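(* Let $n\geq 1$ and let $\phi\colon\mathbb{R}^n\to\mathbb{R}$ be a $C^\infty$ function. Suppose that for some exponent $s\in(2,\infty)$ there is a finite constant $C_{n,\phi}$ such that the Strichartz-type estimate $$\big\| (e^{i t \phi(D)} f)(x) \big\|_{L^s_{(x,t)}(\mathbb{R}^n\times\mathbb{R})} \leq C_{n,\phi}\, \|f\|_{L^2(\mathbb{R}^n)}$$ holds for every Schwartz function $f\in\mathcal{S}(\mathbb{R}^n)$. Then for every $\psi\in\mathcal{S}(\mathbb{R}^{n+1})$ there is a finite constant $C$, depending only on $n,\phi,\psi,s$, such that for any choice of measurable functions $r_1,\ldots,r_{n+1}\colon\mathbb{R}^n\to\mathbb{R}$ the pseudo-differential operator $$(T_{\psi,r_1,\ldots,r_{n+1}}f)(x,t) := \int_{\mathbb{R}^n} \psi\big(r_1(\xi)x_1,\ldots,r_n(\xi)x_n,r_{n+1}(\xi)t\big) \,e^{i t \phi(\xi) + 2\pi i x\cdot\xi}\, \widehat{f}(\xi) \,\mathrm{d}\xi$$ satisfies $$\| T_{\psi,r_1,\ldots,r_{n+1}} f \|_{L^s(\mathbb{R}^{n+1})} \leq C\, \|f\|_{L^2(\mathbb{R}^n)}$$ for every $f\in\mathcal{S}(\mathbb{R}^n)$. In particular, the constant $C$ is independent of $r_1,\ldots,r_{n+1}$.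
   Context: The Fourier transform is $\widehat{f}(\xi)=\int_{\mathbb{R}^n} f(x)e^{-2\pi i x\cdot\xi}\,\mathrm{d}x$. $\mathcal{S}(\mathbb{R}^m)$ is the Schwartz space. $\phi(D)$ is the Fourier multiplier operator with symbol $\phi$, i.e. $\widehat{\phi(D)f}(\xi)=\phi(\xi)\widehat{f}(\xi)$, and for $f\in\mathcal{S}(\mathbb{R}^n)$, $x\in\mathbb{R}^n$, $t\in\mathbb{R}$, $$(e^{i t \phi(D)} f)(x) := \int_{\mathbb{R}^n} e^{i t \phi(\xi) + 2\pi i x\cdot\xi}\, \widehat{f}(\xi) \,\mathrm{d}\xi,$$ which is the solution $u(x,t)$ of the initial value problem $\partial_t u = i\phi(D)u$ in $\mathbb{R}^n\times\mathbb{R}$, $u(x,0)=f(x)$. *)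

(* Defs.v *)
From HB Require Import structures.
From mathcomp Require Import all_boot all_order all_algebra.
From mathcomp Require Import all_classical all_reals all_analysis.
From mathcomp Require Import measurable_realfun.
From mathcomp Require Import complex.

Set Implicit Arguments.
Unset Strict Implicit.
Unset Printing Implicit Defensive.

Import Order.TTheory GRing.Theory Num.Theory.
Import numFieldNormedType.Exports.

Local Open Scope classical_set_scope.
Local Open Scope ring_scope.
Local Open Scope complex_scope.

Definition measure_rV_display : measure_display -> measure_display.
Proof. exact. Qed.

(* As for n.-tuple T, the sigma-algebra on row vectors is the one generated by
   the coordinates; for R it is the Borel sigma-algebra of R^n. *)
Section measurable_rV.
Context d (T : sigmaRingType d) (n : nat).

Let coord (i : 'I_n) (x : 'rV[T]_n) : T := x ord0 i.

Let rV_set0 : g_sigma_preimage coord set0.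
Proof. exact: sigma_algebra0. Qed.

Let rV_setC A : g_sigma_preimage coord A -> g_sigma_preimage coord (~` A).
Proof. exact: sigma_algebraC. Qed.

Let rV_bigcup (F : _^nat) : (forall i, g_sigma_preimage coord (F i)) ->
  g_sigma_preimage coord (\bigcup_i (F i)).
Proof. exact: sigma_algebra_bigcup. Qed.

HB.instance Definition _ := @isMeasurable.Build (measure_rV_display d)
  ('rV[T]_n) (g_sigma_preimage coord) rV_set0 rV_setC rV_bigcup.

End measurable_rV.

Lemma measurable_rV_coord d (T : sigmaRingType d) n (i : 'I_n) :
  measurable_fun [set: 'rV[T]_n] (fun x => x ord0 i).
Proof.
move=> _ Y mY; rewrite setTI; apply: sub_sigma_algebra => /=.
rewrite -bigcup_seq/=; exists i => /=; first by rewrite mem_index_enum.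
by exists Y => //; rewrite setTI.
Qed.

Lemma measurable_fun_rVP d d' (T : measurableType d) (T' : measurableType d')
    n (f : T -> 'rV[T']_n) :
  measurable_fun [set: T] f <->
  forall i, measurable_fun [set: T] (fun x => f x ord0 i).
Proof.
split=> [mf i|mf].
  exact: measurableT_comp (@measurable_rV_coord _ _ _ i) mf.
pose coord (i : 'I_n) (x : 'rV[T']_n) := x ord0 i.
move=> _ A mA; rewrite setTI.
have : preimage_set_system [set: T] f (g_sigma_preimage coord) (f @^-1` A).
  by exists A => //; rewrite setTI.
rewrite -g_sigma_preimage_comp.
apply: smallest_sub => //; first exact: sigma_algebra_measurable.
rewrite -bigcup_seq => B /= [i _] [C mC <-].
by apply: mf => //; exact: measurableT.
Qed.

(* (x, t) |-> (x_1, ..., x_n, t) *)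
Definition rV_snoc (T : Type) n (z : 'rV[T]_n * T) : 'rV[T]_n.+1 :=
  \row_(i < n.+1) oapp (z.1 ord0) z.2 (unlift ord_max i).

Lemma measurable_rV_snoc d (T : measurableType d) n :
  measurable_fun [set: 'rV[T]_n * T] (@rV_snoc T n).
Proof.
apply/measurable_fun_rVP => i.
under eq_fun do rewrite /rV_snoc mxE.
case: (unlift ord_max i) => [j|] /=; last exact: measurable_snd.
exact: measurableT_comp (@measurable_rV_coord _ _ _ j) measurable_fst.
Qed.

Section lebesgue_snoc.
Context (R : realType) (n : nat) (mu : {measure set 'rV[R]_n -> \bar R}).

Definition lebesgue_snoc : set 'rV[R]_n.+1 -> \bar R :=
  pushforward (mu \x lebesgue_measure)%E (@rV_snoc R n).

Let measurable_snoc : measurable_fun [set: 'rV[R]_n * measurableTypeR R]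
  (@rV_snoc R n).
Proof. exact: measurable_rV_snoc. Qed.

Let snoc0 : lebesgue_snoc set0 = 0%E.
Proof. exact: measure0. Qed.

Let snoc_ge0 A : (0 <= lebesgue_snoc A)%E.
Proof. exact: measure_ge0. Qed.

Let snoc_sigma_additive : semi_sigma_additive lebesgue_snoc.
Proof. exact: measure_semi_sigma_additive. Qed.

HB.instance Definition _ := isMeasure.Build _ _ _ lebesgue_snoc
  snoc0 snoc_ge0 snoc_sigma_additive.

End lebesgue_snoc.

Fixpoint lebesgue_rV (R : realType) n : {measure set 'rV[R]_n -> \bar R} :=
  if n is m.+1 then lebesgue_snoc (lebesgue_rV R m) else dirac (0 : 'rV[R]_0).

Lemma lebesgue_rV_box (R : realType) n (A : 'I_n -> set R) :
  (forall i, measurable (A i)) ->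
  lebesgue_rV R n [set x | forall i, A i (x ord0 i)] =
  (\prod_(i < n) lebesgue_measure (A i))%E.
Proof.
elim: n A => [|n IHn] A mA; first by rewrite big_ord0 /= diracE mem_set//= => -[].
pose B := [set x : 'rV[R]_n | forall i, A (lift ord_max i) (x ord0 i)].
have mB : measurable B.
  rewrite (_ : B = \big[setI/setT]_(i < n)
      ((fun x : 'rV[R]_n => x ord0 i) @^-1` A (lift ord_max i))).
    apply: bigsetI_measurable => i _; rewrite -[X in measurable X]setTI.
    by apply: measurable_rV_coord => //; exact: measurableT.
  rewrite -bigcap_seq; apply/seteqP; split=> x /= Bx i.
    by move=> _; exact: Bx.
  by apply: (Bx i); rewrite /= mem_index_enum.
rewrite /= /lebesgue_snoc /pushforward /=.
rewrite (_ : _ @^-1` _ = B `*` A ord_max); last first.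
  apply/seteqP; split=> [[x t] /= Axt|[x t] /= [Bx At] i]; last first.
    by rewrite mxE; case: unliftP => [j ->|->].
  split=> [i|]; first by have := Axt (lift ord_max i); rewrite mxE liftK.
  by have := Axt ord_max; rewrite mxE unlift_none.
rewrite (@product_measure1E _ _ _ (measurableTypeR R) _ (lebesgue_rV R n)
  lebesgue_measure _ _ mB (mA ord_max)).
rewrite (IHn (fun i => A (lift ord_max i)))// big_ord_recr /=.
congr (_ * _)%E; apply: eq_bigr => i _; congr (lebesgue_measure (A _)).
by apply/val_inj; rewrite /= /bump leqNgt ltn_ord.
Qed.

(* Measurability for the completion of Lebesgue measure, which is weaker than
   measurable_fun (Borel measurability). *)
Definition lebesgue_measurable_fun (R : realType) n (f : 'rV[R]_n -> R) :=
  forall B : set R, measurable B ->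
    completed_algebra_gen (lebesgue_rV R n) (f @^-1` B).

Section smooth_schwartz.
Context (R : realType) (n : nat).
Implicit Types (f : 'rV[R]_n -> R) (s : seq 'I_n).

Definition partial (i : 'I_n) f : 'rV[R]_n -> R := 'D_(delta_mx ord0 i) f.

Definition partials s f : 'rV[R]_n -> R := foldr partial f s.

(* 'D_v f is a total function, so that the existence of the iterated partial
   derivatives has to be required separately. The sequence s lists the
   directions of differentiation in order, with repetitions; for smooth
   functions the order is immaterial, so s stands for a multi-index. *)
Definition smooth f := forall s, continuous (partials s f) /\
  forall i x, derivable (partials s f) x (delta_mx ord0 i).

Definition monomial (alpha : 'I_n -> nat) (x : 'rV[R]_n) : R :=
  \prod_(i < n) x ord0 i ^+ alpha i.

Definition schwartz_real f := smooth f /\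
  forall alpha s, exists M : R, forall x,
    `|monomial alpha x * partials s f x| <= M.

(* S(R^n) consists of complex-valued functions; derivatives are taken
   componentwise. *)
Definition schwartz (f : 'rV[R]_n -> R[i]) :=
  schwartz_real (fun x => complex.Re (f x)) /\
  schwartz_real (fun x => complex.Im (f x)).

End smooth_schwartz.

Section complex_integral.
Context d (T : measurableType d) (R : realType).
Variable mu : {measure set T -> \bar R}.

(* The real integral is a difference of suprema over simple functions below the
   positive and negative parts, so that it also has its usual value when the
   components of f are only measurable for the completion of mu. *)
Definition cintegral (f : T -> R[i]) : R[i] :=
  (\int[mu]_x complex.Re (f x)) +i* (\int[mu]_x complex.Im (f x)).

Definition cLnorm (p : \bar R) (f : T -> R[i]) : \bar R :=
  Lnorm mu p (fun x => (Normc.normc (f x))%:E).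

End complex_integral.

Section evolution.
Context (R : realType) (n : nat).
Implicit Types (x xi : 'rV[R]_n) (f : 'rV[R]_n -> R[i]) (phi : 'rV[R]_n -> R).

Definition dotrV x xi : R := \sum_(i < n) x ord0 i * xi ord0 i.

Definition expi (theta : R) : R[i] := cos theta +i* sin theta.

Definition fourier f xi : R[i] :=
  cintegral (lebesgue_rV R n)
    (fun x => f x * expi (- (2 * pi * dotrV x xi))).

Definition evolution phi f (z : 'rV[R]_n * R) : R[i] :=
  cintegral (lebesgue_rV R n)
    (fun xi => expi (z.2 * phi xi + 2 * pi * dotrV z.1 xi) * fourier f xi).

Definition pseudo_diff phi (psi : 'rV[R]_n.+1 -> R[i])
    (r : 'I_n.+1 -> 'rV[R]_n -> R) f (z : 'rV[R]_n * R) : R[i] :=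
  cintegral (lebesgue_rV R n)
    (fun xi => psi (\row_i (r i xi * rV_snoc z ord0 i)) *
       expi (z.2 * phi xi + 2 * pi * dotrV z.1 xi) * fourier f xi).

(* Lebesgue measure on R^n x R. Its image under (x, t) |-> (x_1, ..., x_n, t) is
   lebesgue_rV R n.+1 by definition. *)
Definition lebesgue_xt : {measure set ('rV[R]_n * measurableTypeR R) -> \bar R} :=
  (lebesgue_rV R n \x lebesgue_measure)%E.

End evolution.

(* Main.v *)
(** Write the amplitude as an average of indicators of orthants, [psi v = (-1)^d * \int d_1 ... d_d psi(u) 1_{v_j < u_j for all j} du]. Then T f(z) is an average over u of the restrictions of the Fourier integral of f to the frequency sets [{xi | r_j(xi) z_j < u_j for all j}]. For fixed z each such set is an intersection of n+1 sub- or superlevel sets of the r_j, so |T f| is at most a constant depending on psi times a maximal function over those sets. The sublevel sets of one function form a chain, and since s > 2 the Christ-Kiselev lemma passes from the Strichartz estimate to the maximal function over a chain with a loss depending only on s; applying it once per coordinate gives a constant independent of r. To restrict to arbitrary frequency sets, the Strichartz estimate is first extended from the Fourier transforms of Schwartz functions to all measurable frequency functions dominated by an integrable weight, by Gaussian regularization. The Fourier inversion and Plancherel theorems are replaced by the explicit Gaussian transform and the inequality that the Fourier transform does not increase the L^2 norm (up to a factor).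

All integrals are real: sines are cosines with phase shift [- pi / 2]. *)

From HB Require Import structures.
Require Import Defs.
From mathcomp Require Import all_boot all_order all_algebra.
From mathcomp Require Import all_classical all_reals all_analysis.
From mathcomp Require Import measurable_realfun.
From mathcomp Require Import complex.
From mathcomp Require Import ring lra.

Set Implicit Arguments.
Unset Strict Implicit.
Unset Printing Implicit Defensive.

Import Order.TTheory GRing.Theory Num.Theory.
Import numFieldNormedType.Exports.

Local Open Scope classical_set_scope.
Local Open Scope ring_scope.

(** Sharp frequency cutoffs destroy the Schwartz class, while the hypothesis speaks of Schwartz data
    only. For rough [G] the function [gauss_inverse G e] is Schwartz, its Fourier transform is a
    mollification of [G], and its L^2 norm is at most [sqrt 2] times that of [G]; Fatou then removes
    the mollification. The level sets of one function form a continuum, but the Christ-Kiselev lemma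
    is proved by induction on the length of a finite chain, with a constant that does not see this
    length. Levels are therefore taken on finite grids, and the grid is refined only at the end, for
    each [z] separately. A maximal function is no longer linear, so the lemma is stated for
    subadditive set functions ([admissible]), a class that contains its own maximal functions; this
    is what allows one application per coordinate. Each costs a factor [2 * D], where [D] depends on
    [s] only and 2 counts the possible signs of the coordinate of [z]. The average over [u] costs
    the integral of a weight dominating the mixed derivative of [psi]. *)

Local Notation phase phi z xi := (z.2 * phi xi + 2 * pi * dotrV z.1 xi).
Local Notation integrableR mu f := (mu.-integrable setT (EFin \o f)).

(** * Integration on R^n *)

Section rV_basics.
Context {R : realType}.

Lemma cvg_rV n (T : Type) (F : set_system T) (FF : Filter F)
    (f : T -> 'rV[R]_n) (l : 'rV[R]_n) :
  (forall i, f t ord0 i @[t --> F] --> l ord0 i) -> f @ F --> l.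
Proof.
move=> fl A [P lP PA]; rewrite /= nbhs_filterE /=.
have : \forall t \near F, forall i, P ord0 i (f t ord0 i).
  by apply: filter_forall => i; apply: fl; exact: lP.
by apply: filterS => t Pt; apply: PA => i j; rewrite (ord1 i); exact: Pt.
Qed.

Lemma measurable_rV_all n (A : 'I_n -> set R) : (forall i, measurable (A i)) ->
  measurable [set x : 'rV[R]_n | forall i, A i (x ord0 i)].
Proof.
move=> mA; rewrite (_ : mkset _ =
    \bigcap_(i in [set: 'I_n]) ((fun x : 'rV[R]_n => x ord0 i) @^-1` A i)).
  apply: fin_bigcap_measurable => // i _; rewrite -[X in measurable X]setTI.
  by apply: measurable_rV_coord => //; exact: measurableT.
by apply/seteqP; split=> y yz /= i => [_|]; exact: yz.
Qed.

(** The sigma-algebra comes from the coordinates, not from the topology. [f] is the pointwise limit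
    of [f] composed with rounding down to the lattice of step [1 / (k + 1)], and the rounding takes
    countably many values, each on a measurable box. *)
Lemma rV_continuous_measurable n (f : 'rV[R]_n -> R) :
  continuous f -> measurable_fun [set: 'rV[R]_n] f.
Proof.
move=> cf.
pose rd (k : nat) (x : 'rV[R]_n) : 'rV[R]_n :=
  \row_i ((Num.floor (k.+1%:R * x ord0 i))%:~R / k.+1%:R).
apply: (@measurable_fun_cvg _ _ _ _ (fun k x => f (rd k x))) => [k|x _].
  move=> _ Y mY; rewrite setTI.
  pose F (z : 'rV[int]_n) : set 'rV[R]_n :=
    if f (\row_i ((z ord0 i)%:~R / k.+1%:R)) \in Y then
     [set x | forall i, Num.floor (k.+1%:R * x ord0 i) = z ord0 i] else set0.
  rewrite (_ : _ @^-1` _ = \bigcup_z F z); last first.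
    apply/seteqP; split=> [x /= Yx|x [z _]].
      exists (\row_i Num.floor (k.+1%:R * x ord0 i)) => //.
      rewrite /F mem_set => [i|]; first by rewrite mxE.
      by rewrite /rd in Yx; under eq_mx do rewrite mxE //.
    rewrite /F; case: ifPn => //; rewrite inE => Yz /= xz.
    by rewrite /rd; under eq_mx do rewrite xz.
  apply: countable_bigcupT_measurable => [|z]; first exact: countableP.
  rewrite /F; case: ifPn => _; last exact: measurable0.
  apply: (@measurable_rV_all n
    (fun i => [set t : R | Num.floor (k.+1%:R * t) = z ord0 i])) => i.
  rewrite (_ : mkset _ = ( *%R k.+1%:R) @^-1` `[(z ord0 i)%:~R, (z ord0 i + 1)%:~R[).
    by rewrite -[X in measurable X]setTI; exact: mulrl_measurable.
  by apply/seteqP; split => t /=; rewrite in_itv/= -floor_eq => /eqP.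
apply: continuous_cvg; first exact: cf.
apply: cvg_rV => i.
apply/cvgrPdist_le => e e0.
near=> k.
rewrite mxE.
have k0 : 0 < k.+1%:R :> R by rewrite ltr0n.
have /andP[h1 h2] := floor_itv (k.+1%:R * x ord0 i).
have -> : x ord0 i - (Num.floor (k.+1%:R * x ord0 i))%:~R / k.+1%:R
   = (k.+1%:R * x ord0 i - (Num.floor (k.+1%:R * x ord0 i))%:~R) / k.+1%:R.
  by field.
rewrite normrM normfV (@gtr0_norm _ k.+1%:R)// ler_pdivrMr//.
apply: (@le_trans _ _ 1).
  by rewrite ger0_norm ?subr_ge0// lerBlDr addrC; apply: ltW; rewrite intrD in h2.
rewrite -ler_pdivrMl// mulr1.
rewrite -[leLHS]gtr0_norm ?invr_gt0//.
have : e^-1 <= k.+1%:R.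
  rewrite (le_trans _ (_ : k%:R <= _)) ?ler_nat//.
  near: k; exact: nbhs_infty_ger.
by rewrite ger0_norm// invr_ge0 ltW.
Unshelve. all: by end_near. Qed.

End rV_basics.

(* An alias of [lebesgue_rV R n], which as a fixpoint cannot carry an instance of sigma-finiteness. *)
Definition rVleb (R : realType) n : set 'rV[R]_n -> \bar R := lebesgue_rV R n.

Section rVleb.
Context (R : realType) (n : nat).

HB.instance Definition _ := Measure.copy (@rVleb R n) (lebesgue_rV R n).

Let rVleb_sigma_finite : sigma_finite setT (@rVleb R n).
Proof.
exists (fun k => [set x : 'rV[R]_n | forall i, `[- k%:R, k%:R]%classic (x ord0 i)]).
  apply/seteqP; split => // x _.
  have /(_ _)/cid-/all_sig[N HN] : forall i : 'I_n, exists k : nat, `|x ord0 i| <= k%:R.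
    by move=> i; exists (Num.trunc `|x ord0 i|).+1; apply/ltW; rewrite truncnS_gt.
  exists (\max_i N i)%N => //= i; rewrite in_itv/= -ler_norml.
  by rewrite (le_trans (HN i))// ler_nat; exact: leq_bigmax.
move=> k; split.
  exact: (@measurable_rV_all R n (fun=> `[- k%:R, k%:R]%classic)).
rewrite /rVleb (@lebesgue_rV_box R n (fun=> `[- k%:R, k%:R]%classic))//.
rewrite (eq_bigr (fun=> (k%:R *+ 2)%:E)) ?prodEFin ?ltry// => i _.
rewrite lebesgue_measure_itv/= lte_fin; case: ifPn => [_|].
  by rewrite -EFinD opprK -mulr2n.
rewrite -leNgt => k0; suff -> : k%:R = 0 :> R by rewrite mul0rn.
by have := ler0n R k; lra.
Qed.

HB.instance Definition _ :=
  Measure_isSigmaFinite.Build _ _ _ (@rVleb R n) rVleb_sigma_finite.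

End rVleb.

Arguments rVleb : clear implicits.

(** A nonnegative integral is a supremum over the simple functions below the integrand, so
    monotonicity holds for arbitrary functions. *)
Lemma ge0_le_integralT d (T : measurableType d) (R : realType) (mu : {measure set T -> \bar R})
    (f g : T -> \bar R) : (forall x, 0 <= f x)%E -> (forall x, f x <= g x)%E ->
  (\int[mu]_x f x <= \int[mu]_x g x)%E.
Proof.
move=> f0 fg; have g0 x : (0 <= g x)%E by exact: le_trans (fg x).
rewrite !ge0_integralTE//; apply: le_ereal_sup => _ [h /= hf <-].
by exists h => // x; exact: le_trans (fg x).
Qed.

Section integral_tools.
Context d (T : measurableType d) (R : realType).
Variable mu : {measure set T -> \bar R}.
Implicit Types f g h : T -> R.

Lemma le_integrableR f g : measurable_fun setT f ->
  (forall x, `|f x| <= g x) ->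
  integrableR mu g -> integrableR mu f.
Proof.
move=> mf fg ig; apply: le_integrable ig => //; first exact/measurable_EFinP.
by move=> x _ /=; rewrite lee_fin (le_trans (fg x))// ler_norm.
Qed.

Lemma integrableRZl (a : R) f : integrableR mu f ->
  integrableR mu (fun x => a * f x).
Proof. by move=> fi; have := integrableZl measurableT a fi; apply: eq_integrable. Qed.

Lemma integrableRZr (a : R) f : integrableR mu f ->
  integrableR mu (fun x => f x * a).
Proof. by move=> fi; have := integrableZr measurableT a fi; apply: eq_integrable. Qed.

Lemma integrableRD f g : integrableR mu f -> integrableR mu g ->
  integrableR mu (fun x => f x + g x).
Proof. by move=> fi gi; have := integrableD measurableT fi gi; apply: eq_integrable. Qed.

Lemma integrableRB f g : integrableR mu f -> integrableR mu g ->
  integrableR mu (fun x => f x - g x).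
Proof. by move=> fi gi; have := integrableB measurableT fi gi; apply: eq_integrable. Qed.

Lemma measurable_intR f : integrableR mu f -> measurable_fun setT f.
Proof. by move=> /measurable_int/measurable_EFinP. Qed.

Lemma integrableMbound f h M : integrableR mu f ->
  measurable_fun setT h -> (forall x, `|h x| <= M) ->
  integrableR mu (fun x => f x * h x).
Proof.
move=> fi mh hM; apply: (@le_integrableR _ (fun x => `|f x| * M)).
- by apply: measurable_funM => //; exact: measurable_intR.
- by move=> x; rewrite normrM ler_wpM2l.
- have := integrableZr measurableT M (integrable_norm fi).
  by apply: eq_integrable => // x _; rewrite /= EFinM.
Qed.

Lemma ge0_integralRZl (a : R) f : 0 <= a -> (forall x, 0 <= f x) -> measurable_fun setT f ->
  (\int[mu]_x (a * f x)%:E = a%:E * \int[mu]_x (f x)%:E)%E.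
Proof.
move=> a0 f0 mf; under eq_integral do rewrite EFinM.
by rewrite ge0_integralZl_EFin//; [move=> x _; rewrite lee_fin|apply/measurable_EFinP].
Qed.

Lemma ge0_integralRD f g : (forall x, 0 <= f x) -> (forall x, 0 <= g x) ->
  measurable_fun setT f -> measurable_fun setT g ->
  (\int[mu]_x (f x + g x)%:E = \int[mu]_x (f x)%:E + \int[mu]_x (g x)%:E)%E.
Proof.
move=> f0 g0 mf mg; under eq_integral do rewrite EFinD.
by rewrite ge0_integralD//; [move=> x _; rewrite lee_fin|apply/measurable_EFinP|
  move=> x _; rewrite lee_fin|apply/measurable_EFinP].
Qed.

Lemma measurable_fun_powR f s : measurable_fun setT f -> measurable_fun setT (fun x => f x `^ s).
Proof. exact: measurableT_comp (measurable_powR s). Qed.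

Lemma integral_EFinR f : integrableR mu f ->
  (\int[mu]_x (f x)%:E)%E = (\int[mu]_x f x)%:E.
Proof. by move=> fi; rewrite /Rintegral fineK//; exact: integrable_fin_num. Qed.

Lemma cvg_Rintegral (f_ : nat -> T -> R) f g :
  (forall k, measurable_fun setT (f_ k)) ->
  (forall x, f_ k x @[k --> \oo] --> f x) ->
  integrableR mu g ->
  (forall k x, `|f_ k x| <= g x) ->
  integrableR mu f /\ \int[mu]_x f_ k x @[k --> \oo] --> \int[mu]_x f x.
Proof.
move=> mf_ ff ig fg.
have mf : measurable_fun setT f.
  by apply: (measurable_fun_cvg mf_) => x _; exact: ff.
have ff' : {ae mu, forall x, setT x -> (f_ k x)%:E @[k --> \oo] --> (EFin \o f) x}.
  by apply: aeW => x _; apply: cvg_EFin; [exact: nearW|exact: ff].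
have fg' : {ae mu, forall x k, setT x -> (`|(f_ k x)%:E| <= (EFin \o g) x)%E}.
  by apply: aeW => x k _; exact: fg.
have [fi _ cf] := @dominated_convergence _ _ _ mu setT measurableT
   (fun k x => (f_ k x)%:E) (EFin \o f) (EFin \o g)
   (fun k => (measurable_EFinP _ _).2 (mf_ k)) ((measurable_EFinP _ _).2 mf)
   ff' ig fg'.
split => //.
by apply: fine_cvg; rewrite -integral_EFinR.
Qed.

Lemma normr_Rintegral_le f g : measurable_fun setT f ->
  integrableR mu g -> (forall x, `|f x| <= g x) ->
  `|\int[mu]_x f x| <= \int[mu]_x g x.
Proof.
move=> mf gi fg; have fi := le_integrableR mf fg gi.
apply: (le_trans (le_normr_Rintegral _ _)) => //.
by apply: le_Rintegral => //; exact: integrable_norm.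
Qed.

End integral_tools.

Section fubini_tools.
Context d1 d2 (T1 : measurableType d1) (T2 : measurableType d2) (R : realType).
Variable m1 : {sigma_finite_measure set T1 -> \bar R}.
Variable m2 : {sigma_finite_measure set T2 -> \bar R}.
Variables (h : T1 * T2 -> R) (a : T1 -> R) (b : T2 -> R).
Hypothesis mh : measurable_fun setT h.
Hypothesis ai : integrableR m1 a.
Hypothesis bi : integrableR m2 b.
Hypothesis hab : forall x y, `|h (x, y)| <= a x * b y.

Lemma integrable_prod_dominated : integrableR (m1 \x m2)%E h.
Proof.
apply/integrable12ltyP; first exact/measurable_EFinP.
have mh1 x : measurable_fun setT (fun y => `|(h (x, y))|%:E).
  apply/measurable_EFinP/measurableT_comp => //.
  exact: measurableT_comp mh (measurable_pair1 x).
have le1 x : (\int[m2]_y `|(h (x, y))|%:E <= `|a x|%:E * \int[m2]_y `|b y|%:E)%E.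
  rewrite -ge0_integralZl_EFin//; last exact/measurable_EFinP/measurableT_comp/(measurable_intR bi).
  apply: ge0_le_integralT => // y.
  by rewrite -EFinM lee_fin -normrM (le_trans (hab _ _))// ler_norm.
have bfin : (\int[m2]_y `|b y|%:E < +oo)%E by case/integrableP : bi.
apply: (@le_lt_trans _ _ (\int[m1]_x (`|a x|%:E * \int[m2]_y `|b y|%:E))%E).
  by apply: ge0_le_integralT => // x; exact: integral_ge0.
rewrite ge0_integralZr//.
- rewrite lte_mul_pinfty//; first exact: integral_ge0.
    rewrite ge0_fin_numE ?integral_ge0//.
    by case/integrableP : ai.
- exact/measurable_EFinP/measurableT_comp/(measurable_intR ai).
- exact: integral_ge0.
Qed.

Let hx_int x : integrableR m2 (fun y => h (x, y)).
Proof.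
apply: (le_integrableR _ _ (_ : integrableR m2 (fun y => a x * b y))).
- exact: measurableT_comp mh (measurable_pair1 x).
- by move=> y; exact: hab.
- exact: integrableRZl.
Qed.

Let hy_int y : integrableR m1 (fun x => h (x, y)).
Proof.
apply: (le_integrableR _ _ (_ : integrableR m1 (fun x => a x * b y))).
- exact: measurableT_comp mh (measurable_pair2 y).
- by move=> x; exact: hab.
- exact: integrableRZr.
Qed.

Lemma measurable_Rintegral_prod1 : measurable_fun setT (fun x => \int[m2]_y h (x, y)).
Proof.
apply/measurable_EFinP.
rewrite (_ : _ \o _ = fubini_F m2 (EFin \o h)).
  exact: measurable_fubini_F integrable_prod_dominated.
by apply/funext => x; rewrite /= -integral_EFinR.
Qed.

Lemma measurable_Rintegral_prod2 : measurable_fun setT (fun y => \int[m1]_x h (x, y)).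
Proof.
apply/measurable_EFinP.
rewrite (_ : _ \o _ = fubini_G m1 (EFin \o h)).
  exact: measurable_fubini_G integrable_prod_dominated.
by apply/funext => y; rewrite /= -integral_EFinR.
Qed.

Lemma Rintegral_swap :
  \int[m1]_x (\int[m2]_y h (x, y)) = \int[m2]_y (\int[m1]_x h (x, y)).
Proof.
rewrite /(Rintegral m1) /(Rintegral m2 setT (fun y => fine _)).
congr fine.
have := Fubini integrable_prod_dominated; rewrite /=.
under eq_integral => x _ do rewrite integral_EFinR//.
by under [in RHS]eq_integral => x _ do rewrite integral_EFinR//.
Qed.

Lemma Rintegral_prod :
  \int[(m1 \x m2)%E]_z h z = \int[m1]_x (\int[m2]_y h (x, y)).
Proof.
rewrite {1 2}/Rintegral -(integral12_prod_meas1 integrable_prod_dominated).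
congr fine; apply: eq_integral => x _.
by rewrite /fubini_F integral_EFinR.
Qed.

End fubini_tools.

Section rV_snoc_integral.
Context {R : realType}.
Local Notation leb := (@lebesgue_measure R).

Lemma rV_snoc_lift n (z : 'rV[R]_n * R) i : rV_snoc z ord0 (lift ord_max i) = z.1 ord0 i.
Proof. by rewrite mxE liftK. Qed.

Lemma rV_snoc_max n (z : 'rV[R]_n * R) : rV_snoc z ord0 ord_max = z.2.
Proof. by rewrite mxE unlift_none. Qed.

Lemma big_ord_lift_max (T : Type) (idx : T) (op : Monoid.law idx) n (F : 'I_n.+1 -> T) :
  \big[op/idx]_(i < n.+1) F i = op (\big[op/idx]_(i < n) F (lift ord_max i)) (F ord_max).
Proof.
rewrite big_ord_recr/=; congr (op _ _); apply: eq_bigr => i _.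
by congr F; apply/val_inj; rewrite /= /bump leqNgt ltn_ord.
Qed.

Lemma ge0_integral_snoc n (f : 'rV[R]_n.+1 -> \bar R) :
  measurable_fun setT f -> (forall x, 0 <= f x)%E ->
  (\int[rVleb R n.+1]_x f x = \int[rVleb R n]_x \int[leb]_t f (rV_snoc (x, t)))%E.
Proof.
move=> mf f0.
have -> : (\int[rVleb R n.+1]_x f x = \int[rVleb R n \x leb]_z (f \o @rV_snoc R n) z)%E.
  have := @ge0_integral_pushforward _ _ ('rV[R]_n * measurableTypeR R)%type ('rV[R]_n.+1) R (@rV_snoc R n)
    (@measurable_rV_snoc _ (measurableTypeR R) n)
    (rVleb R n \x leb)%E setT f measurableT mf (fun y _ => f0 y).
  by rewrite preimage_setT.
rewrite fubini_tonelli1//; last by move=> z; exact: f0.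
exact: measurableT_comp mf (@measurable_rV_snoc _ (measurableTypeR R) n).
Qed.

Section dominated.
Context (n : nat) (f : 'rV[R]_n.+1 -> R) (a : 'rV[R]_n -> R) (b : R -> R).
Hypothesis mf : measurable_fun setT f.
Hypothesis ai : integrableR (rVleb R n) a.
Hypothesis bi : integrableR leb b.
Hypothesis fab : forall x t, `|f (rV_snoc (x, t))| <= a x * b t.

Let mfs : measurable_fun [set: 'rV[R]_n * measurableTypeR R] (f \o @rV_snoc R n).
Proof. exact: measurableT_comp mf (@measurable_rV_snoc _ (measurableTypeR R) n). Qed.

Lemma integrable_snoc : integrableR (rVleb R n.+1) f.
Proof.
apply: (@integrable_pushforward _ _ ('rV[R]_n * measurableTypeR R)%type ('rV[R]_n.+1) R (@rV_snoc R n)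
    (@measurable_rV_snoc _ (measurableTypeR R) n)
    (rVleb R n \x leb)%E setT (EFin \o f)) => //.
  exact/measurable_EFinP.
rewrite preimage_setT; exact: (integrable_prod_dominated mfs ai bi fab).
Qed.

Lemma Rintegral_snoc :
  \int[rVleb R n.+1]_x f x = \int[rVleb R n]_x \int[leb]_t f (rV_snoc (x, t)).
Proof.
have <- := @Rintegral_prod _ _ _ _ _ (rVleb R n) leb (f \o @rV_snoc R n) _ _ mfs ai bi fab.
rewrite /Rintegral; congr fine.
have := @integral_pushforward _ _ ('rV[R]_n * measurableTypeR R)%type ('rV[R]_n.+1) R (@rV_snoc R n)
    (@measurable_rV_snoc _ (measurableTypeR R) n)
    (rVleb R n \x leb)%E setT (EFin \o f).
rewrite preimage_setT; apply => //.
  exact/measurable_EFinP.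
exact: (integrable_prod_dominated mfs ai bi fab).
Qed.

End dominated.

(** Both measures give a half-open interval its length, so uniqueness of Lebesgue measure identifies
    them. *)
Lemma lebesgue_measureD (v : R) (A : set R) : measurable A ->
  pushforward leb ((fun x => x + v) : _ -> measurableTypeR R) A = leb A.
Proof.
move=> mA.
have mv : measurable_fun [set: measurableTypeR R] ((fun x => x + v) : _ -> measurableTypeR R).
  exact: measurable_funD.
apply/esym/(@lebesgue_measure_unique R (pushforward leb ((fun x => x + v) : _ -> measurableTypeR R))) => //= _ [[a b]] _ <-.
rewrite /pushforward (_ : _ @^-1` _ = `]a - v, b - v]%classic).
  rewrite !lebesgue_measure_itv/= !lte_fin ltrD2r.
  by case: ifP => // _; rewrite -!EFinD; congr EFin; ring.
by apply/seteqP; split=> x /=; rewrite !in_itv/= ltrBlDr lerBrDr.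
Qed.

Lemma ge0_integral_shift1 (v : R) (f : R -> \bar R) : measurable_fun setT f ->
  (forall x, 0 <= f x)%E -> (\int[leb]_x f (x + v)%R = \int[leb]_x f x)%E.
Proof.
move=> mf f0.
have mv : measurable_fun [set: measurableTypeR R] ((fun x => x + v) : _ -> measurableTypeR R).
  exact: measurable_funD.
have := @ge0_integral_pushforward _ _ _ _ R _ mv leb setT f measurableT mf (fun y _ => f0 y).
rewrite preimage_setT => <-.
by apply: eq_measure_integral => //= A mA _; exact: lebesgue_measureD.
Qed.

Lemma measurable_fun_rVD d (T : measurableType d) n (f g : T -> 'rV[R]_n) :
  measurable_fun setT f -> measurable_fun setT g -> measurable_fun setT (fun t => f t + g t).
Proof.
move=> /measurable_fun_rVP mf /measurable_fun_rVP mg; apply/measurable_fun_rVP => i.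
by under eq_fun do rewrite mxE; exact: measurable_funD.
Qed.

Lemma measurable_fun_rVB d (T : measurableType d) n (f g : T -> 'rV[R]_n) :
  measurable_fun setT f -> measurable_fun setT g -> measurable_fun setT (fun t => f t - g t).
Proof.
move=> /measurable_fun_rVP mf /measurable_fun_rVP mg; apply/measurable_fun_rVP => i.
by under eq_fun do rewrite !mxE; exact: measurable_funB.
Qed.

Lemma measurable_rVD n (v : 'rV[R]_n) : measurable_fun setT (fun x : 'rV[R]_n => x + v).
Proof. exact: measurable_fun_rVD. Qed.

Lemma ge0_integral_shift n (v : 'rV[R]_n) (f : 'rV[R]_n -> \bar R) :
  measurable_fun setT f -> (forall x, 0 <= f x)%E ->
  (\int[rVleb R n]_x f (x + v)%R = \int[rVleb R n]_x f x)%E.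
Proof.
elim: n v f => [v f mf f0|n IHn v f mf f0].
  by apply: eq_integral => x _; congr f; apply/rowP => -[].
pose v1 : 'rV[R]_n := \row_i v ord0 (lift ord_max i).
pose v2 := v ord0 ord_max.
rewrite (ge0_integral_snoc (f := fun x => f (x + v)));
  [|exact: measurableT_comp mf (measurable_rVD v)|by move=> x; exact: f0].
rewrite (ge0_integral_snoc mf f0).
have mfs : measurable_fun [set: 'rV[R]_n * measurableTypeR R] (f \o @rV_snoc R n).
  exact: measurableT_comp mf (@measurable_rV_snoc _ (measurableTypeR R) n).
have sE x t : rV_snoc (x, t) + v = rV_snoc (x + v1, t + v2).
  apply/rowP => i; case: (unliftP ord_max i) => [j ->|->].
    by rewrite mxE !rV_snoc_lift/= !mxE.
  by rewrite mxE !rV_snoc_max.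
under eq_integral => x _.
  under eq_integral do rewrite sE.
  rewrite (ge0_integral_shift1 v2 (f:= fun t => f (rV_snoc (x + v1, t)))) //; last first.
    exact: measurableT_comp mfs (measurable_pair1 _).
  over.
rewrite (IHn v1 (fun x => \int[leb]_t f (rV_snoc (x, t)))%E)//.
- apply: (@measurable_fun_fubini_tonelli_F _ _ 'rV[R]_n (measurableTypeR R) R leb (f \o @rV_snoc R n) mfs) => z.
  exact: f0.
- by move=> x; exact: integral_ge0.
Qed.

Lemma integrable_shift n (v : 'rV[R]_n) (f : 'rV[R]_n -> R) :
  integrableR (rVleb R n) f ->
  integrableR (rVleb R n) (fun x => f (x + v)).
Proof.
move=> /integrableP[mf fi]; apply/integrableP; split.
  exact: measurableT_comp mf (measurable_rVD v).
by rewrite (ge0_integral_shift v (f := fun x => `|(f x)%:E|%E))//; exact: measurableT_comp.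
Qed.

Lemma Rintegral_shift n (v : 'rV[R]_n) (f : 'rV[R]_n -> R) :
  integrableR (rVleb R n) f ->
  \int[rVleb R n]_x f (x + v) = \int[rVleb R n]_x f x.
Proof.
move=> /measurable_int mf; rewrite /Rintegral integralE [in RHS]integralE.
congr (fine (_ - _)%E).
  have <- := @ge0_integral_shift n v (EFin \o f)^\+%E (measurable_funepos mf)
    (fun x => funepos_ge0 _ x).
  by apply: eq_integral => x _; rewrite !funeposE.
have <- := @ge0_integral_shift n v (EFin \o f)^\-%E (measurable_funeneg mf)
  (fun x => funeneg_ge0 _ x).
by apply: eq_integral => x _; rewrite !funenegE.
Qed.

(* An integrable weight dominating Schwartz functions. *)
Definition wt n (x : 'rV[R]_n) : R := \prod_(i < n) (1 + x ord0 i ^+ 2)^-1.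

Lemma wt_gt0 n (x : 'rV[R]_n) : 0 < wt x.
Proof. by apply: prodr_gt0 => i _; rewrite invr_gt0 ltr_pwDl ?sqr_ge0. Qed.

Lemma wt_le_ge0 n (g : 'rV[R]_n -> R) A : (forall x, `|g x| <= A * wt x) -> 0 <= A.
Proof. by move=> gA; have := le_trans (normr_ge0 _) (gA 0); rewrite pmulr_lge0// wt_gt0. Qed.

Lemma wt_le1 n (x : 'rV[R]_n) : wt x <= 1.
Proof.
apply: prodr_ile1 => i _; rewrite invr_ge0 addr_ge0 ?sqr_ge0//=.
by rewrite invf_le1 ?lerDl ?sqr_ge0// ltr_pwDl ?sqr_ge0.
Qed.

Lemma wt_snoc n (x : 'rV[R]_n) t : wt (rV_snoc (x, t)) = wt x * (1 + t ^+ 2)^-1.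
Proof.
rewrite /wt big_ord_lift_max /= rV_snoc_max; congr (_ * _).
by apply: eq_bigr => i _; rewrite rV_snoc_lift.
Qed.

Lemma measurable_wt n : measurable_fun setT (@wt n).
Proof.
apply: measurable_prod => i _.
have c1 : continuous (fun t : R => (1 + t ^+ 2)^-1) by exact: continuous_oneDsqrV.
exact: measurableT_comp (continuous_measurable_fun c1) (@measurable_rV_coord _ _ n i).
Qed.

Lemma integrable_oneDsqrV : integrableR leb (fun t : R => (1 + t ^+ 2)^-1).
Proof.
have c1 : continuous (fun t : R => (1 + t ^+ 2)^-1) by exact: continuous_oneDsqrV.
apply/integrableP; split.
  by apply/measurable_EFinP; exact: (continuous_measurable_fun c1).
under eq_integral => x _ do rewrite /= ger0_norm ?invr_ge0 ?addr_ge0 ?sqr_ge0//.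
rewrite ge0_symfun_integralT//=.
- rewrite (_ : [set x | _] = `[0, +oo[%classic); last first.
    by apply/seteqP; split => x/=; rewrite in_itv/= andbT.
  by rewrite integral0y_oneDsqr -EFinM ltry.
- by move=> x; rewrite invr_ge0 addr_ge0 ?sqr_ge0.
- by move=> x/=; rewrite sqrrN.
Qed.

Lemma integrable_wt n : integrableR (rVleb R n) (@wt n).
Proof.
elim: n => [|n IHn].
  apply/integrableP; split; first by apply/measurable_EFinP; exact: measurable_wt.
  rewrite integral_dirac//.
    by rewrite diracT mul1e ltry.
  by apply: measurableT_comp => //; apply/measurable_EFinP; exact: measurable_wt.
apply: (integrable_snoc _ IHn integrable_oneDsqrV); first exact: measurable_wt.
by move=> x t; rewrite ger0_norm ?wt_snoc// ltW ?wt_gt0// mulr_gt0 ?wt_gt0 ?invr_gt0 ?ltr_pwDl ?sqr_ge0.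
Qed.

End rV_snoc_integral.

(** * The Fourier transform of a Gaussian *)

Section calculus_line.
Context {R : realType}.
Local Notation leb := (@lebesgue_measure R).

Lemma cvgn_uniqR (u : nat -> R) (a b : R) :
  u k @[k --> \oo] --> a -> u k @[k --> \oo] --> b -> a = b.
Proof. by move=> ua ub; rewrite -(cvg_lim (@Rhausdorff R) ua) (cvg_lim (@Rhausdorff R) ub). Qed.

(** The fundamental theorem on growing intervals starting at [y], then dominated convergence. The
    half-line is encoded as a factor, to match the one-dimensional factors of [lt_ind]. *)
Lemma Rintegral_derive_gt (h h' : R -> R) (y : R) :
  (forall t : R, is_derive t (1 : R) h (h' t)) -> continuous h' ->
  integrableR leb h' ->
  h (y + k.+1%:R) @[k --> \oo] --> 0 ->
  \int[leb]_t (h' t * (y < t)%R%:R) = - h y.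
Proof.
move=> dh ch' ih' h0.
have ddh (t : R) : derivable h t 1 by case: (dh t).
have mh' : measurable_fun setT h' := measurable_intR ih'.
pose f_ (k : nat) : R -> R := h' \_ `]y, y + k.+1%:R]%classic.
have f_E k : \int[leb]_t f_ k t = h (y + k.+1%:R) - h y.
  have yk : y < y + k.+1%:R by rewrite ltrDl ltr0n.
  have ih'k b : leb.-integrable [set` Interval (BSide b y) (BRight (y + k.+1%:R))] (EFin \o h').
    exact: integrableS ih'.
  rewrite -Rintegral_mkcond Rintegral_itv_obnd_cbnd//.
  rewrite /Rintegral (@continuous_FTC2 _ _ h)//.
  - apply: continuous_subspaceT => t; exact: ch'.
  - have ch t : {for t, continuous h}.
      by apply: differentiable_continuous; apply/derivable1_diffP; exact: ddh.
    split.
    + by move=> t _; exact: ddh.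
    + by apply: cvg_at_right_filter; exact: ch.
    + by apply: cvg_at_left_filter; exact: ch.
  - move=> t _; rewrite derive1E; exact: (@derive_val _ _ _ _ _ _ _ (dh t)).
have mf_ k : measurable_fun [set: measurableTypeR R] (f_ k).
  by apply/(measurable_restrictT _ _).1 => //; exact: measurable_funTS.
have f_cv (t : R) : f_ k t @[k --> \oo] --> h' t * (y < t)%R%:R.
  apply: cvg_near_cst; near=> k.
  rewrite /f_ patchE; case: ifPn => [|].
    by rewrite inE/= in_itv/= => /andP[-> _]; rewrite mulr1.
  rewrite notin_setE/= in_itv/= => /negP; rewrite negb_and.
  case: (y < t) => /=; last by rewrite mulr0.
  move=> /negP[]; rewrite -lerBlDl.
  apply: (@le_trans _ _ k%:R); last by rewrite ler_nat.
  by near: k; exact: nbhs_infty_ger.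
have f_le k t : `|f_ k t| <= `|h' t|.
  by rewrite /f_ patchE; case: ifPn => // _; rewrite normr0.
have [_ cv] := cvg_Rintegral mf_ f_cv (integrable_norm ih') f_le.
apply: (cvgn_uniqR cv).
under eq_fun do rewrite f_E.
have : h (y + k.+1%:R) - cst (h y) k @[k --> \oo] --> 0 - h y by exact: cvgB h0 (cvg_cst _).
by rewrite sub0r.
Unshelve. all: by end_near. Qed.

Lemma Rintegral_derive (h h' : R -> R) :
  (forall t : R, is_derive t (1 : R) h (h' t)) -> continuous h' ->
  integrableR leb h' ->
  h t @[t --> +oo] --> 0 -> h t @[t --> -oo] --> 0 ->
  \int[leb]_t h' t = 0.
Proof.
move=> dh ch' ih' h0 h0N.
have mh' : measurable_fun setT h' := measurable_intR ih'.
have hS y : h (y + k.+1%:R) @[k --> \oo] --> 0.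
  have := h0; apply: cvg_comp.
  apply/cvgryPge => A; near=> k; rewrite -lerBlDl.
  apply: (@le_trans _ _ k%:R); last by rewrite ler_nat.
  by near: k; exact: nbhs_infty_ger.
pose f_ (k : nat) (t : R) := h' t * (- k%:R < t)%R%:R.
have mf_ k : measurable_fun [set: measurableTypeR R] (f_ k).
  apply: measurable_funM => //.
  have -> : (fun x : R => (- k%:R < x)%R%:R : R) = \1_(`]- k%:R, +oo[%classic).
    by apply/funext => t; rewrite indicE mem_setE in_itv/= andbT.
  exact: measurable_indic.
have f_cv (t : R) : f_ k t @[k --> \oo] --> h' t.
  apply: cvg_near_cst; near=> k; rewrite /f_ (_ : - k%:R < t) ?mulr1//.
  rewrite ltrNl; near: k; exact: nbhs_infty_gtr.
have f_le k t : `|f_ k t| <= `|h' t|.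
  by rewrite /f_; case: ltP => _; rewrite ?mulr1 ?mulr0 ?normr0.
have [_ cv] := cvg_Rintegral mf_ f_cv (integrable_norm ih') f_le.
apply: (cvgn_uniqR cv).
under eq_fun do rewrite Rintegral_derive_gt//.
suff : - h (- k%:R) @[k --> \oo] --> - 0 by rewrite oppr0.
apply: cvgN; have := h0N; apply: cvg_comp.
apply/cvgrNyPle => A; near=> k; rewrite lerNl.
by near: k; exact: nbhs_infty_ger.
Unshelve. all: by end_near. Qed.

(** One term of the exponential series bounds [t^(2m+2) exp(-a t^2)] by [(m+1)! / a^(m+1)], and
    [|t|^m <= 1 + t^(2m+2)]. *)
Lemma powr_gauss_bound (m : nat) (a : R) : 0 < a ->
  exists2 M, 0 <= M & forall t : R, `|t| ^+ m * expR (- (a * t ^+ 2)) <= M.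
Proof.
move=> a0; exists (1 + (m.+1)`!%:R / a ^+ m.+1).
  by rewrite addr_ge0// divr_ge0// exprn_ge0// ltW.
move=> t; set E := expR _.
have E0 : 0 < E := expR_gt0 _.
have E1 : E <= 1 by rewrite -expR0 ler_expR oppr_le0 mulr_ge0 ?sqr_ge0// ltW.
have at0 : 0 <= a * t ^+ 2 by rewrite mulr_ge0 ?sqr_ge0// ltW.
have h1 : t ^+ (2 * m.+1) * E <= (m.+1)`!%:R / a ^+ m.+1.
  have := expR_ge1Dxn m at0.
  have -> : expR (a * t ^+ 2) = E^-1 by rewrite /E expRN invrK.
  move=> h; have {}h : (a * t ^+ 2) ^+ m.+1 / (m.+1)`!%:R <= E^-1.
    by apply: le_trans h; rewrite lerDr.
  rewrite ler_pdivrMr ?ltr0n ?fact_gt0// -ler_pdivrMl ?invr_gt0// invrK in h.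
  rewrite ler_pdivlMr ?exprn_gt0//; apply: le_trans h.
  by rewrite exprMn -exprM le_eqVlt; apply/orP; left; apply/eqP; ring.
have h2 : `|t| ^+ m <= 1 + t ^+ (2 * m.+1).
  have t20 : 0 <= t ^+ (2 * m.+1) by rewrite exprM exprn_ge0// sqr_ge0.
  have [t1|t1] := leP `|t| 1.
    by rewrite (@le_trans _ _ 1)// ?lerDl// exprn_ile1.
  rewrite -[t ^+ _]ger0_norm// normrX.
  rewrite (@le_trans _ _ (`|t| ^+ (2 * m.+1)))// ?lerDr// ler_weXn2l//; first exact: ltW.
  by rewrite mul2n -addnn (leq_trans (leqnSn m)) ?leq_addl.
rewrite (@le_trans _ _ ((1 + t ^+ (2 * m.+1)) * E))//.
  by rewrite ler_wpM2r// ltW.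
by rewrite mulrDl mul1r lerD.
Qed.

Lemma continuous_gauss (a : R) : continuous (fun t : R => expR (- (a * t ^+ 2))).
Proof.
move=> t; apply: continuous_comp; last exact: continuous_expR.
by apply: cvgN; apply: cvgM; [exact: cvg_cst|exact: exprn_continuous].
Qed.

Lemma integrable_poly_gauss (m : nat) (a : R) : 0 < a ->
  integrableR leb (fun t : R => `|t| ^+ m * expR (- (a * t ^+ 2))).
Proof.
move=> a0.
have [M M0 HM] := powr_gauss_bound m a0.
have [N N0 HN] := powr_gauss_bound m.+2 a0.
apply: (@le_integrableR _ _ _ leb _ (fun t => (M + N) * (1 + t ^+ 2)^-1)).
- have c : continuous (fun t : R => `|t| ^+ m * expR (- (a * t ^+ 2))).
    move=> t; apply: cvgM; last exact: continuous_gauss.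
    apply: (@continuous_comp R R R Num.norm (fun x : R => x ^+ m)).
      exact: norm_continuous.
    exact: exprn_continuous.
  exact: (continuous_measurable_fun c).
- move=> t; rewrite ger0_norm ?mulr_ge0 ?expR_ge0 ?exprn_ge0//.
  rewrite ler_pdivlMr ?ltr_pwDl ?sqr_ge0//.
  apply: le_trans (lerD (HM t) (HN t)).
  have -> : `|t| ^+ m.+2 = `|t| ^+ m * t ^+ 2.
    by rewrite -addn2 exprD real_normK ?num_real.
  by rewrite mulrDr mulr1 lerD2l mulrAC.
- have := integrableZl measurableT (M + N) integrable_oneDsqrV.
  by apply: eq_integrable => // t _ /=; rewrite EFinM.
Qed.

Lemma cvg_poly_gauss (a : R) (h : R -> R) (m : nat) : 0 < a ->
  (forall t, `|h t| <= `|t| ^+ m * expR (- (a * t ^+ 2))) ->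
  h t @[t --> +oo] --> 0 /\ h t @[t --> -oo] --> 0.
Proof.
move=> a0 hle.
have [N N0 HN] := powr_gauss_bound m.+1 a0.
have key t : t != 0 -> `|h t| <= N / `|t|.
  move=> t0; rewrite ler_pdivlMr ?normr_gt0// (le_trans _ (HN t))//.
  by rewrite mulrC exprS -mulrA ler_wpM2l.
split; apply/cvgr0Pnorm_le => e e0; near=> t.
  have t0 : 0 < t by near: t; exact: nbhs_pinfty_gt.
  rewrite (le_trans (key t _)) ?gt_eqF// ler_pdivrMr ?normr_gt0 ?gt_eqF//.
  rewrite gtr0_norm// -ler_pdivrMl//; near: t; apply: nbhs_pinfty_ge; exact: num_real.
have t0 : t < 0 by near: t; exact: nbhs_ninfty_lt.
rewrite (le_trans (key t _)) ?lt_eqF// ler_pdivrMr ?normr_gt0 ?lt_eqF//.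
rewrite ltr0_norm// -ler_pdivrMl// lerNr; near: t; apply: nbhs_ninfty_le; exact: num_real.
Unshelve. all: by end_near. Qed.

End calculus_line.

Section gauss_fourier_line.
Context {R : realType}.
Local Notation leb := (@lebesgue_measure R).

Lemma integrable_gauss (a : R) : 0 < a ->
  integrableR leb (fun t : R => expR (- (a * t ^+ 2))).
Proof.
move=> a0; have := integrable_poly_gauss 0 a0.
by apply: eq_integrable => // t _; rewrite /= expr0 mul1r.
Qed.

Lemma continuous_cos_affine (k c : R) : continuous (fun t : R => cos (k * t + c)).
Proof.
move=> t; apply: continuous_comp; last exact: continuous_cos.
by apply: cvgD; [apply: mulrl_continuous|exact: cvg_cst].
Qed.

Lemma continuous_sin_affine (k c : R) : continuous (fun t : R => sin (k * t + c)).
Proof.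
move=> t; apply: continuous_comp; last exact: continuous_sin.
by apply: cvgD; [apply: mulrl_continuous|exact: cvg_cst].
Qed.

Lemma integrable_gauss_cos (a k c : R) : 0 < a ->
  integrableR leb (fun t : R => expR (- (a * t ^+ 2)) * cos (k * t + c)).
Proof.
move=> a0.
have m1 : measurable_fun [set: measurableTypeR R] (fun t : R => cos (k * t + c)).
  exact: (continuous_measurable_fun (@continuous_cos_affine k c)).
by apply: (integrableMbound (integrable_gauss a0) m1) => t; exact: cos_max.
Qed.

Lemma integrable_gauss_sin (a k c : R) : 0 < a ->
  integrableR leb (fun t : R => (t * expR (- (a * t ^+ 2))) * sin (k * t + c)).
Proof.
move=> a0.
have m1 : measurable_fun [set: measurableTypeR R] (fun t : R => sin (k * t + c)).
  exact: (continuous_measurable_fun (@continuous_sin_affine k c)).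
have i1 := integrable_poly_gauss 1 a0.
suff i2 : integrableR leb (fun t : R => t * expR (- (a * t ^+ 2))).
  by apply: (integrableMbound i2 m1) => t; exact: sin_max.
apply: (le_integrableR _ _ i1).
  have c1 : continuous (fun t : R => t * expR (- (a * t ^+ 2))).
    by move=> u; apply: cvgM; [exact: cvg_id|exact: continuous_gauss].
  exact: (continuous_measurable_fun c1).
by move=> u; rewrite normrM expr1 ler_wpM2l// ger0_norm// expR_ge0.
Qed.

(** Integration by parts: the derivative of [exp(-a t^2) sin(k t + c)] has integral zero over the
    line. *)
Lemma gauss_sin_cos (a k c : R) : 0 < a ->
  \int[leb]_t ((t * expR (- (a * t ^+ 2))) * sin (k * t + c)) =
  k / (2 * a) * \int[leb]_t (expR (- (a * t ^+ 2)) * cos (k * t + c)).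
Proof.
move=> a0.
pose h (t : R) := expR (- (a * t ^+ 2)) * sin (k * t + c).
pose h' (t : R) := (- (2 * a)) * ((t * expR (- (a * t ^+ 2))) * sin (k * t + c)) +
   k * (expR (- (a * t ^+ 2)) * cos (k * t + c)).
have dh (t : R) : is_derive t (1 : R) h (h' t).
  rewrite /h /h'; apply: is_derive_eq.
  by rewrite /GRing.scale/=; ring.
have ic := integrable_gauss_cos k c a0; have is' := integrable_gauss_sin k c a0.
have i1 := integrableZl measurableT (- (2 * a)) is'.
have i2 := integrableZl measurableT k ic.
have ih' : integrableR leb h'.
  exact: (integrableRD i1 i2).
have ch' : continuous h'.
  move=> t; rewrite /h'; apply: cvgD; apply: cvgM; try exact: cvg_cst.
    by apply: cvgM; [apply: cvgM; [exact: cvg_id|exact: continuous_gauss]|exact: continuous_sin_affine].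
  by apply: cvgM; [exact: continuous_gauss|exact: continuous_cos_affine].
have [h0 h0N] : h t @[t --> +oo] --> 0 /\ h t @[t --> -oo] --> 0.
  apply: (@cvg_poly_gauss _ a _ 0) => // t.
  by rewrite expr0 mul1r normrM ger0_norm ?expR_ge0// ler_piMr ?expR_ge0 ?sin_max.
have := Rintegral_derive dh ch' ih' h0 h0N.
rewrite RintegralD//.
rewrite (@RintegralZl _ _ _ leb setT _ (- (2 * a)))// (@RintegralZl _ _ _ leb setT _ k)//.
set I1 := Rintegral _ _ _; set I2 := Rintegral _ _ _ => e.
have a2 : 2 * a != 0 by rewrite mulf_neq0// gt_eqF.
apply: (mulfI a2); rewrite mulrA mulrCA mulfV// mulr1.
by apply/eqP; rewrite -subr_eq0 -oppr_eq0 opprB addrC -mulNr e.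
Qed.

(** Differentiation under the integral produces a sine moment, which [gauss_sin_cos] turns back into
    the cosine integral; the transform thus solves a first-order linear equation. *)
Lemma is_derive_gauss_cos (a c xi : R) : 0 < a ->
  is_derive xi (1 : R) (fun x : R => \int[leb]_t (expR (- (a * t ^+ 2)) * cos (2 * pi * x * t + c)))
   (- (2 * pi ^+ 2 * xi / a) * \int[leb]_t (expR (- (a * t ^+ 2)) * cos (2 * pi * xi * t + c))).
Proof.
move=> a0.
pose f (x t : R) := expR (- (a * t ^+ 2)) * cos (2 * pi * x * t + c).
pose G (t : R) := 2 * pi * (`|t| ^+ 1 * expR (- (a * t ^+ 2))).
have df x t : is_derive x (1 : R) (f ^~ t) (- (2 * pi) * ((t * expR (- (a * t ^+ 2))) * sin (2 * pi * x * t + c))).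
  by rewrite /f; apply: is_derive_eq; rewrite /GRing.scale/=; ring.
have xi1 : `]xi - 1, xi + 1[%classic xi by rewrite /= in_itv/= ltrBlDr ltrDl ltr01.
have H1 x : `]xi - 1, xi + 1[%classic x -> integrableR leb (f x).
  by move=> _; exact: integrable_gauss_cos.
have H2 x t : `]xi - 1, xi + 1[%classic x -> setT t -> derivable (f ^~ t) x 1.
  by move=> _ _; case: (df x t).
have G0 t : 0 <= G t.
  by rewrite /G !mulr_ge0 ?expR_ge0 ?pi_ge0 ?expr1.
have iG : integrableR leb G.
  exact: (integrableRZl (2 * pi) (integrable_poly_gauss 1 a0)).
have d1E x t : partial1of2 f x t = - (2 * pi) * ((t * expR (- (a * t ^+ 2))) * sin (2 * pi * x * t + c)).
  by rewrite partial1of2E; exact: (@derive_val _ _ _ _ _ _ _ (df x t)).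
have H3 x t : `]xi - 1, xi + 1[%classic x -> setT t -> `|partial1of2 f x t| <= G t.
  move=> _ _; rewrite d1E /G normrM normrN (@ger0_norm _ (2 * pi)) ?mulr_ge0 ?pi_ge0//.
  rewrite ler_wpM2l ?mulr_ge0 ?pi_ge0// !normrM expr1 (@ger0_norm _ (expR _)) ?expR_ge0//.
  by rewrite ler_piMr ?mulr_ge0 ?expR_ge0 ?sin_max.
have D1 := derivable_under_integral measurableT xi1 H1 H2 G0 iG H3.
have D2 := differentiation_under_integral measurableT xi1 H1 H2 G0 iG H3.
rewrite derive1E in D2.
apply: (DeriveDef D1); rewrite D2.
under eq_Rintegral do rewrite d1E.
rewrite RintegralZl//; last exact: integrable_gauss_sin.
rewrite gauss_sin_cos//; field.
by rewrite gt_eqF.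
Qed.

Lemma Rintegral_gauss (e : R) : 0 < e ->
  \int[leb]_t (expR (- ((pi * e ^+ 2) * t ^+ 2))) = e^-1.
Proof.
move=> e0.
pose sp := Num.sqrt pi * e : R.
have sp0 : 0 < sp by rewrite mulr_gt0 // sqrtr_gt0 pi_gt0.
have dF (x : R) : is_derive x (1 : R) ( *%R sp) sp.
  by apply: is_derive_eq; rewrite /GRing.scale/=; ring.
have dFE : ( *%R sp : R -> R)^`()%classic = cst sp.
  by apply/funext => x; rewrite derive1E; exact: (@derive_val _ _ _ _ _ _ _ (dF x)).
have := @increasing_ge0_integration_by_substitutionT R ( *%R sp) gauss_fun.
rewrite dFE integralT_gauss => H.
have {}H : (Num.sqrt pi)%:E = (\int[leb]_x ((sp)%:E * (expR (- ((pi * e ^+ 2) * x ^+ 2)))%:E))%E.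
  rewrite H.
  - apply: eq_integral => x _; rewrite -EFinM; congr EFin.
    rewrite /= /gauss_fun/= mulrC; congr (_ * expR _).
    by rewrite /sp !exprMn sqr_sqrtr ?pi_ge0.
  - by move=> x y xy; rewrite ltr_pM2l.
  - by move=> x; exact: cvg_cst.
  - exact: is_cvg_cst.
  - exact: is_cvg_cst.
  - by move=> x; case: (dF x).
  - by apply: gt0_cvgMrNy => //; exact: cvg_id.
  - by apply: gt0_cvgMry => //; exact: cvg_id.
  - exact: continuous_gauss_fun.
  - by move=> x; exact: gauss_fun_ge0.
have a0 : 0 < pi * e ^+ 2 by rewrite mulr_gt0 ?pi_gt0 ?exprn_gt0.
move: H; rewrite ge0_integralZl_EFin//; last 2 first.
- by have /measurable_int := integrable_gauss a0.
- exact: ltW.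
rewrite integral_EFinR; last exact: integrable_gauss.
rewrite -EFinM => -[H].
have spi : Num.sqrt pi != 0 :> R by rewrite gt_eqF// sqrtr_gt0 pi_gt0.
apply: (mulfI spi); apply: (mulIf (lt0r_neq0 e0)).
by rewrite mulrAC -/sp -H mulfVK ?gt_eqF.
Qed.

Lemma gauss_fourier1 (e c xi : R) : 0 < e ->
  \int[leb]_t (expR (- ((pi * e ^+ 2) * t ^+ 2)) * cos (2 * pi * xi * t + c)) =
  cos c * (e^-1 * expR (- (pi * (xi / e) ^+ 2))).
Proof.
move=> e0; set a := pi * e ^+ 2.
have a0 : 0 < a by rewrite mulr_gt0 ?pi_gt0 ?exprn_gt0.
pose K (x : R) := \int[leb]_t (expR (- (a * t ^+ 2)) * cos (2 * pi * x * t + c)).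
(* The equation reads [K' = - 2 b x K], so [exp(b x^2)] is an integrating factor and [P] is
   constant. *)
pose b := pi ^+ 2 / a.
pose P (x : R) := K x * expR (b * x ^+ 2).
have dP (x : R) : is_derive x (1 : R) P 0.
  have dK : is_derive x (1 : R) K (- (2 * pi ^+ 2 * x / a) * K x).
    exact: is_derive_gauss_cos.
  rewrite /P; apply: is_derive_eq; rewrite /GRing.scale/= /b; ring.
have PE : P xi = P 0 by apply: is_derive_0_is_cst => x; exact: dP.
have K0 : K 0 = cos c * e^-1.
  rewrite /K; under eq_Rintegral do rewrite mulr0 mul0r add0r.
  rewrite RintegralZr ?Rintegral_gauss// 1?mulrC//; exact: integrable_gauss.
move: PE; rewrite /P K0 expr0n/= mulr0 expR0 mulr1 -/(K xi) => PE.
apply: (mulIf (lt0r_neq0 (expR_gt0 (b * xi ^+ 2)))); rewrite PE.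
have pi0 : (pi : R) != 0 by rewrite gt_eqF ?pi_gt0.
have -> : b = pi / e ^+ 2 by rewrite /b /a expr2 -mulf_div divff// mul1r.
rewrite -!mulrA -expRD (_ : _ + _ = 0) ?expR0 ?mulr1//.
by rewrite expr_div_n; ring.
Qed.

End gauss_fourier_line.

Section gauss_rV.
Context {R : realType}.
Local Notation leb := (@lebesgue_measure R).

Lemma measurable_dotrV d (T : measurableType d) n (f g : T -> 'rV[R]_n) :
  measurable_fun setT f -> measurable_fun setT g ->
  measurable_fun setT (fun t => dotrV (f t) (g t)).
Proof.
move=> /measurable_fun_rVP mf /measurable_fun_rVP mg.
by apply: measurable_sum => i; exact: measurable_funM.
Qed.

Lemma measurable_fun_cos d (T : measurableType d) (f : T -> R) :
  measurable_fun setT f -> measurable_fun setT (fun t => cos (f t)).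
Proof.
move=> mf; apply: (measurableT_comp _ mf).
exact: (continuous_measurable_fun (@continuous_cos R)).
Qed.

Lemma dotrV_snoc n (x : 'rV[R]_n) t (xi : 'rV[R]_n.+1) :
  dotrV (rV_snoc (x, t)) xi =
  dotrV x (\row_i xi ord0 (lift ord_max i)) + t * xi ord0 ord_max.
Proof.
rewrite /dotrV big_ord_lift_max/= rV_snoc_max; congr (_ + _).
by apply: eq_bigr => i _; rewrite rV_snoc_lift mxE.
Qed.

Lemma dotrVC n (x y : 'rV[R]_n) : dotrV x y = dotrV y x.
Proof. by apply: eq_bigr => i _; rewrite mulrC. Qed.

Lemma dotrVBl n (x y z : 'rV[R]_n) : dotrV (x - y) z = dotrV x z - dotrV y z.
Proof. by rewrite /dotrV -sumrB; apply: eq_bigr => i _; rewrite !mxE mulrBl. Qed.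

Lemma dotrVDl n (x y z : 'rV[R]_n) : dotrV (x + y) z = dotrV x z + dotrV y z.
Proof. by rewrite /dotrV -big_split/=; apply: eq_bigr => i _; rewrite !mxE mulrDl. Qed.

Definition gaussn n (e : R) (x : 'rV[R]_n) : R :=
  \prod_(i < n) expR (- ((pi * e ^+ 2) * x ord0 i ^+ 2)).

(** The Fourier transform of [gaussn e] (see [gauss_fourier]): a probability density of width about
    [e], which concentrates at 0 as [e] tends to 0 while [gaussn e] tends to 1. *)
Definition kern n (e : R) (x : 'rV[R]_n) : R :=
  \prod_(i < n) (e^-1 * expR (- (pi * (x ord0 i / e) ^+ 2))).

Lemma gaussn_gt0 n e (x : 'rV[R]_n) : 0 < gaussn e x.
Proof. by apply: prodr_gt0 => i _; exact: expR_gt0. Qed.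

Lemma gaussn_ge0 n e (x : 'rV[R]_n) : 0 <= gaussn e x.
Proof. exact/ltW/gaussn_gt0. Qed.

Lemma gaussn_le1 n e (x : 'rV[R]_n) : gaussn e x <= 1.
Proof.
apply: prodr_ile1 => i _; rewrite expR_ge0/= -expR0 ler_expR oppr_le0.
by apply: mulr_ge0; [apply: mulr_ge0|]; rewrite ?sqr_ge0 ?pi_ge0.
Qed.

Lemma measurable_gaussn n e : measurable_fun setT (@gaussn n e).
Proof.
apply: measurable_prod => i _.
exact: measurableT_comp (continuous_measurable_fun (@continuous_gauss R _)) (@measurable_rV_coord _ _ n i).
Qed.

Lemma gaussn_snoc n e (x : 'rV[R]_n) t :
  gaussn e (rV_snoc (x, t)) = gaussn e x * expR (- ((pi * e ^+ 2) * t ^+ 2)).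
Proof.
rewrite /gaussn big_ord_lift_max/= rV_snoc_max; congr (_ * _).
by apply: eq_bigr => i _; rewrite rV_snoc_lift.
Qed.

Lemma kernE n e (x : 'rV[R]_n) : kern e x = e ^- n * gaussn e^-1 x.
Proof.
rewrite /kern big_split/= prodr_const card_ord exprVn; congr (_ * _).
by apply: eq_bigr => i _; congr (expR (- _)); rewrite exprMn; ring.
Qed.

Lemma kern_gt0 n e (x : 'rV[R]_n) : 0 < e -> 0 < kern e x.
Proof. by move=> e0; apply: prodr_gt0 => i _; rewrite mulr_gt0 ?invr_gt0 ?expR_gt0. Qed.

Lemma kern_ge0 n e (x : 'rV[R]_n) : 0 < e -> 0 <= kern e x.
Proof. by move=> e0; exact/ltW/kern_gt0. Qed.

Lemma measurable_kern n e : measurable_fun setT (@kern n e).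
Proof.
rewrite (_ : @kern n e = fun x => e ^- n * gaussn e^-1 x); last first.
  by apply/funext => x; exact: kernE.
by apply: measurable_funM => //; exact: measurable_gaussn.
Qed.

Lemma integrable_rV0 (f : 'rV[R]_0 -> R) : measurable_fun setT f ->
  integrableR (rVleb R 0) f.
Proof.
move=> mf; apply/integrableP; split; first exact/measurable_EFinP.
rewrite integral_dirac//.
  by rewrite diracT mul1e ltry.
by apply: measurableT_comp => //; exact/measurable_EFinP.
Qed.

Lemma Rintegral_rV0 (f : 'rV[R]_0 -> R) : measurable_fun setT f ->
  \int[rVleb R 0]_x f x = f 0.
Proof.
move=> mf; rewrite /Rintegral integral_dirac//; last exact/measurable_EFinP.
by rewrite diracT mul1e.
Qed.

Lemma integrable_gaussn n e : 0 < e -> integrableR (rVleb R n) (@gaussn n e).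
Proof.
move=> e0; have a0 : 0 < pi * e ^+ 2 by rewrite mulr_gt0 ?pi_gt0 ?exprn_gt0.
elim: n => [|n IHn]; first by apply: integrable_rV0; exact: measurable_gaussn.
apply: (integrable_snoc _ IHn (integrable_gauss a0)); first exact: measurable_gaussn.
by move=> x t; rewrite gaussn_snoc ger0_norm// mulr_ge0 ?expR_ge0 ?gaussn_ge0.
Qed.

(** Coordinate by coordinate: while the last one is integrated out, the contribution of the others
    is a constant phase, which is why the one-dimensional formula allows an arbitrary [c]. *)
Lemma gauss_fourier n (e c : R) (xi : 'rV[R]_n) : 0 < e ->
  \int[rVleb R n]_x (gaussn e x * cos (2 * pi * dotrV x xi + c)) = cos c * kern e xi.
Proof.
move=> e0; have a0 : 0 < pi * e ^+ 2 by rewrite mulr_gt0 ?pi_gt0 ?exprn_gt0.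
have mcos m (z : 'rV[R]_m) b : measurable_fun setT (fun x : 'rV[R]_m => cos (2 * pi * dotrV x z + b)).
  apply: measurable_fun_cos; apply: measurable_funD => //; apply: measurable_funM => //.
  exact: measurable_dotrV.
have mf m (z : 'rV[R]_m) b : measurable_fun setT (fun x : 'rV[R]_m => gaussn e x * cos (2 * pi * dotrV x z + b)).
  by apply: measurable_funM; [exact: measurable_gaussn|exact: mcos].
elim: n c xi => [|n IHn] c xi.
  by rewrite Rintegral_rV0// /gaussn /kern /dotrV !big_ord0 mul1r mulr0 add0r mulr1.
rewrite (Rintegral_snoc (mf _ _ _) (integrable_gaussn n e0) (integrable_gauss a0)); last first.
  move=> x t; rewrite gaussn_snoc normrM ger0_norm ?mulr_ge0 ?expR_ge0 ?gaussn_ge0//.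
  by rewrite ler_piMr ?cos_max// mulr_ge0 ?expR_ge0 ?gaussn_ge0.
pose xi' : 'rV[R]_n := \row_i xi ord0 (lift ord_max i).
pose l := xi ord0 ord_max.
have E x : \int[leb]_t (gaussn e (rV_snoc (x, t)) * cos (2 * pi * dotrV (rV_snoc (x, t)) xi + c)) =
   e^-1 * expR (- (pi * (l / e) ^+ 2)) * (gaussn e x * cos (2 * pi * dotrV x xi' + c)).
  under eq_Rintegral => t _.
    rewrite gaussn_snoc -mulrA dotrV_snoc -/xi' -/l.
    rewrite (_ : 2 * pi * (_ + _) + c = 2 * pi * l * t + (2 * pi * dotrV x xi' + c)); last by ring.
    over.
  rewrite RintegralZl//; last exact: integrable_gauss_cos.
  by rewrite gauss_fourier1//; ring.
under eq_Rintegral do rewrite E.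
rewrite RintegralZl//; last first.
  have := integrableMbound (integrable_gaussn n e0) (mcos n xi' c) (fun=> cos_max _).
  by apply: eq_integrable.
rewrite IHn [kern e xi]/kern big_ord_lift_max/= -/l mulrCA; congr (_ * _).
rewrite mulrC; congr (_ * _).
by apply: eq_bigr => i _; rewrite mxE.
Qed.

(** [kern e] is a multiple of the Gaussian [gaussn e^-1], whose integral is its transform at
    frequency 0. *)
Lemma Rintegral_kern n e : 0 < e -> \int[rVleb R n]_x kern e x = 1.
Proof.
move=> e0; under eq_Rintegral do rewrite kernE.
have e10 : 0 < e^-1 by rewrite invr_gt0.
rewrite RintegralZl//; last exact: integrable_gaussn.
have := @gauss_fourier n e^-1 0 0 e10.
under eq_Rintegral => x _.
  rewrite /dotrV big1 => [|i _]; last by rewrite mxE mulr0.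
  rewrite mulr0 addr0 cos0 mulr1.
  over.
move=> ->; rewrite cos0 mul1r /kern.
under eq_bigr do rewrite mxE mul0r expr0n/= mulr0 oppr0 expR0 mulr1.
by rewrite prodr_const card_ord invrK mulVf// expf_neq0// gt_eqF.
Qed.

Lemma integrable_kern n e : 0 < e -> integrableR (rVleb R n) (@kern n e).
Proof.
move=> e0; have e10 : 0 < e^-1 by rewrite invr_gt0.
have := integrableZl measurableT (e ^- n) (integrable_gaussn n e10).
by apply: eq_integrable => // x _; rewrite /= kernE EFinM.
Qed.

Lemma cvg_gaussn n (x : 'rV[R]_n) : gaussn k.+1%:R^-1 x @[k --> \oo] --> (1 : R).
Proof.
have x0 : gaussn 0 x = 1.
  by rewrite /gaussn big1// => i _; rewrite expr0n/= mulr0 mul0r oppr0 expR0.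
suff : gaussn k.+1%:R^-1 x @[k --> \oo] --> gaussn 0 x by rewrite x0.
rewrite /gaussn; apply: cvg_big => [|i _].
  exact: mul_continuous.
have -> : (fun k => expR (- (pi * k.+1%:R^-1 ^+ 2 * x ord0 i ^+ 2))) =
   (fun e => expR (- ((pi * x ord0 i ^+ 2) * e ^+ 2))) \o (fun k => k.+1%:R^-1).
  by apply/funext => k /=; rewrite mulrAC.
rewrite mulrAC.
apply: cvg_comp; first exact: cvg_harmonic.
exact: continuous_gauss.
Qed.

End gauss_rV.

(** * The L^2 bound for the Fourier transform *)

Section cosine_transform.
Context {R : realType}.

(** The bound on [h] does not decay in [y], so Fubini does not apply to [h] itself. A positive
    integrable weight [w] is inserted and divided out after the integration. *)
Lemma measurable_Rintegral_bounded d1 d2 (T1 : measurableType d1) (T2 : measurableType d2)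
    (m1 : {sigma_finite_measure set T1 -> \bar R})
    (m2 : {sigma_finite_measure set T2 -> \bar R})
    (h : T1 * T2 -> R) (a : T1 -> R) (w : T2 -> R) :
  measurable_fun setT h -> integrableR m1 a ->
  integrableR m2 w -> (forall y, 0 < w y) ->
  (forall x y, `|h (x, y)| <= a x) ->
  measurable_fun setT (fun y => \int[m1]_x h (x, y)).
Proof.
move=> mh ia iw w0 ha.
have mw : measurable_fun setT w := measurable_intR iw.
pose h' (z : T1 * T2) := h z * w z.2.
have mh' : measurable_fun setT h'.
  by apply: measurable_funM => //; exact: measurableT_comp mw measurable_snd.
have h'aw x y : `|h' (x, y)| <= a x * w y.
  by rewrite normrM (gtr0_norm (w0 y)) ler_wpM2r// ltW.
have mG := measurable_Rintegral_prod2 mh' ia iw h'aw.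
have hi y : integrableR m1 (fun x => h (x, y)).
  apply: (le_integrableR _ _ ia); last by move=> x; exact: ha.
  exact: measurableT_comp mh (measurable_pair2 y).
have -> : (fun y => \int[m1]_x h (x, y)) = (fun y => (\int[m1]_x h' (x, y)) * (w y)^-1).
  apply/funext => y; rewrite /h'/= RintegralZr//.
  by rewrite mulfK// gt_eqF.
apply: measurable_funM => //.
have -> : (fun y => (w y)^-1) = (fun y => expR (- ln (w y))).
  by apply/funext => y; rewrite expRN lnK// posrE.
apply: measurableT_comp => //; apply: measurableT_comp => //.
exact: measurableT_comp (@measurable_ln R) mw.
Qed.

Variable n : nat.
Local Notation mu := (rVleb R n).
Implicit Types u v : 'rV[R]_n -> R.

Definition cft u (c : R) (xi : 'rV[R]_n) : R :=
  \int[mu]_x (u x * cos (2 * pi * dotrV x xi + c)).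

Lemma measurable_cosphase (c : R) : measurable_fun setT
  (fun z : 'rV[R]_n * 'rV[R]_n => cos (2 * pi * dotrV z.1 z.2 + c)).
Proof.
apply: measurable_fun_cos; apply: measurable_funD => //; apply: measurable_funM => //.
exact: measurable_dotrV.
Qed.

Lemma measurable_cosphase1 (c : R) xi : measurable_fun setT
  (fun x : 'rV[R]_n => cos (2 * pi * dotrV x xi + c)).
Proof. exact: measurableT_comp (measurable_cosphase c) (measurable_pair2 xi). Qed.

Lemma integrable_cosphase u c xi : integrableR mu u ->
  integrableR mu (fun x => u x * cos (2 * pi * dotrV x xi + c)).
Proof.
move=> iu; apply: (integrableMbound iu (measurable_cosphase1 c xi)) => x.
exact: cos_max.
Qed.

Lemma normr_cft u c xi : integrableR mu u ->
  `|cft u c xi| <= \int[mu]_x `|u x|.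
Proof.
move=> iu; apply: normr_Rintegral_le; last by move=> x; rewrite normrM ler_piMr ?cos_max.
- exact: measurable_intR (integrable_cosphase c xi iu).
- exact: integrable_norm.
Qed.

Lemma measurable_cft u c : integrableR mu u -> measurable_fun setT (cft u c).
Proof.
move=> iu; have mu_ := measurable_intR iu.
apply: (@measurable_Rintegral_bounded _ _ _ _ mu mu
  (fun z => u z.1 * cos (2 * pi * dotrV z.1 z.2 + c)) (fun x => `|u x|) (@wt R n)).
- apply: measurable_funM; last exact: measurable_cosphase.
  exact: measurableT_comp mu_ measurable_fst.
- exact: integrable_norm.
- exact: integrable_wt.
- exact: wt_gt0.
- by move=> x y; rewrite normrM ler_piMr ?cos_max.
Qed.

(** The multiplication formula for the Fourier transform: the kernel [cos(2 pi x . y + c)] is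
    symmetric in [x] and [y]. *)
Lemma cft_swap u v c : integrableR mu u -> integrableR mu v ->
  \int[mu]_x (v x * cft u c x) = \int[mu]_x (u x * cft v c x).
Proof.
move=> iu iv; have mu_ := measurable_intR iu; have mv := measurable_intR iv.
pose h (z : 'rV[R]_n * 'rV[R]_n) := v z.1 * u z.2 * cos (2 * pi * dotrV z.1 z.2 + c).
have mh : measurable_fun setT h.
  apply: measurable_funM; last exact: measurable_cosphase.
  apply: measurable_funM; first exact: measurableT_comp mv measurable_fst.
  exact: measurableT_comp mu_ measurable_snd.
have := @Rintegral_swap _ _ _ _ _ mu mu h _ _ mh (integrable_norm iv) (integrable_norm iu) _.
rewrite {1 2}/h/= => H.
transitivity (\int[mu]_x \int[mu]_y h (x, y)).
  apply: eq_Rintegral => x _.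
  rewrite -(RintegralZl (v x) measurableT (integrable_cosphase c x iu)).
  by apply: eq_Rintegral => y _; rewrite /h/= dotrVC; ring.
rewrite H; last by move=> x y; rewrite /h/= !normrM ler_piMr ?cos_max// mulr_ge0.
apply: eq_Rintegral => x _.
rewrite -(RintegralZl (u x) measurableT (integrable_cosphase c x iv)).
by apply: eq_Rintegral => y _; rewrite /h/=; ring.
Qed.

Lemma kern_oppr e (x : 'rV[R]_n) : kern e (- x) = kern e x.
Proof.
by apply: eq_bigr => i _; rewrite mxE mulNr sqrrN.
Qed.

Lemma ge0_integral_kern e : 0 < e -> (\int[mu]_x (kern e x)%:E = 1)%E.
Proof. by move=> e0; rewrite integral_EFinR ?Rintegral_kern//; exact: integrable_kern. Qed.

Lemma ge0_integral_kernD e (x : 'rV[R]_n) : 0 < e -> (\int[mu]_y (kern e (y + x)%R)%:E = 1)%E.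
Proof.
move=> e0; rewrite (ge0_integral_shift x (f := fun y => (kern e y)%:E)).
- exact: ge0_integral_kern.
- by apply/measurable_EFinP; exact: measurable_kern.
- by move=> y; rewrite lee_fin kern_ge0.
Qed.

(** The product-to-sum formula leaves two Gaussian transforms, at the frequencies [y - x] and
    [y + x]. *)
Lemma gauss_cft_cos e c d (x y : 'rV[R]_n) : 0 < e ->
  cft (fun xi => gaussn e xi * cos (2 * pi * dotrV xi x + c)) d y =
  2^-1 * (cos (d - c) * kern e (y - x) + cos (d + c) * kern e (y + x)).
Proof.
move=> e0; rewrite /cft.
have cc (a b : R) : cos a * cos b = 2^-1 * cos (b - a) + 2^-1 * cos (b + a).
  by rewrite cosB cosD; field.
have i1 z b : integrableR mu (fun xi => 2^-1 * (gaussn e xi * cos (2 * pi * dotrV xi z + b))).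
  exact: (integrableRZl 2^-1 (integrable_cosphase b z (integrable_gaussn n e0))).
transitivity (\int[mu]_xi (2^-1 * (gaussn e xi * cos (2 * pi * dotrV xi (y - x) + (d - c)))
   + 2^-1 * (gaussn e xi * cos (2 * pi * dotrV xi (y + x) + (d + c))))).
  apply: eq_Rintegral => xi _; rewrite -mulrA cc mulrDr !(mulrCA _ 2^-1).
  rewrite ![dotrV xi _]dotrVC dotrVBl dotrVDl.
  by congr (2^-1 * (_ * cos _) + 2^-1 * (_ * cos _)); ring.
rewrite RintegralD//.
rewrite !RintegralZl//; [|exact/integrable_cosphase/integrable_gaussn..].
by rewrite !gauss_fourier// mulrDr.
Qed.

(* Gaussian regularization of Fourier inversion; the reflected kernel at [eta + xi] appears because only the cosine is used. *)
Lemma gauss_cft_swap G e c d xi : 0 < e -> integrableR mu G ->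
  \int[mu]_x (cft G d x * gaussn e x * cos (2 * pi * dotrV x xi + c)) =
  \int[mu]_eta (G eta * (2^-1 * (cos (d - c) * kern e (eta - xi) + cos (d + c) * kern e (eta + xi)))).
Proof.
move=> e0 iG.
pose v x := gaussn e x * cos (2 * pi * dotrV x xi + c).
have iv : integrableR mu v by exact/integrable_cosphase/integrable_gaussn.
transitivity (\int[mu]_x (v x * cft G d x)).
  by apply: eq_Rintegral => x _; rewrite /v; ring.
rewrite cft_swap//; apply: eq_Rintegral => eta _.
by rewrite gauss_cft_cos.
Qed.

Lemma normr_Rintegral_le_integral d (T : measurableType d) (m : {measure set T -> \bar R}) (f : T -> R) :
  measurable_fun setT f -> (`|\int[m]_x f x|%:E <= \int[m]_x `|f x|%:E)%E.
Proof.
move=> mf; have := le_abse_integral m measurableT ((measurable_EFinP _ _).2 mf).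
move=> H; apply: (le_trans _ H).
rewrite /Rintegral -[X in fine X]/(\int[m]_x (EFin \o f) x)%E.
by case: (\int[m]_x (EFin \o f) x)%E => [r||] //=; rewrite normr0 leey.
Qed.

(** A Schur test in place of Plancherel. By [cft_swap] the left side is the integral of [u * N],
    where [N] is the transform of [gaussn e * F]; and [N] is an integral of [u] against a kernel
    dominated by [M], which is symmetric and of mass 1 in each variable. *)
Lemma gauss_cft_sqr_le e u c : 0 < e -> integrableR mu u ->
  (\int[mu]_xi (gaussn e xi * cft u c xi ^+ 2)%:E <= \int[mu]_x (u x ^+ 2)%:E)%E.
Proof.
move=> e0 iu; have mu_ := measurable_intR iu.
have mF := measurable_cft c iu; set F := cft u c in mF *.
pose M (x y : 'rV[R]_n) := 2^-1 * (kern e (y - x) + kern e (y + x)).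
have M0 x y : 0 <= M x y by rewrite mulr_ge0// addr_ge0// kern_ge0.
have mM : measurable_fun setT (fun z : 'rV[R]_n * 'rV[R]_n => M z.1 z.2).
  apply: measurable_funM => //; apply: measurable_funD.
    by apply: measurableT_comp (@measurable_kern R n e) _; exact: measurable_fun_rVB.
  by apply: measurableT_comp (@measurable_kern R n e) _; exact: measurable_fun_rVD.
have igF : integrableR mu (fun x => gaussn e x * F x).
  by apply: (integrableMbound (integrable_gaussn n e0) mF) => x; exact: normr_cft.
have igF2 : integrableR mu (fun x => gaussn e x * F x ^+ 2).
  have := integrableMbound igF mF (fun x => normr_cft c x iu).
  by apply: eq_integrable => // x _; rewrite /= expr2 mulrA.
have mk (z : 'rV[R]_n) : measurable_fun setT (fun y : 'rV[R]_n => kern e (y + z)).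
  exact: measurableT_comp (@measurable_kern R n e) (measurable_rVD z).
have mM1 x : measurable_fun setT (M x) by exact: measurableT_comp mM (measurable_pair1 x).
have M1 x : (\int[mu]_y (M x y)%:E = 1)%E.
  rewrite ge0_integralRZl//; [|by move=> y; rewrite addr_ge0 ?kern_ge0|exact: measurable_funD].
  rewrite ge0_integralRD//; [|by move=> y; exact: kern_ge0..].
  rewrite (ge0_integral_kernD (- x) e0) (ge0_integral_kernD x e0).
  by rewrite -EFinD -EFinM -(@natrD _ 1 1) mulVf.
pose N := cft (fun z => gaussn e z * F z) c.
have NE x : N x = \int[mu]_y (u y * (2^-1 * (kern e (y - x) + cos (c + c) * kern e (y + x)))).
  transitivity (\int[mu]_xi (cft u c xi * gaussn e xi * cos (2 * pi * dotrV xi x + c))).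
    by apply: eq_Rintegral => xi _; rewrite /F; ring.
  by rewrite gauss_cft_swap// subrr cos0; apply: eq_Rintegral => y _; rewrite mul1r.
have N_le x : (`|N x|%:E <= \int[mu]_y (`|u y| * M x y)%:E)%E.
  rewrite NE; apply: (le_trans (normr_Rintegral_le_integral mu _)).
    apply: measurable_funM => //; apply: measurable_funM => //; apply: measurable_funD => //.
    exact: measurable_funM.
  apply: ge0_le_integralT => y; rewrite lee_fin// normrM ler_wpM2l// normrM ger0_norm//.
  rewrite /M ler_wpM2l// (le_trans (ler_normD _ _))// ger0_norm ?kern_ge0//.
  by rewrite lerD2l normrM (ger0_norm (kern_ge0 _ e0)) ler_piMl ?kern_ge0 ?cos_max.
have mB : measurable_fun setT (fun z : 'rV[R]_n * 'rV[R]_n => (u z.2 ^+ 2 * M z.1 z.2)%:E).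
  apply/measurable_EFinP; apply: measurable_funM => //; apply: measurable_funX.
  exact: measurableT_comp mu_ measurable_snd.
have B0 x y : (0 <= (u y ^+ 2 * M x y)%:E)%E by rewrite lee_fin mulr_ge0 ?sqr_ge0.
have mB1 : measurable_fun setT (fun x => \int[mu]_y (u y ^+ 2 * M x y)%:E)%E.
  by apply: (@measurable_fun_fubini_tonelli_F _ _ _ _ R mu (fun z => (u z.2 ^+ 2 * M z.1 z.2)%:E)).
have iB : (\int[mu]_x \int[mu]_y (u y ^+ 2 * M x y)%:E = \int[mu]_x (u x ^+ 2)%:E)%E.
  have /= -> := @fubini_tonelli _ _ _ _ R mu mu _ mB (fun z => B0 z.1 z.2).
  apply: eq_integral => y _ /=.
  have MC x : M x y = M y x by rewrite /M -(kern_oppr e (y - x)) opprB (addrC x y).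
  under eq_integral do rewrite MC.
  by rewrite ge0_integralRZl ?sqr_ge0// M1 mule1.
(* AM-GM: [|u x| |u y| <= (u x ^+ 2 + u y ^+ 2) / 2] *)
have step x : (`|u x * N x|%:E <= 2^-1%:E * ((u x ^+ 2)%:E + \int[mu]_y (u y ^+ 2 * M x y)%:E))%E.
  have -> : (2^-1%:E * ((u x ^+ 2)%:E + \int[mu]_y (u y ^+ 2 * M x y)%:E) =
      \int[mu]_y (2^-1 * (u x ^+ 2 * M x y + u y ^+ 2 * M x y))%:E)%E.
    have p0 y z : 0 <= u z ^+ 2 * M x y by rewrite mulr_ge0 ?sqr_ge0.
    have mx : measurable_fun setT (fun y => u x ^+ 2 * M x y) by exact: measurable_funM.
    have my : measurable_fun setT (fun y => u y ^+ 2 * M x y).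
      by apply: measurable_funM => //; exact: measurable_funX.
    rewrite ge0_integralRZl//; [|by move=> y; rewrite addr_ge0|exact: measurable_funD].
    by rewrite ge0_integralRD// ge0_integralRZl ?sqr_ge0// M1 mule1.
  rewrite normrM EFinM; apply: (@le_trans _ _ (`|u x|%:E * \int[mu]_y (`|u y| * M x y)%:E)%E).
    by apply: lee_wpmul2l; rewrite ?lee_fin.
  rewrite -ge0_integralRZl//; [|by move=> y; rewrite mulr_ge0|by apply: measurable_funM => //; exact: measurableT_comp].
  apply: ge0_le_integralT => y; rewrite lee_fin; first by rewrite mulr_ge0// mulr_ge0.
  rewrite mulrA -mulrDl [leRHS]mulrA ler_wpM2r//.
  rewrite -[u x ^+ 2]real_normK ?num_real// -[u y ^+ 2]real_normK ?num_real//.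
  by have := sqr_ge0 (`|u x| - `|u y|); lra.
have -> : (\int[mu]_xi (gaussn e xi * F xi ^+ 2)%:E = (\int[mu]_x (u x * N x))%:E)%E.
  rewrite integral_EFinR// -cft_swap//; congr EFin.
  by apply: eq_Rintegral => x _; rewrite -mulrA expr2.
have mN : measurable_fun setT (fun x => u x * N x) by apply: measurable_funM => //; exact: measurable_cft.
apply: (@le_trans _ _ (\int[mu]_x `|u x * N x|%:E)%E).
  by apply: le_trans (normr_Rintegral_le_integral mu mN); rewrite lee_fin ler_norm.
have mu2 : measurable_fun setT (fun x => (u x ^+ 2)%:E).
  by apply/measurable_EFinP; exact: measurable_funX.
apply: (le_trans (ge0_le_integralT _ _ step)) => [x|]; first by rewrite lee_fin.
rewrite ge0_integralZl_EFin//; last 2 first.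
- by move=> x _; apply: adde_ge0; [rewrite lee_fin sqr_ge0|apply: integral_ge0].
- exact: emeasurable_funD.
rewrite ge0_integralD//; [|by move=> x _; rewrite lee_fin sqr_ge0|by move=> x _; apply: integral_ge0].
rewrite iB; set I := (\int[mu]_x _)%E.
have I0 : (0 <= I)%E by apply: integral_ge0 => x _; rewrite lee_fin sqr_ge0.
have -> : (I + I = 2%:E * I)%E by rewrite mule_natl mule2n.
by rewrite muleA -EFinM mulVf// mul1e.
Qed.

(** Fatou's lemma with the lower limit replaced by an actual limit. It removes Gaussian factors,
    mollifications and truncations once the bound is uniform in them. *)
Lemma fatou_le d (T : measurableType d) (m : {measure set T -> \bar R})
    (f_ : nat -> T -> R) (f : T -> R) (B : \bar R) :
  (forall k, measurable_fun setT (f_ k)) -> (forall k x, 0 <= f_ k x) ->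
  (forall x, f_ k x @[k --> \oo] --> f x) ->
  (forall k, \int[m]_x (f_ k x)%:E <= B)%E ->
  (\int[m]_x (f x)%:E <= B)%E.
Proof.
move=> mf f0 ff fB.
have -> : (\int[m]_x (f x)%:E = \int[m]_x limn_einf (fun k => (f_ k x)%:E))%E.
  apply: eq_integral => x _; apply/esym.
  have cE : (f_ k x)%:E @[k --> \oo] --> (f x)%:E.
    by apply: cvg_EFin; [exact: nearW|exact: ff].
  rewrite is_cvg_limn_einfE; first exact: cvg_lim cE.
  by apply/cvg_ex; exists (f x)%:E.
apply: le_trans.
  apply: (@fatou _ _ _ m setT measurableT (fun k x => (f_ k x)%:E)).
    by move=> k; exact/measurable_EFinP.
  by move=> k x _; rewrite lee_fin.
rewrite limn_einf_lim; apply: lime_le.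
  exact: is_cvg_einfs.
apply: nearW => k; apply: ereal_inf_le.
exists (\int[m]_x (f_ k x)%:E)%E; last exact: fB.
by exists k => /=.
Qed.

(** The Gaussian in [gauss_cft_sqr_le] tends to 1 pointwise while the right side does not involve
    [e]. *)
Lemma cft_sqr_le u c : integrableR mu u ->
  (\int[mu]_xi (cft u c xi ^+ 2)%:E <= \int[mu]_x (u x ^+ 2)%:E)%E.
Proof.
move=> iu.
apply: (@fatou_le _ _ mu (fun k xi => gaussn k.+1%:R^-1 xi * cft u c xi ^+ 2)).
- move=> k; apply: measurable_funM; first exact: measurable_gaussn.
  by apply: measurable_funX; exact: measurable_cft.
- by move=> k x; rewrite mulr_ge0 ?gaussn_ge0 ?sqr_ge0.
- move=> x; suff : gaussn k.+1%:R^-1 x * cst (cft u c x ^+ 2) k @[k --> \oo] --> 1 * cft u c x ^+ 2.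
    by rewrite mul1r.
  by apply: cvgM; [exact: cvg_gaussn|exact: cvg_cst].
- by move=> k; apply: gauss_cft_sqr_le => //; rewrite invr_gt0 ltr0n.
Qed.

End cosine_transform.

(** * Decay of the Fourier transform of a Schwartz function *)

Section line_derivative.
Context {R : realType} {n : nat}.
Implicit Types (f : 'rV[R]_n -> R) (x v : 'rV[R]_n).

Lemma is_derive_line f x v (t : R) : derivable f (x + t *: v) v ->
  is_derive t (1 : R) (fun s : R => f (x + s *: v)) ('D_v f (x + t *: v)).
Proof.
move=> df.
have E : (fun h : R => h^-1 *: (((fun s : R => f (x + s *: v)) \o shift t) (h *: (1 : R)) - f (x + t *: v)))
   = (fun h => h^-1 *: ((f \o shift (x + t *: v)) (h *: v) - f (x + t *: v))).
  apply/funext => h; congr (_ *: (f _ - _)).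
  by rewrite /= /shift/= [h *: 1]mulr1 scalerDl addrCA.
split.
  by rewrite /derivable E; exact: df.
by rewrite /derive E.
Qed.

Lemma derivable_shift f x v w : derivable f (x + w) v ->
  derivable (fun y => f (y + w)) x v /\ 'D_v (fun y => f (y + w)) x = 'D_v f (x + w).
Proof.
have E : (fun h : R => h^-1 *: (((fun y => f (y + w)) \o shift x) (h *: v) - f (x + w)))
   = (fun h => h^-1 *: ((f \o shift (x + w)) (h *: v) - f (x + w))).
  by apply/funext => h; congr (_ *: (f _ - _)); rewrite /= /shift/= addrA.
by move=> df; split; [rewrite /derivable E|rewrite /derive E].
Qed.

Definition diffop v f : 'rV[R]_n -> R := fun x => f (x + v) - f x.

Lemma smooth_derivable f i x : smooth f -> derivable f x (delta_mx ord0 i).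
Proof. by move=> /(_ [::]) [_]; exact. Qed.

Lemma smooth_partial f i : smooth f -> smooth (partial i f).
Proof.
move=> sf s; have := sf (rcons s i).
by rewrite /partials foldr_rcons.
Qed.

Lemma partial_diffop f i v : (forall x, derivable f x (delta_mx ord0 i)) ->
  partial i (diffop v f) = diffop v (partial i f) /\
  (forall x, derivable (diffop v f) x (delta_mx ord0 i)).
Proof.
move=> df; split=> [|x].
  apply/funext => x; rewrite /partial /diffop.
  have [d1 d2] := derivable_shift (df (x + v)).
  by rewrite -d2; exact: (deriveB d1 (df x)).
have [d1 d2] := derivable_shift (df (x + v)).
exact: (derivableB d1 (df x)).
Qed.

Lemma partials_diffop f s v : smooth f ->
  partials s (diffop v f) = diffop v (partials s f).
Proof.
move=> sf; elim: s => // i s IHs.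
by rewrite /= IHs; apply: (partial_diffop _ _).1 => x; exact: (sf s).2.
Qed.

Lemma smooth_diffop f v : smooth f -> smooth (diffop v f).
Proof.
move=> sf s; rewrite partials_diffop//; split=> [x|i x].
  have c1 : {for x, continuous (fun y : 'rV[R]_n => partials s f (y + v))}.
    apply: (@continuous_comp 'rV[R]_n 'rV[R]_n R (fun y : 'rV[R]_n => y + v) (partials s f)).
      by apply: continuousD; [exact: cvg_id|exact: cst_continuous].
    exact: (sf s).1.
  exact: (continuousB c1 ((sf s).1 x)).
by apply: (partial_diffop _ _).2 => y; exact: (sf s).2.
Qed.

(** Only coordinate [i] moves, and [1 + a^2 <= 3 (1 + (a + th)^2)] for [|th| <= 1]. *)
Lemma wt_shift x i (th : R) : `|th| <= 1 ->
  wt (x + th *: delta_mx ord0 i) <= 3 * wt x.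
Proof.
move=> th1.
rewrite /wt (bigD1 i)//= [in leRHS](bigD1 i)//= mulrA.
apply: ler_pM.
- by rewrite invr_ge0 addr_ge0 ?sqr_ge0.
- by apply: prodr_ge0 => j _; rewrite invr_ge0 addr_ge0 ?sqr_ge0.
- have -> : (x + th *: delta_mx ord0 i) ord0 i = x ord0 i + th.
    by rewrite !mxE !eqxx mulr1.
  set a := x ord0 i.
  have a0 : 0 < 1 + a ^+ 2 by rewrite ltr_pwDl ?sqr_ge0.
  have b0 : 0 < 1 + (a + th) ^+ 2 by rewrite ltr_pwDl ?sqr_ge0.
  rewrite ler_pdivlMr// mulrC ler_pdivrMr//.
  have := sqr_ge0 (a + 2 * th).
  have : th ^+ 2 <= 1 by rewrite -[th ^+ 2]real_normK ?num_real// exprn_ile1.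
  by nra.
- rewrite le_eqVlt; apply/orP; left; apply/eqP; apply: eq_bigr => j ji.
  by rewrite !mxE (negbTE ji) mulr0 addr0.
Qed.

(** The mean value theorem on a coordinate line; the factor 3 compares the weight at the
    intermediate point with the weight at [x]. *)
Lemma diffop_bound f i (h B : R) : (forall x, derivable f x (delta_mx ord0 i)) ->
  `|h| <= 1 -> 0 <= B -> (forall x, `|partial i f x| <= B * wt x) ->
  forall x, `|diffop (h *: delta_mx ord0 i) f x| <= 3 * `|h| * B * wt x.
Proof.
move=> df h1 B0 fB x.
pose g (t : R) := f (x + t *: delta_mx ord0 i).
have dg t : is_derive t (1 : R) g (partial i f (x + t *: delta_mx ord0 i)).
  by apply: is_derive_line; exact: df.
have cg : continuous g.
  move=> t; apply: differentiable_continuous; apply/derivable1_diffP.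
  by case: (dg t).
have [c ch gE] : exists2 c, `|c| <= `|h| & g h - g 0 = partial i f (x + c *: delta_mx ord0 i) * h.
  have [h0|h0|->] := ltgtP h 0.
  - have [c ch E] := @MVT R g (fun t => partial i f (x + t *: delta_mx ord0 i)) h 0 h0
      (fun t _ => dg t) (continuous_subspaceT cg).
    move: ch; rewrite in_itv/= => /andP[hc c0].
    exists c; first by rewrite !ltr0_norm// lerN2 ltW.
    by rewrite -opprB E; ring.
  - have [c ch E] := @MVT R g (fun t => partial i f (x + t *: delta_mx ord0 i)) 0 h h0
      (fun t _ => dg t) (continuous_subspaceT cg).
    move: ch; rewrite in_itv/= => /andP[hc c0].
    exists c; first by rewrite !gtr0_norm// ltW.
    by rewrite E subr0.
  - by exists 0; rewrite ?normr0// subrr mulr0.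
have -> : diffop (h *: delta_mx ord0 i) f x = g h - g 0.
  by rewrite /diffop /g scale0r addr0.
rewrite gE normrM mulrC.
rewrite (_ : 3 * `|h| * B * wt x = `|h| * (B * (3 * wt x))); last by ring.
rewrite ler_wpM2l// (le_trans (fB _))// ler_wpM2l//.
by apply: wt_shift; exact: le_trans ch h1.
Qed.

End line_derivative.

Section schwartz_decay.
Context {R : realType} {n : nat}.
Implicit Types (f u : 'rV[R]_n -> R).
Local Notation mu := (rVleb R n).

Lemma wt_ge0 m (x : 'rV[R]_m) : 0 <= wt x.
Proof. exact/ltW/wt_gt0. Qed.

Lemma monomialD2 (alpha : 'I_n -> nat) i (x : 'rV[R]_n) :
  monomial (fun j => if j == i then (alpha j).+2 else alpha j) x =
  x ord0 i ^+ 2 * monomial alpha x.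
Proof.
rewrite /monomial (bigD1 i)//= eqxx [in RHS](bigD1 i)//= mulrA -exprD; congr (_ * _).
by apply: eq_bigr => j /negbTE ->.
Qed.

(** The reciprocal of [wt] is a product of factors [1 + x_i^2]. Adding one factor to the list [l]
    combines the bound for [alpha] with the bound for [alpha] raised by 2 at [i]. *)
Lemma schwartz_wt f s : schwartz_real f ->
  exists2 A, 0 <= A & forall x, `|partials s f x| <= A * wt x.
Proof.
move=> [_ fs].
have H (l : seq 'I_n) : forall alpha, exists M : R, forall x : 'rV[R]_n,
    `|(\prod_(i <- l) (1 + x ord0 i ^+ 2)) * monomial alpha x * partials s f x| <= M.
  elim: l => [|i l IHl] alpha.
    have [M HM] := fs alpha s; exists M => x.
    by rewrite big_nil mul1r.
  have [M HM] := IHl alpha.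
  have [N HN] := IHl (fun j => if j == i then (alpha j).+2 else alpha j).
  exists (M + N) => x; rewrite big_cons.
  rewrite (le_trans _ (lerD (HM x) (HN x)))// (le_trans _ (ler_normD _ _))//.
  by rewrite monomialD2 le_eqVlt; apply/orP; left; apply/eqP; congr (Num.norm _); ring.
have [M HM] := H (index_enum _) (fun=> 0%N).
have M0 : 0 <= M := le_trans (normr_ge0 _) (HM 0).
exists M => // x; have := HM x.
have -> : monomial (fun=> 0%N) x = 1 by rewrite /monomial big1// => i _; rewrite expr0.
rewrite mulr1 normrM.
have -> : \prod_i (1 + x ord0 i ^+ 2) = (wt x)^-1.
  by rewrite /wt -prodfV; apply: eq_bigr => i _; rewrite invrK.
by rewrite gtr0_norm ?invr_gt0 ?wt_gt0// ler_pdivrMl ?wt_gt0// mulrC.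
Qed.

Lemma schwartz_partial f i : schwartz_real f -> schwartz_real (partial i f).
Proof.
move=> [sf fs]; split; first exact: smooth_partial.
by move=> alpha s; have := fs alpha (rcons s i); rewrite /partials foldr_rcons.
Qed.

Lemma schwartz_wt_le (N : nat) f : schwartz_real f ->
  exists2 A, 0 <= A & forall s, (size s <= N)%N -> forall x, `|partials s f x| <= A * wt x.
Proof.
elim: N f => [|N IHN] f sf.
  have [A A0 HA] := schwartz_wt [::] sf.
  by exists A => // -[].
have [A A0 HA] := schwartz_wt [::] sf.
have /(_ _)/cid2-/all_sig[B HB] i := IHN (partial i f) (schwartz_partial i sf).
have B0 i : 0 <= B i by case: (HB i).
exists (A + \sum_i B i) => [|s]; first by rewrite addr_ge0// sumr_ge0.
elim/last_ind: s => [_ x|s i _].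
  by rewrite (le_trans (HA x))// ler_wpM2r ?wt_ge0// lerDl sumr_ge0.
rewrite size_rcons ltnS => sN x.
rewrite /partials foldr_rcons -/(partials s (partial i f)).
have [_ /(_ s sN x) h] := HB i.
rewrite (le_trans h)// ler_wpM2r ?wt_ge0//.
by rewrite (bigD1 i)//= addrCA lerDl addr_ge0// sumr_ge0.
Qed.

Lemma integrable_wt_le u A : measurable_fun setT u -> (forall x, `|u x| <= A * wt x) ->
  integrableR mu u.
Proof.
move=> mu_ uA; apply: (le_integrableR mu_ uA).
exact: (integrableRZl A (integrable_wt n)).
Qed.

Lemma cft_shift u v c xi : integrableR mu u ->
  cft (fun x => u (x + v)) c xi = cft u (c - 2 * pi * dotrV v xi) xi.
Proof.
move=> iu; rewrite /cft.
rewrite -(Rintegral_shift v (integrable_cosphase (c - 2 * pi * dotrV v xi) xi iu)).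
apply: eq_Rintegral => x _; congr (_ * cos _).
by rewrite dotrVDl; ring.
Qed.

(* Translation by half a period: this replaces integration by parts in the decay estimate. *)
Lemma cft_diffop u v c xi : integrableR mu u -> 2 * dotrV v xi = 1 ->
  cft (diffop v u) c xi = - 2 * cft u c xi.
Proof.
move=> iu vxi.
have -> : cft (diffop v u) c xi = cft (fun x => u (x + v)) c xi - cft u c xi.
  rewrite /cft -RintegralB//; last 2 first.
  - exact/integrable_cosphase/integrable_shift.
  - exact: integrable_cosphase.
  by apply: eq_Rintegral => x _; rewrite -mulrBl.
rewrite cft_shift//.
have -> : cft u (c - 2 * pi * dotrV v xi) xi = - cft u c xi; last by ring.
rewrite (_ : 2 * pi * dotrV v xi = pi); last by rewrite mulrAC vxi mul1r.
rewrite -[RHS]mulN1r /cft -RintegralZl//; last exact: integrable_cosphase.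
apply: eq_Rintegral => x _; rewrite addrA cosB cospi sinpi; ring.
Qed.

Lemma dotrV_delta (h : R) i xi : dotrV (h *: delta_mx ord0 i : 'rV[R]_n) xi = h * xi ord0 i.
Proof.
rewrite /dotrV (bigD1 i)//= !mxE !eqxx/= mulr1 big1 ?addr0// => j ji.
by rewrite !mxE (negbTE ji) mulr0 mul0r.
Qed.

(* Each frequency coordinate in [l] gains a factor [2 / (1 + xi_j ^+ 2)] from two half-period differences, each of which costs one derivative. *)
Lemma cft_decay (l : seq 'I_n) u A c xi : smooth u -> 0 <= A ->
  (forall s, (size s <= 2 * size l)%N -> forall x, `|partials s u x| <= A * wt x) ->
  `|cft u c xi| <= A * (\int[mu]_x wt x) * \prod_(j <- l) (2 / (1 + xi ord0 j ^+ 2)).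
Proof.
have iu_ v B : smooth v -> (forall x, `|v x| <= B * wt x) -> integrableR mu v.
  move=> sv; apply: integrable_wt_le; apply: rV_continuous_measurable.
  exact: (sv [::]).1.
have I0 : 0 <= \int[mu]_x wt x by apply: Rintegral_ge0 => x _; exact/ltW/wt_gt0.
elim: l u A c => [|j l IHl] u A c su A0 uA.
  rewrite big_nil mulr1 (le_trans (normr_cft _ _ (iu_ _ _ su (uA [::] isT))))//.
  rewrite -RintegralZl//; last exact: integrable_wt.
  apply: le_Rintegral => //.
  - exact/integrable_norm/(iu_ _ _ su (uA [::] isT)).
  - exact: (integrableRZl A (integrable_wt n)).
  - by move=> x _; exact: (uA [::]).
set P := \prod_(i <- l) _ in IHl *.
have P0 : 0 <= P.
  by apply: prodr_ge0 => i _; rewrite divr_ge0// addr_ge0// sqr_ge0.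
have d0 : 0 < 1 + xi ord0 j ^+ 2 by rewrite ltr_pwDl ?sqr_ge0.
rewrite big_cons -/P.
(* At a low frequency the factor [2 / (1 + xi_j^2)] is at least 1, and no derivative is spent on
   it. *)
have [x1|x1] := leP `|xi ord0 j| 1.
  have uA' s : (size s <= 2 * size l)%N -> forall x, `|partials s u x| <= A * wt x.
    by move=> hs; apply: uA; rewrite (leq_trans hs)// leq_mul2l/=.
  apply: (le_trans (IHl u A c su A0 uA')).
  rewrite ler_wpM2l ?mulr_ge0// ler_peMl// ler_pdivlMr// mul1r.
  have : xi ord0 j ^+ 2 <= 1 by rewrite -[_ ^+ 2]real_normK ?num_real// exprn_ile1.
  by lra.
set x := xi ord0 j in x1 d0 *.
have x0 : x != 0 by rewrite -normr_gt0 (lt_trans _ x1).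
(* Half a period in direction [j]: a shift by [h] changes the phase by [pi]. *)
pose h := (2 * x)^-1.
have h1 : `|h| <= 1.
  rewrite /h normfV normrM ger0_norm// invf_le1 ?mulr_gt0 ?normr_gt0//.
  by have := ltW x1; lra.
pose v : 'rV[R]_n := h *: delta_mx ord0 j.
have vxi : 2 * dotrV v xi = 1.
  by rewrite dotrV_delta /h -/x; field.
pose g := diffop v (diffop v u).
have sdu : smooth (diffop v u) by exact: smooth_diffop.
have sg : smooth g by exact: smooth_diffop.
have gE s : partials s g = diffop v (diffop v (partials s u)).
  by rewrite /g partials_diffop// partials_diffop.
have du s y i : derivable (partials s u) y (delta_mx ord0 i) by exact: (su s).2.
pose B := 3 * `|h| * (3 * `|h| * A).
have B0 : 0 <= B by rewrite /B !mulr_ge0.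
have gB s : (size s <= 2 * size l)%N -> forall y, `|partials s g y| <= B * wt y.
  move=> hs; rewrite gE /B.
  have ddu y : derivable (diffop v (partials s u)) y (delta_mx ord0 j).
    by apply: (partial_diffop _ _).2 => z; exact: du.
  apply: (diffop_bound ddu h1); first by rewrite !mulr_ge0.
  rewrite (partial_diffop _ _).1 => [|z]; last exact: du.
  apply: (@diffop_bound _ _ _ j) => //.
  - by move=> z; exact: (du (j :: s)).
  - by apply: (uA (j :: j :: s)); rewrite /= mulnS addSn addSn add0n !ltnS.
have iu := iu_ _ _ su (uA [::] isT).
have idu : integrableR mu (diffop v u).
  exact: (integrableRB (integrable_shift v iu) iu).
have cg : cft g c xi = 4 * cft u c xi.
  by rewrite /g !cft_diffop//; ring.
have := IHl g B c sg B0 gB.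
rewrite cg normrM ger0_norm// -ler_pdivlMl// => /le_trans; apply.
rewrite (_ : 4^-1 * (B * _ * P) = (4^-1 * B) * ((\int[mu]_x wt x) * P)); last by ring.
rewrite (_ : A * _ * _ = (A * (2 / (1 + x ^+ 2))) * ((\int[mu]_x wt x) * P)); last by ring.
rewrite ler_wpM2r ?mulr_ge0//.
(* The gain is [9 / 4 * h^2 = 9 / (16 x^2)], which is below [2 / (1 + x^2)] because [x^2 >= 1]. *)
have -> : 4^-1 * B = A * (4^-1 * 9 * h ^+ 2).
  by rewrite -[h ^+ 2]real_normK ?num_real// /B; ring.
rewrite ler_wpM2l// ler_pdivlMr// /h.
have x21 : 1 <= x ^+ 2 by rewrite -[x ^+ 2]real_normK ?num_real// expr_ge1// ltW.
have -> : 4^-1 * 9 * (2 * x)^-1 ^+ 2 * (1 + x ^+ 2) = 9 / 16 * ((1 + x ^+ 2) / x ^+ 2).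
  by field.
rewrite mulrA ler_pdivrMr; last by apply: lt_le_trans x21.
by lra.
Qed.

Lemma schwartz_cft u : schwartz_real u ->
  exists2 A, 0 <= A & forall c xi, `|cft u c xi| <= A * wt xi.
Proof.
move=> su; have [A A0 HA] := schwartz_wt_le (2 * size (index_enum 'I_n)) su.
exists (A * (\int[mu]_x wt x) * 2 ^+ n) => [|c xi].
  rewrite !mulr_ge0 ?exprn_ge0//.
  by apply: Rintegral_ge0 => x _; exact/ltW/wt_gt0.
rewrite (le_trans (cft_decay c xi su.1 A0 HA))// big_split/=.
by rewrite prodr_const card_ord mulrA.
Qed.

End schwartz_decay.

(** * Regularized inverse Fourier transforms *)

Section trig_polynomials.
Context {R : realType} {n : nat}.
Implicit Types (G : 'rV[R]_n -> R).
Local Notation mu := (rVleb R n).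

Lemma is_derive_of_line (f : 'rV[R]_n -> R) x v (d : R) :
  is_derive (0 : R) (1 : R) (fun t : R => f (x + t *: v)) d -> is_derive x v f d.
Proof.
have E : (fun h : R => h^-1 *: (((fun s : R => f (x + s *: v)) \o shift (0 : R)) (h *: (1 : R)) - f (x + (0 : R) *: v)))
   = (fun h : R => h^-1 *: ((f \o shift x) (h *: v) - f x)).
  apply/funext => h; rewrite /= /shift/= addr0 scale0r addr0 [h *: 1]mulr1.
  by congr (_ *: (f _ - _)); rewrite addrC.
move=> [d1 d2]; split.
  by move: d1; rewrite /derivable E.
by rewrite -d2 /derive E.
Qed.

(** Bounded support makes the class stable under multiplication by a coordinate, which is what each
    derivative of [cft] brings in; the bound by [wt] gives integrability. *)
Definition bounded_support G := measurable_fun setT G /\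
  exists2 k : R, 0 <= k & exists2 A : R, 0 <= A & forall x : 'rV[R]_n,
    `|G x| <= A * wt x /\ (G x != 0 -> forall i, `|x ord0 i| <= k).

Lemma csb_integrable G : bounded_support G -> integrableR mu G.
Proof.
by move=> [mG [k _ [A _ GA]]]; apply: (integrable_wt_le mG (A := A)) => x; case: (GA x).
Qed.

Lemma csb_coord G (a : R) i : bounded_support G ->
  bounded_support (fun x => a * x ord0 i * G x).
Proof.
move=> [mG [k k0 [A A0 GA]]]; split.
  apply: measurable_funM => //; apply: measurable_funM => //.
  exact: measurable_rV_coord.
exists k => //; exists (`|a| * k * A); first by rewrite !mulr_ge0.
move=> x; have [G1 G2] := GA x.
have [Gx0|Gx0] := eqVneq (G x) 0.
  by rewrite Gx0 mulr0 normr0 eqxx; split => //; rewrite !mulr_ge0// wt_ge0.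
split; last by move=> _; exact: G2.
rewrite !normrM -mulrA -!mulrA ler_wpM2l// ler_pM//; exact: G2.
Qed.

Lemma cos_lipschitz (a b : R) : `|cos a - cos b| <= `|a - b|.
Proof.
wlog ab : a b / b < a.
  move=> H; have [ab|ab|->] := ltgtP a b; last by rewrite !subrr.
    by rewrite distrC (distrC a) H.
  exact: H.
have cc : continuous (cos : R -> R) := @continuous_cos R.
have [c _ ->] := @MVT R cos (fun t => - sin t) b a ab (fun t _ => is_derive_cos t) (continuous_subspaceT cc).
by rewrite normrM normrN ler_piMl// sin_max.
Qed.

Lemma norm_rV_coord (x : 'rV[R]_n) i : `|x ord0 i| <= `|x|.
Proof.
rewrite [leRHS]mx_normrE.
exact: (le_bigmax _ (fun ij : (ordinal 1 * ordinal n)%type => `|x ij.1 ij.2|) (ord0, i)).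
Qed.

(** On the support of [G] the integration variable has coordinates of size at most [k], so the phase
    is Lipschitz in [x] with constant [2 pi n k] for the maximum norm. *)
Lemma continuous_cft G c : bounded_support G -> continuous (cft G c).
Proof.
move=> aG x; have iG := csb_integrable aG.
case: (aG) => mG [k k0 [A A0 GA]].
have L y : `|cft G c x - cft G c y| <= (2 * pi * n%:R * k * \int[mu]_z `|G z|) * `|x - y|.
  rewrite /cft -RintegralB//; [|exact: integrable_cosphase..].
  have mB : measurable_fun setT (fun z => G z * cos (2 * pi * dotrV z x + c) - G z * cos (2 * pi * dotrV z y + c)).
    by apply: measurable_funB; apply: measurable_funM => //; exact: measurable_cosphase1.
  have iB : integrableR mu (fun z => (2 * pi * n%:R * k * `|x - y|) * `|G z|).
    exact: (integrableRZl (2 * pi * n%:R * k * `|x - y|) (integrable_norm iG)).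
  rewrite [leRHS](_ : _ = \int[mu]_z ((2 * pi * n%:R * k * `|x - y|) * `|G z|)); last first.
    by rewrite RintegralZl//; [ring|exact: integrable_norm].
  apply: (normr_Rintegral_le mB iB) => z.
  rewrite -mulrBr normrM mulrC.
  have [->|/(GA z).2 zk] := eqVneq (G z) 0; first by rewrite normr0 !mulr0.
  rewrite ler_wpM2r// (le_trans (cos_lipschitz _ _))//.
  rewrite opprD addrACA subrr addr0 -mulrBr normrM ger0_norm ?mulr_ge0 ?pi_ge0//.
  rewrite -!mulrA ler_wpM2l// ler_wpM2l ?pi_ge0//.
  rewrite ![dotrV z _]dotrVC -dotrVBl.
  rewrite (le_trans (ler_norm_sum _ _ _))//.
  rewrite (_ : n%:R * _ = \sum_(i < n) (k * `|x - y|)); last first.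
    by rewrite sumr_const card_ord mulr_natl.
  apply: ler_sum => i _; rewrite normrM mulrC ler_pM//.
  exact: norm_rV_coord.
set C := (X in forall y, _ <= X * _) in L.
have C0 : 0 <= C.
  by rewrite /C !mulr_ge0 ?pi_ge0// Rintegral_ge0.
suff : cft G c y @[y --> nbhs (x : 'rV[R]_n)] --> cft G c x by [].
apply/cvgrPdist_le => e e0; near=> y.
rewrite (le_trans (L y))//.
have : `|x - y| <= e / (C + 1).
  near: y; apply: cvgr_dist_le; first exact: cvg_id.
  by rewrite divr_gt0// ltr_wpDl.
rewrite ler_pdivlMr ?ltr_wpDl// => H; apply: (le_trans _ H).
by rewrite mulrC ler_wpM2l// lerDl.
Unshelve. all: by end_near. Qed.

(** A sine is a cosine with phase lowered by [pi / 2], so the derivative is again a [cft], with a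
    coordinate absorbed into [G]. *)
Lemma is_derive_cft G c i x : bounded_support G ->
  is_derive x (delta_mx ord0 i) (cft G c)
    (cft (fun z => - (2 * pi) * z ord0 i * G z) (c - pi / 2) x).
Proof.
move=> aG; apply: is_derive_of_line.
have iG := csb_integrable aG.
have aG' := csb_coord (- (2 * pi)) i aG.
have iG' := csb_integrable aG'.
pose f (t : R) (z : 'rV[R]_n) := G z * cos (2 * pi * (dotrV z x + t * z ord0 i) + c).
have fE t z : f t z = G z * cos (2 * pi * dotrV z (x + t *: delta_mx ord0 i) + c).
  by rewrite /f ![dotrV z _]dotrVC dotrVDl dotrV_delta.
pose G1 (z : 'rV[R]_n) := `| - (2 * pi) * z ord0 i * G z|.
have df t z : is_derive t (1 : R) (f ^~ z) (- (2 * pi) * z ord0 i * G z * sin (2 * pi * (dotrV z x + t * z ord0 i) + c)).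
  by rewrite /f; apply: is_derive_eq; rewrite /GRing.scale/=; ring.
have xi1 : `](0 - 1 : R), 1[%classic (0 : R) by rewrite /= in_itv/= sub0r ltrN10 ltr01.
have H1 t : `](0 - 1 : R), 1[%classic t -> integrableR mu (f t).
  move=> _; have := integrable_cosphase c (x + t *: delta_mx ord0 i) iG.
  by apply: eq_integrable => // z _; rewrite /= fE.
have H2 t z : `](0 - 1 : R), 1[%classic t -> setT z -> derivable (f ^~ z) t 1.
  by move=> _ _; case: (df t z).
have G10 z : 0 <= G1 z by exact: normr_ge0.
have iG1 : integrableR mu G1 by exact: integrable_norm.
have d1E t z : partial1of2 f t z = - (2 * pi) * z ord0 i * G z * sin (2 * pi * (dotrV z x + t * z ord0 i) + c).
  by rewrite partial1of2E; exact: (@derive_val _ _ _ _ _ _ _ (df t z)).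
have H3 t z : `](0 - 1 : R), 1[%classic t -> setT z -> `|partial1of2 f t z| <= G1 z.
  by move=> _ _; rewrite d1E /G1 [leLHS]normrM ler_piMr// sin_max.
have D1 := derivable_under_integral measurableT xi1 H1 H2 G10 iG1 H3.
have D2 := differentiation_under_integral measurableT xi1 H1 H2 G10 iG1 H3.
rewrite derive1E in D2.
have FE : (fun t : R => cft G c (x + t *: delta_mx ord0 i)) = (fun t => \int[mu]_z f t z).
  by apply/funext => t; apply: eq_Rintegral => z _; rewrite fE.
rewrite FE; apply: (DeriveDef D1); rewrite D2.
apply: eq_Rintegral => z _; rewrite d1E mul0r addr0; congr (_ * _).
by rewrite addrA cosB cos_pihalf sin_pihalf mulr0 mulr1 add0r.
Qed.

(* A class stable under partial derivatives, up to the Gaussian factor, on which the regularized inverse transforms lie. *)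
Inductive trig_poly : ('rV[R]_n -> R) -> Prop :=
| trig_cft G c : bounded_support G -> trig_poly (cft G c)
| trig_coord i h : trig_poly h -> trig_poly (fun x : 'rV[R]_n => x ord0 i * h x)
| trig_add h1 h2 : trig_poly h1 -> trig_poly h2 -> trig_poly (fun x => h1 x + h2 x)
| trig_scale (a : R) h : trig_poly h -> trig_poly (fun x => a * h x).

Lemma is_derive_coord i j (x : 'rV[R]_n) :
  is_derive x (delta_mx ord0 i) (fun y : 'rV[R]_n => y ord0 j) (j == i)%:R.
Proof.
apply: is_derive_of_line.
have -> : (fun t : R => (x + t *: delta_mx ord0 i) ord0 j) = (fun t => x ord0 j + t * (j == i)%:R).
  by apply/funext => t; rewrite !mxE eqxx.
by apply: is_derive_eq; rewrite /GRing.scale/=; ring.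
Qed.

Lemma trig_continuous h : trig_poly h -> continuous h.
Proof.
elim=> [G c aG|i {}h _ IH|h1 h2 _ IH1 _ IH2|a {}h _ IH].
- exact: continuous_cft.
- by move=> x; apply: continuousM; [exact: coord_continuous|exact: IH].
- by move=> x; apply: continuousD; [exact: IH1|exact: IH2].
- by move=> x; apply: continuousM; [exact: cst_continuous|exact: IH].
Qed.

Lemma trig_derive h i : trig_poly h ->
  exists2 h', trig_poly h' & forall x, is_derive x (delta_mx ord0 i) h (h' x).
Proof.
elim=> [G c aG|j {}h th [h' th' IH]|h1 h2 _ [h1' t1 IH1] _ [h2' t2 IH2]|a {}h _ [h' th' IH]].
- exists (cft (fun z => - (2 * pi) * z ord0 i * G z) (c - pi / 2)).
    by apply: trig_cft; exact: csb_coord.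
  by move=> x; exact: is_derive_cft.
- exists (fun x : 'rV[R]_n => x ord0 j * h' x + (j == i)%:R * h x).
    by apply: trig_add; [exact: trig_coord|exact: trig_scale].
  move=> x; have /= d := is_deriveM (is_derive_coord i j x) (IH x).
  apply: (is_derive_eq d); rewrite /GRing.scale/=; ring.
- exists (fun x => h1' x + h2' x); first exact: trig_add.
  by move=> x; exact: is_deriveD (IH1 x) (IH2 x).
- exists (fun x => a * h' x); first exact: trig_scale.
  by move=> x; exact: (@is_deriveZ _ _ _ h a x _ _ (IH x)).
Qed.

Lemma gaussn_double e (x : 'rV[R]_n) :
  gaussn e x = gaussn (e / Num.sqrt 2) x * gaussn (e / Num.sqrt 2) x.
Proof.
rewrite /gaussn -big_split/=; apply: eq_bigr => i _; rewrite -expRD; congr expR.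
by rewrite expr_div_n sqr_sqrtr//; field.
Qed.

(** Quantified over all widths because a coordinate factor uses up half of the Gaussian: [gaussn e]
    is the square of the wider [gaussn (e / sqrt 2)]; one copy bounds [x_j], the other goes to the
    induction hypothesis. *)
Lemma trig_gauss_bounded h : trig_poly h -> forall e : R, 0 < e ->
  exists2 M, 0 <= M & forall x, `|h x| * gaussn e x <= M.
Proof.
elim=> [G c aG|j {}h th IH|h1 h2 _ IH1 _ IH2|a {}h _ IH] e e0.
- exists (\int[mu]_z `|G z|); first exact: Rintegral_ge0.
  move=> x; rewrite (le_trans _ (normr_cft c x (csb_integrable aG)))//.
  by rewrite ler_piMr// gaussn_le1.
- have e20 : 0 < e / Num.sqrt 2 by rewrite divr_gt0// sqrtr_gt0.
  have [M M0 HM] := IH _ e20.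
  have a0 : 0 < pi * (e / Num.sqrt 2) ^+ 2 by rewrite mulr_gt0 ?pi_gt0 ?exprn_gt0.
  have [N N0 HN] := powr_gauss_bound 1 a0.
  exists (N * M) => [|x]; first exact: mulr_ge0.
  rewrite normrM gaussn_double mulrACA ler_pM ?mulr_ge0 ?gaussn_ge0//.
  rewrite (le_trans _ (HN (x ord0 j)))// expr1 ler_wpM2l//.
  rewrite /gaussn (bigD1 j)//= ler_piMr ?expR_ge0//.
  apply: prodr_ile1 => i _; rewrite expR_ge0/= -expR0 ler_expR oppr_le0.
  by apply: mulr_ge0; [apply: mulr_ge0|]; rewrite ?sqr_ge0 ?pi_ge0.
- have [M M0 HM] := IH1 e e0; have [N N0 HN] := IH2 e e0.
  exists (M + N) => [|x]; first exact: addr_ge0.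
  rewrite (le_trans _ (lerD (HM x) (HN x)))// -mulrDl ler_wpM2r ?gaussn_ge0//.
  exact: ler_normD.
- have [M M0 HM] := IH e e0; exists (`|a| * M) => [|x]; first exact: mulr_ge0.
  by rewrite normrM -mulrA ler_wpM2l.
Qed.

Lemma is_derive_gaussn e i (x : 'rV[R]_n) :
  is_derive x (delta_mx ord0 i) (gaussn e) (- (2 * pi * e ^+ 2) * x ord0 i * gaussn e x).
Proof.
apply: is_derive_of_line.
pose C := \prod_(j < n | j != i) expR (- (pi * e ^+ 2 * x ord0 j ^+ 2)).
have E t : gaussn e (x + t *: delta_mx ord0 i) = expR (- (pi * e ^+ 2 * (x ord0 i + t) ^+ 2)) * C.
  rewrite /gaussn (bigD1 i)//= !mxE !eqxx mulr1; congr (_ * _).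
  by apply: eq_bigr => j /negbTE ji; rewrite !mxE ji mulr0 addr0.
have -> : gaussn e x = expR (- (pi * e ^+ 2 * x ord0 i ^+ 2)) * C.
  by have := E 0; rewrite scale0r !addr0.
under eq_fun do rewrite E.
apply: is_derive_eq; rewrite /GRing.scale/= !addr0; ring.
Qed.

Lemma continuous_gaussn e : continuous (@gaussn R n e).
Proof.
move=> x; suff : gaussn e y @[y --> nbhs (x : 'rV[R]_n)] --> gaussn e x by [].
rewrite /gaussn; apply: cvg_big => [|i _]; first exact: mul_continuous.
apply: (@continuous_comp 'rV[R]_n R R (fun y : 'rV[R]_n => y ord0 i) (fun t => expR (- (pi * e ^+ 2 * t ^+ 2)))).
  exact: coord_continuous.
exact: continuous_gauss.
Qed.

Lemma partials_trig_gauss h e s : trig_poly h ->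
  exists2 h', trig_poly h' & partials s (fun x => h x * gaussn e x) = (fun x => h' x * gaussn e x).
Proof.
move=> th; elim: s => [|i s [h' th' IH]]; first by exists h.
have [h2 th2 dh] := trig_derive i th'.
exists (fun x : 'rV[R]_n => h2 x + (- (2 * pi * e ^+ 2)) * (x ord0 i * h' x)).
  by apply: trig_add => //; apply: trig_scale; exact: trig_coord.
rewrite /= IH; apply/funext => x; rewrite /partial.
have d := is_deriveM (dh x) (is_derive_gaussn e i x).
rewrite (@derive_val _ _ _ _ _ _ _ d) /GRing.scale/=; ring.
Qed.

Lemma schwartz_trig_gauss h e : 0 < e -> trig_poly h ->
  schwartz_real (fun x => h x * gaussn e x).
Proof.
move=> e0 th; split=> [s|alpha s].
  have [h' th' ->] := partials_trig_gauss e s th; split=> [x|i x].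
    by apply: continuousM; [exact: trig_continuous|exact: continuous_gaussn].
  have [h2 th2 dh] := trig_derive i th'.
  by have [] := is_deriveM (dh x) (is_derive_gaussn e i x).
have [h' th' ->] := partials_trig_gauss e s th.
(* Monomials are absorbed into the class, so that rapid decay reduces to boundedness. *)
have tm (l : seq 'I_n) : trig_poly (fun x : 'rV[R]_n => (\prod_(i <- l) x ord0 i ^+ alpha i) * h' x).
  elim: l => [|i l IHl].
    by under eq_fun do rewrite big_nil mul1r.
  under eq_fun do rewrite big_cons -mulrA.
  elim: (alpha i) => [|k IHk]; first by under eq_fun do rewrite expr0 mul1r.
  by under eq_fun do rewrite exprS -mulrA; exact: trig_coord.
have [M M0 HM] := trig_gauss_bounded (tm (index_enum _)) e0.
exists M => x; rewrite mulrA normrM (ger0_norm (gaussn_ge0 _ _)).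
exact: HM.
Qed.

End trig_polynomials.

(** * Gaussian kernels as an approximate identity *)

Section approximate_identity.
Context {R : realType} {n : nat}.
Local Notation mu := (rVleb R n).

(** A quarter of the exponent of [kern e] is the exponent of [kern (2 * e)]; the other three
    quarters give the decay at distance [d], and [2 ^+ n] corrects the normalization. *)
Lemma kern_tail (e d : R) (x : 'rV[R]_n) i : 0 < e -> 0 <= d -> d <= `|x ord0 i| ->
  kern e x <= 2 ^+ n * expR (- (pi * d ^+ 2 / (2 * e ^+ 2))) * kern (2 * e) x.
Proof.
move=> e0 d0 dx; rewrite /kern.
have E j : e^-1 * expR (- (pi * (x ord0 j / e) ^+ 2)) =
    2 * expR (- (3 / 4 * (pi * (x ord0 j / e) ^+ 2))) *
    ((2 * e)^-1 * expR (- (pi * (x ord0 j / (2 * e)) ^+ 2))).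
  rewrite mulrACA -expRD; congr (_ * expR _); first by field; rewrite gt_eqF.
  by field; rewrite gt_eqF.
under eq_bigr do rewrite E.
rewrite big_split/=; apply: ler_wpM2r.
  by apply: prodr_ge0 => j _; rewrite mulr_ge0 ?expR_ge0// invr_ge0 mulr_ge0// ltW.
rewrite big_split/= prodr_const card_ord ler_wpM2l ?exprn_ge0//.
rewrite (bigD1 i)//=.
have a0 j : 0 <= 3 / 4 * (pi * (x ord0 j / e) ^+ 2).
  by apply: mulr_ge0 => //; apply: mulr_ge0; rewrite ?pi_ge0 ?sqr_ge0.
rewrite (@le_trans _ _ (expR (- (3 / 4 * (pi * (x ord0 i / e) ^+ 2)))))//.
  rewrite ler_piMr ?expR_ge0//; apply: prodr_ile1 => j _.
  by rewrite expR_ge0/= -[leRHS]expR0 ler_expR oppr_le0.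
rewrite ler_expR lerN2.
have d2 : d ^+ 2 <= x ord0 i ^+ 2.
  by rewrite -[leRHS]real_normK ?num_real// ler_sqr ?nnegrE.
have e20 : 0 < e ^+ 2 by rewrite exprn_gt0.
rewrite expr_div_n (_ : pi * d ^+ 2 / (2 * e ^+ 2) = pi / e ^+ 2 * (1 / 2 * d ^+ 2)); last first.
  by field; rewrite gt_eqF.
rewrite (_ : 3 / 4 * _ = pi / e ^+ 2 * (3 / 4 * x ord0 i ^+ 2)); last first.
  by field; rewrite gt_eqF.
rewrite ler_wpM2l ?divr_ge0 ?pi_ge0 ?(ltW e20)//.
by have := sqr_ge0 d; lra.
Qed.

Lemma kern_shift_integrable (e : R) (y : 'rV[R]_n) : 0 < e ->
  integrableR mu (fun x => kern e (x - y)) /\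
  \int[mu]_x kern e (x - y) = 1.
Proof.
move=> e0; have ik := integrable_kern n e0.
by rewrite (Rintegral_shift (- y) ik) Rintegral_kern//; split => //; exact: integrable_shift.
Qed.

Lemma approximate_identity (p : 'rV[R]_n -> R) (y : 'rV[R]_n) : continuous p -> (forall x, `|p x| <= 1) ->
  \int[mu]_x (kern k.+1%:R^-1 (x - y) * p x) @[k --> \oo] --> p y.
Proof.
move=> cp p1; have mp := rV_continuous_measurable cp.
apply/cvgrPdist_le => e e0.
have e20 : 0 < e / 2 by rewrite divr_gt0.
have : \forall x \near nbhs (y : 'rV[R]_n), `|p y - p x| <= e / 2.
  by move: (cp y) => /cvgrPdist_le /(_ _ e20).
move=> /nbhs_normP[d /= d0 dP].
pose b := pi * (d / 2) ^+ 2 / 2.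
have b0 : 0 < b by rewrite divr_gt0// mulr_gt0 ?pi_gt0// exprn_gt0// divr_gt0.
near=> k.
set ek := k.+1%:R^-1 : R.
have ek0 : 0 < ek by rewrite invr_gt0 ltr0n.
have ek20 : 0 < 2 * ek by rewrite mulr_gt0.
have [i1 I1] := kern_shift_integrable y ek0.
have [i2 I2] := kern_shift_integrable y ek20.
have i3 : integrableR mu (fun x : 'rV[R]_n => kern ek (x - y) * p x).
  exact: (integrableMbound i1 mp p1).
have i4 : integrableR mu (fun x : 'rV[R]_n => kern ek (x - y) * p y).
  exact: (integrableRZr (p y) i1).
have -> : p y - \int[mu]_x (kern ek (x - y) * p x) = \int[mu]_x (kern ek (x - y) * p y - kern ek (x - y) * p x).
  by rewrite RintegralB// RintegralZr// I1 mul1r.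
(* The weight of the region far from [y]: [p] oscillates by at most 2, and the rest is the tail
   factor of [kern_tail] at distance [d / 2] and width [1 / (k + 1)]. *)
pose q := 2 * (2 ^+ n * expR (- (b * k.+1%:R ^+ 2))).
have q0 : 0 <= q by rewrite !mulr_ge0 ?exprn_ge0 ?expR_ge0.
have i5 : integrableR mu (fun x : 'rV[R]_n => e / 2 * kern ek (x - y) + q * kern (2 * ek) (x - y)).
  exact: (integrableRD (integrableRZl (e / 2) i1) (integrableRZl q i2)).
have m3 : measurable_fun setT (fun x : 'rV[R]_n => kern ek (x - y) * p y - kern ek (x - y) * p x).
  by apply: measurable_funB; [exact: measurable_intR i4|exact: measurable_intR i3].
have bound (x : 'rV[R]_n) : `|kern ek (x - y) * p y - kern ek (x - y) * p x| <= e / 2 * kern ek (x - y) + q * kern (2 * ek) (x - y).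
  rewrite -mulrBr normrM (ger0_norm (kern_ge0 _ ek0)).
  have [xy|xy] := ltP `|y - x| d.
    rewrite mulrC ler_wpDr ?mulr_ge0 ?kern_ge0// ler_wpM2r ?kern_ge0//.
    exact: dP.
  (* If all coordinates were below [d / 2], the maximum norm would be at most [d / 2], hence below
     [d]; halving avoids the need for a strict bound on a maximum. *)
  have [i xyi] : exists i, d / 2 <= `|(x - y) ord0 i|.
    apply/not_existsP => H.
    have d20 : 0 <= d / 2 by rewrite divr_ge0// ltW.
    suff H2 : `|y - x| <= d / 2 by clear -H2 xy d0; lra.
    rewrite distrC [leLHS]mx_normrE; apply: bigmax_le => [//|[i j] _ /=].
    by rewrite (ord1 i); have /negP := H j; rewrite -ltNge => /ltW.
  have d20 : 0 <= d / 2 by rewrite divr_ge0// ltW.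
  have := kern_tail ek0 d20 xyi.
  rewrite (_ : pi * (d / 2) ^+ 2 / (2 * ek ^+ 2) = b * k.+1%:R ^+ 2); last first.
    by rewrite /b /ek exprVn invfM invrK; ring.
  move=> H.
  have p2 : `|p y - p x| <= 2.
    by rewrite (le_trans (ler_normB _ _))// (le_trans (lerD (p1 y) (p1 x))).
  have h0 : 0 <= e / 2 * kern ek (x - y) by rewrite mulr_ge0 ?kern_ge0// ltW.
  rewrite (le_trans _ (_ : q * kern (2 * ek) (x - y) <= _)) ?lerDr//.
  by rewrite mulrC /q -mulrA ler_pM ?kern_ge0.
rewrite (le_trans (normr_Rintegral_le m3 i5 bound))// RintegralD//; last 2 first.
- exact: (integrableRZl (e / 2) i1).
- exact: (integrableRZl q i2).
rewrite !RintegralZl// I1 I2 !mulr1.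
suff : q <= e / 2 by move=> H; rewrite [leRHS]splitr lerD2l.
have bk : 0 < b * k.+1%:R by rewrite mulr_gt0// ltr0n.
have hq : expR (- (b * k.+1%:R ^+ 2)) <= (b * k.+1%:R)^-1.
  rewrite expRN lef_pV2 ?posrE ?expR_gt0//.
  rewrite (@le_trans _ _ (b * k.+1%:R ^+ 2))//.
    by rewrite ler_wpM2l ?(ltW b0)// expr2 ler_peMl ?ler0n// ler1n.
  by rewrite (le_trans _ (expR_ge1Dx _))// lerDr.
rewrite /q (@le_trans _ _ (2 * (2 ^+ n * (b * k.+1%:R)^-1)))//.
  by rewrite !ler_wpM2l// exprn_ge0.
rewrite mulrA ler_pdivrMr// mulrA -ler_pdivrMl ?(mulr_gt0 e20 b0)//.
rewrite (@le_trans _ _ k%:R)// ?ler_nat//.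
near: k; exact: nbhs_infty_ger.
Unshelve. all: by end_near. Qed.

End approximate_identity.

(* An alias of the product measure, as the latter has no instance of sigma-finiteness. *)
Definition muxt (R : realType) n : set ('rV[R]_n * measurableTypeR R) -> \bar R :=
  (rVleb R n \x @lebesgue_measure R)%E.

Section muxt.
Context (R : realType) (n : nat).

HB.instance Definition _ := Measure.copy (@muxt R n) (rVleb R n \x @lebesgue_measure R)%E.

Let muxt_sigma_finite : sigma_finite setT (@muxt R n).
Proof.
have /sigma_finiteP[F [TF ndF Fy]] := sigma_finiteT (rVleb R n).
have /sigma_finiteP[G [TG ndG Gy]] := sigma_finiteT (@lebesgue_measure R).
exists (fun k => F k `*` G k).
  apply/seteqP; split => // -[x t] _.
  have [i _ Fx] : (\bigcup_i F i) x by rewrite -TF.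
  have [j _ Gt] : (\bigcup_i G i) t by rewrite -TG.
  exists (maxn i j) => //; split.
    by move: x Fx; exact/subsetPset/ndF/leq_maxl.
  by move: t Gt; exact/subsetPset/ndG/leq_maxr.
move=> k; have [mF lF] := Fy k; have [mG lG] := Gy k.
split; first exact: measurableX.
by rewrite /muxt product_measure1E// lte_mul_pinfty// ge0_fin_numE.
Qed.

HB.instance Definition _ := Measure_isSigmaFinite.Build _ _ _ (@muxt R n) muxt_sigma_finite.

End muxt.

Arguments muxt : clear implicits.

(** * Oscillatory integrals over the frequencies *)

Section oscillatory.
Context {R : realType} {n : nat}.
Local Notation mu := (rVleb R n).
Local Notation leb := (@lebesgue_measure R).
Implicit Types G : 'rV[R]_n -> R.

Variable phi : 'rV[R]_n -> R.
Hypothesis cphi : continuous phi.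

Definition osc G (c : R) (z : 'rV[R]_n * R) : R :=
  \int[mu]_xi (G xi * cos (phase phi z xi + c)).

Lemma measurable_oscphase c : measurable_fun [set: 'rV[R]_n * ('rV[R]_n * measurableTypeR R)]
  (fun w => cos (phase phi w.2 w.1 + c)).
Proof.
apply: measurable_fun_cos; apply: measurable_funD => //; apply: measurable_funD.
  apply: measurable_funM.
    exact: measurableT_comp measurable_snd measurable_snd.
  exact: measurableT_comp (rV_continuous_measurable cphi) measurable_fst.
apply: measurable_funM => //; apply: measurable_dotrV => //.
exact: measurableT_comp measurable_fst measurable_snd.
Qed.

Lemma measurable_oscphase1 c (z : 'rV[R]_n * R) : measurable_fun setT
  (fun xi => cos (phase phi z xi + c)).
Proof. exact: measurableT_comp (measurable_oscphase c) (measurable_pair2 z). Qed.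

Lemma integrable_osc G c z : integrableR mu G ->
  integrableR mu (fun xi => G xi * cos (phase phi z xi + c)).
Proof.
by move=> iG; apply: (integrableMbound iG (measurable_oscphase1 c z)) => x; exact: cos_max.
Qed.

Lemma measurable_Rintegral_xt (h : 'rV[R]_n * ('rV[R]_n * measurableTypeR R) -> R) (a : 'rV[R]_n -> R) :
  measurable_fun setT h -> integrableR mu a -> (forall x z, `|h (x, z)| <= a x) ->
  measurable_fun setT (fun z => \int[mu]_x h (x, z)).
Proof.
move=> mh ia ha.
pose w (z : 'rV[R]_n * measurableTypeR R) : R := wt z.1 * (1 + z.2 ^+ 2)^-1.
have mw : measurable_fun setT w.
  apply: measurable_funM; first exact: measurableT_comp (@measurable_wt R n) measurable_fst.
  exact: measurableT_comp (measurable_intR (@integrable_oneDsqrV R)) measurable_snd.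
have w0 z : 0 < w z by rewrite mulr_gt0 ?wt_gt0// invr_gt0 ltr_pwDl ?sqr_ge0.
have iw : integrableR (muxt R n) w.
  apply: (integrable_prod_dominated mw (integrable_wt n) (@integrable_oneDsqrV R)) => x y.
  by rewrite gtr0_norm// w0.
exact: measurable_Rintegral_bounded mh ia iw w0 ha.
Qed.

Lemma measurable_osc G c : integrableR mu G ->
  measurable_fun [set: 'rV[R]_n * measurableTypeR R] (osc G c).
Proof.
move=> iG; have mG := measurable_intR iG.
apply: (@measurable_Rintegral_xt (fun v => G v.1 * cos (phase phi v.2 v.1 + c)) _ _
  (integrable_norm iG)) => [|x z].
  apply: measurable_funM; first exact: measurableT_comp mG measurable_fst.
  exact: measurable_oscphase.
by rewrite normrM ler_piMr// cos_max.
Qed.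

(** At the limit 0 the formula [exp(s ln x)] breaks down; there [|u|^s <= |u|] once [|u| <= 1],
    because [1 <= s]. *)
Lemma cvg_powR_norm (s : R) (u : nat -> R) (a : R) : 1 <= s ->
  u k @[k --> \oo] --> a -> `|u k| `^ s @[k --> \oo] --> `|a| `^ s.
Proof.
move=> s1 ua; have s0 : 0 < s by exact: lt_le_trans s1.
have [a0|a0] := eqVneq a 0.
  rewrite a0 normr0 powR0 ?gt_eqF//; rewrite a0 in ua.
  apply: (@squeeze_cvgr _ _ _ _ (cst 0) (fun k => `|u k|)).
  - near=> k; rewrite powR_ge0/=.
    have [->|uk] := eqVneq (u k) 0; first by rewrite normr0 powR0// gt_eqF.
    apply: ge1r_powR => //; rewrite normr_gt0 uk/=.
    by near: k; exact: (cvgr0_norm_le _ ua).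
  - exact: cvg_cst.
  - exact/norm_cvg0P.
have na0 : 0 < `|a| by rewrite normr_gt0.
have una : `|u k| @[k --> \oo] --> `|a| by exact: cvg_norm.
have E (x : R) : 0 < x -> x `^ s = expR (s * ln x) by move=> x0; rewrite /powR gt_eqF.
rewrite E//.
apply: (@cvg_trans _ ((fun k => expR (s * ln `|u k|)) @ \oo)).
  apply: near_eq_cvg; near=> k; rewrite E//.
  by near: k; apply: (cvgr_gt `|a|).
apply: continuous_cvg; first exact: continuous_expR.
apply: cvgM; first exact: cvg_cst.
by apply: continuous_cvg => //; exact: continuous_ln.
Unshelve. all: by end_near. Qed.

End oscillatory.

(** * Mollification of frequency functions by the Gaussian kernel *)

Section smoothing.
Context {R : realType} {n : nat}.
Local Notation mu := (rVleb R n).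
Implicit Types G p : 'rV[R]_n -> R.

Lemma expr_wt (c : R) (x : 'rV[R]_n) :
  c ^+ n * wt x = \prod_(i < n) (c * (1 + x ord0 i ^+ 2)^-1).
Proof. by rewrite big_split/= prodr_const card_ord. Qed.

(** From [exp(-y) <= 1 / (1 + y)] in each coordinate. *)
Lemma kern_wt e (x : 'rV[R]_n) : 0 < e ->
  kern e x <= (e^-1 * (1 + e ^+ 2 / pi)) ^+ n * wt x.
Proof.
move=> e0; rewrite /kern expr_wt.
apply: ler_prod => i _; rewrite mulr_ge0 ?invr_ge0 ?expR_ge0 ?(ltW e0)//=.
set t := x ord0 i.
have t1 : 0 < 1 + t ^+ 2 by rewrite ltr_pwDl ?sqr_ge0.
rewrite -mulrA ler_wpM2l ?invr_ge0 ?(ltW e0)// ler_pdivlMr//.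
have u0 : 0 < 1 + pi * (t / e) ^+ 2.
  by rewrite ltr_pwDl// mulr_ge0 ?pi_ge0 ?sqr_ge0.
rewrite (@le_trans _ _ ((1 + pi * (t / e) ^+ 2)^-1 * (1 + t ^+ 2)))//.
  rewrite ler_wpM2r ?(ltW t1)// expRN lef_pV2 ?posrE ?expR_gt0//.
  exact: expR_ge1Dx.
rewrite ler_pdivrMl//.
have E : pi * (t / e) ^+ 2 * (e ^+ 2 / pi) = t ^+ 2.
  have p0 : pi != 0 :> R by rewrite gt_eqF// pi_gt0.
  have en0 : e != 0 by rewrite gt_eqF.
  by move: p0; move: pi => q q0; field; rewrite q0 en0.
have h : 0 <= e ^+ 2 / pi :> R by rewrite divr_ge0 ?sqr_ge0 ?pi_ge0.
have h2 : 0 <= pi * (t / e) ^+ 2 by rewrite mulr_ge0 ?pi_ge0 ?sqr_ge0.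
by move: E h h2; move: (pi * _) (e ^+ 2 / pi) => a b E h h2; lra.
Qed.

(** Peetre's inequality [1 + b^2 <= 2 (1 + a^2) (1 + (a - b)^2)] in each coordinate. *)
Lemma wt_subr (k : R) (x y : 'rV[R]_n) : (forall i, `|y ord0 i| <= k) ->
  wt (y - x) <= (2 * (1 + k ^+ 2)) ^+ n * wt x.
Proof.
move=> yk; rewrite expr_wt /wt.
apply: ler_prod => i _; rewrite !mxE.
have yk2 : y ord0 i ^+ 2 <= k ^+ 2.
  rewrite -[leLHS]real_normK ?num_real// ler_sqr ?nnegrE ?yk//.
  exact: le_trans (yk i).
have pos (t : R) : 0 < 1 + t ^+ 2 by rewrite ltr_pwDl ?sqr_ge0.
rewrite invr_ge0 (ltW (pos _))/= ler_pdivlMr// ler_pdivrMl//.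
move: (y ord0 i) (x ord0 i) yk2 => a b ak.
rewrite (@le_trans _ _ ((1 + (a - b) ^+ 2) * (2 * (1 + a ^+ 2))))//; last first.
  by rewrite ler_wpM2l ?(ltW (pos _))// ler_wpM2l// lerD2l.
have := sqr_ge0 (a - (a - b)); have := sqr_ge0 (a + (a - b)).
have := mulr_ge0 (sqr_ge0 a) (sqr_ge0 (a - b)).
by have := sqr_ge0 a; have := sqr_ge0 (a - b); nra.
Qed.

Section fixed_kernel.
Variables (G : 'rV[R]_n -> R) (e : R).
Hypothesis csbG : bounded_support G.
Hypothesis e0 : 0 < e.

Let smooth_bound : exists2 M, 0 <= M & forall x y, `|kern e (y - x) * G y| <= M * wt x * `|G y|.
Proof.
have [mG [k k0 [A A0 GA]]] := csbG.
exists ((e^-1 * (1 + e ^+ 2 / pi)) ^+ n * (2 * (1 + k ^+ 2)) ^+ n).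
  by rewrite mulr_ge0// exprn_ge0// ?mulr_ge0 ?addr_ge0 ?invr_ge0 ?divr_ge0 ?sqr_ge0 ?pi_ge0// ltW.
move=> x y; have [->|Gy] := eqVneq (G y) 0; first by rewrite normr0 !mulr0 normr0.
rewrite normrM (ger0_norm (kern_ge0 _ e0)) ler_wpM2r//.
rewrite (le_trans (kern_wt _ e0))// -[leRHS]mulrA ler_wpM2l//.
  by rewrite exprn_ge0// mulr_ge0 ?addr_ge0 ?invr_ge0 ?divr_ge0 ?sqr_ge0 ?pi_ge0// ltW.
by apply: wt_subr; have [_] := GA y; exact.
Qed.

Let mkern : measurable_fun setT (fun w : 'rV[R]_n * 'rV[R]_n => kern e (w.2 - w.1)).
Proof.
suff H : measurable_fun setT (fun w : 'rV[R]_n * 'rV[R]_n => w.2 - w.1).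
  exact: measurableT_comp (@measurable_kern R n e) H.
exact: measurable_fun_rVB.
Qed.

Section multiplier.
Variable p : 'rV[R]_n -> R.
Hypothesis mp : measurable_fun setT p.
Hypothesis p1 : forall x, `|p x| <= 1.

Let h (w : 'rV[R]_n * 'rV[R]_n) := kern e (w.2 - w.1) * G w.2 * p w.1.

Let mh : measurable_fun setT h.
Proof.
have [mG _] := csbG.
apply: measurable_funM; last exact: measurableT_comp mp measurable_fst.
by apply: measurable_funM => //; exact: measurableT_comp mG measurable_snd.
Qed.

Let integrable_Mwt M : integrableR mu (fun x : 'rV[R]_n => M * wt x).
Proof.
exact: (integrableRZl M (@integrable_wt R n)).
Qed.

(** Moves the mollification from the rough [G] to the multiplier [p]: [approximate_identity] asks
    for continuity, which the oscillating factor has and [G] lacks. *)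
Lemma smoothing_swap :
  \int[mu]_x ((\int[mu]_y (G y * kern e (y - x))) * p x) =
  \int[mu]_y (G y * \int[mu]_x (kern e (x - y) * p x)).
Proof.
have [M M0 hM] := smooth_bound.
have hab x y : `|h (x, y)| <= M * wt x * `|G y|.
  by rewrite normrM (le_trans _ (hM x y))// ler_piMr.
have iG := csb_integrable csbG.
have [mG _] := csbG.
transitivity (\int[mu]_x (\int[mu]_y h (x, y))).
  apply: eq_Rintegral => x _; rewrite -RintegralZr//; last first.
    apply: (@le_integrableR _ _ _ _ _ (fun y => M * wt x * `|G y|)).
    - apply: measurable_funM => //.
      exact: measurableT_comp mkern (measurable_pair1 x).
    - by move=> y; rewrite mulrC hM.
    - exact: (integrableRZl (M * wt x) (integrable_norm iG)).
  by apply: eq_Rintegral => y _; rewrite /h/= [G y * _]mulrC.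
rewrite (Rintegral_swap mh (integrable_Mwt M) (integrable_norm iG) hab).
apply: eq_Rintegral => y _; rewrite -RintegralZl//; last first.
  apply: (integrableMbound _ mp p1).
  by have [] := kern_shift_integrable y e0.
apply: eq_Rintegral => x _; rewrite /h/= -[y - x]opprB kern_oppr.
by rewrite mulrCA mulrA.
Qed.

Lemma measurable_smoothing : measurable_fun setT (fun y => G y * \int[mu]_x (kern e (x - y) * p x)).
Proof.
have [M M0 hM] := smooth_bound.
have hab x y : `|h (x, y)| <= M * wt x * `|G y|.
  by rewrite normrM (le_trans _ (hM x y))// ler_piMr.
have := measurable_Rintegral_prod2 mh (integrable_Mwt M) (integrable_norm (csb_integrable csbG)) hab.
apply: eq_measurable_fun => y _; rewrite -RintegralZl//; last first.
  apply: (integrableMbound _ mp p1).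
  by have [] := kern_shift_integrable y e0.
apply: eq_Rintegral => x _; rewrite /h/= -[y - x]opprB kern_oppr.
by rewrite mulrCA mulrA.
Qed.

End multiplier.

Lemma integrable_smoothing : integrableR mu (fun x => \int[mu]_y (G y * kern e (y - x))).
Proof.
have [M M0 hM] := smooth_bound; have iG := csb_integrable csbG; have [mG _] := csbG.
have iGM (x : 'rV[R]_n) : integrableR mu (fun y => M * wt x * `|G y|).
  exact: (integrableRZl (M * wt x) (integrable_norm iG)).
have mK x : measurable_fun setT (fun y => G y * kern e (y - x)).
  by apply: measurable_funM => //; exact: measurableT_comp mkern (measurable_pair1 x).
apply: (@integrable_wt_le _ _ _ (M * \int[mu]_y `|G y|)).
  pose h (w : 'rV[R]_n * 'rV[R]_n) := kern e (w.2 - w.1) * G w.2.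
  have mh : measurable_fun setT h.
    by apply: measurable_funM => //; exact: measurableT_comp mG measurable_snd.
  have iw : integrableR mu (fun x : 'rV[R]_n => M * wt x).
    exact: (integrableRZl M (@integrable_wt R n)).
  have := measurable_Rintegral_prod1 mh iw (integrable_norm iG) hM.
  by apply: eq_measurable_fun => x _; apply: eq_Rintegral => y _; rewrite /h mulrC.
move=> x; rewrite (le_trans (normr_Rintegral_le (mK x) (iGM x) _))//; first by move=> y; rewrite mulrC hM.
rewrite RintegralZl//; last exact: integrable_norm.
by rewrite mulrAC.
Qed.

End fixed_kernel.

End smoothing.

Section Lnorm_tools.
Context d (T : measurableType d) (R : realType) (mu : {measure set T -> \bar R}).
Implicit Types f : T -> R[i].

Lemma normc_ge0 (z : R[i]) : 0 <= Normc.normc z.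
Proof. by case: z => a b; exact: sqrtr_ge0. Qed.

Lemma cLnormE (p : R) f :
  cLnorm mu p%:E f = ((\int[mu]_x (Normc.normc (f x) `^ p)%:E) `^ p^-1)%E.
Proof.
rewrite /cLnorm unlock /=.
under eq_integral => x _ do rewrite ger0_norm ?normc_ge0//.
by [].
Qed.

Lemma poweRV_le (p : R) (X : \bar R) (Y : R) : 0 < p -> (0 <= X)%E -> 0 <= Y ->
  (X `^ p^-1 <= Y%:E)%E -> (X <= (Y `^ p)%:E)%E.
Proof.
move=> p0 X0 Y0 XY; rewrite -(poweRe1 X0) -(mulVf (lt0r_neq0 p0)) poweRrM -poweR_EFin.
apply: gt0_ler_poweR => //; rewrite ?in_itv/= ?leey ?andbT ?lee_fin//.
- exact: ltW.
- exact: poweR_ge0.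
Qed.

Lemma normc_Re (z : R[i]) : `|complex.Re z| <= Normc.normc z.
Proof.
by case: z => a b /=; rewrite -sqrtr_sqr ler_wsqrtr// lerDl sqr_ge0.
Qed.

Lemma normc_Im (z : R[i]) : `|complex.Im z| <= Normc.normc z.
Proof.
by case: z => a b /=; rewrite -sqrtr_sqr ler_wsqrtr// lerDr sqr_ge0.
Qed.

Lemma normc_sqr (z : R[i]) : Normc.normc z `^ 2 = complex.Re z ^+ 2 + complex.Im z ^+ 2.
Proof.
by case: z => a b /=; rewrite powR_mulrn ?sqrtr_ge0// sqr_sqrtr// addr_ge0 ?sqr_ge0.
Qed.

End Lnorm_tools.

Lemma cvg_dotrV {R : realType} n (y x : 'rV[R]_n) :
  dotrV y xi @[xi --> nbhs (x : 'rV[R]_n)] --> dotrV y x.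
Proof.
rewrite /dotrV; elim: (index_enum _) => [|i r IHr].
  by under eq_fun do rewrite big_nil; rewrite big_nil; exact: cvg_cst.
under eq_fun do rewrite big_cons; rewrite big_cons.
apply: cvgD => //; apply: cvgM; first exact: cvg_cst.
exact: coord_continuous.
Qed.

(** * The Strichartz estimate for rough frequency functions *)

Definition strichartz_estimate (R : realType) n (phi : 'rV[R]_n -> R) (s C : R) :=
  forall f : 'rV[R]_n -> R[i], schwartz f ->
  (cLnorm (lebesgue_xt R n) s%:E (evolution phi f) <= C%:E * cLnorm (lebesgue_rV R n) 2%:E f)%E.

Section strichartz_real.
Context {R : realType} {n : nat}.
Local Notation mu := (rVleb R n).
Local Notation leb := (@lebesgue_measure R).
Local Notation muxt := (muxt R n).
Implicit Types G : 'rV[R]_n -> R.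
Variable phi : 'rV[R]_n -> R.
Hypothesis cphi : continuous phi.
Variable s : R.
Hypothesis s_gt2 : 2 < s.
Variable C : R.
Hypothesis strichartz : strichartz_estimate phi s C.

Let phi2 : R := pi / 2.

(* The inverse Fourier transform of [G], damped by a Gaussian; its Fourier transform is [mollified G e]. *)
Definition gauss_inverse G (e : R) (x : 'rV[R]_n) : R[i] :=
  Complex (cft G 0 x * gaussn e x) (cft G (- phi2) x * gaussn e x).

Definition mollified G e (xi : 'rV[R]_n) : R := \int[mu]_eta (G eta * kern e (eta - xi)).

Lemma schwartz_gauss_inverse G e : bounded_support G -> 0 < e ->
  schwartz (gauss_inverse G e).
Proof.
by move=> cG e0; split => /=; apply: schwartz_trig_gauss => //; exact: trig_cft.
Qed.

(** The reflected kernel cancels between the two components: with [A] and [B] the integrals against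
    the direct and the reflected kernel, the real part is [(A + B) / 2 + (A - B) / 2], and every
    cosine in the imaginary part vanishes. *)
Lemma fourier_gauss_inverse G e xi : bounded_support G -> 0 < e ->
  fourier (gauss_inverse G e) xi = Complex (mollified G e xi) 0.
Proof.
move=> cG e0; have iG := csb_integrable cG.
have iu d c : integrableR mu (fun x => cft G d x * gaussn e x * cos (2 * pi * dotrV x xi + c)).
  apply: integrable_cosphase.
  have H := @integrableMbound _ _ _ mu _ (cft G d) (\int[mu]_x `|G x|) (integrable_gaussn n e0) (measurable_cft d iG)
    (fun x => normr_cft d x iG).
  by apply: eq_integrable H => // x _ /=; rewrite mulrC.
have iK (z : 'rV[R]_n) : integrableR mu (fun eta => G eta * kern e (eta + z)).
  have [M M0 KM] : exists2 M, 0 <= M & forall x : 'rV[R]_n, `|kern e x| <= M.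
    exists ((e^-1 * (1 + e ^+ 2 / pi)) ^+ n).
      by rewrite exprn_ge0// mulr_ge0 ?addr_ge0 ?invr_ge0 ?divr_ge0 ?sqr_ge0 ?pi_ge0// ltW.
    move=> x; rewrite ger0_norm ?kern_ge0// (le_trans (kern_wt _ e0))// ler_piMr ?wt_le1//.
    by rewrite exprn_ge0// mulr_ge0 ?addr_ge0 ?invr_ge0 ?divr_ge0 ?sqr_ge0 ?pi_ge0// ltW.
  apply: (integrableMbound iG (M := M)) => [|x]; last exact: KM.
  exact: measurableT_comp (@measurable_kern R n e) (measurable_rVD z).
pose A := \int[mu]_eta (G eta * kern e (eta - xi)).
pose B := \int[mu]_eta (G eta * kern e (eta + xi)).
have E d c : \int[mu]_x (cft G d x * gaussn e x * cos (2 * pi * dotrV x xi + c)) =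
    2^-1 * (cos (d - c) * A + cos (d + c) * B).
  have i1 := integrableZl measurableT (cos (d - c)) (iK (- xi)).
  have i2 := integrableZl measurableT (cos (d + c)) (iK xi).
  rewrite gauss_cft_swap//.
  transitivity (\int[mu]_eta (2^-1 * (cos (d - c) * (G eta * kern e (eta - xi))
     + cos (d + c) * (G eta * kern e (eta + xi))))).
    by apply: eq_Rintegral => eta _; ring.
  rewrite RintegralZl//; last exact: (integrableRD i1 i2).
  by rewrite RintegralD// !RintegralZl.
have cN (t : R) : cos t = cos (t + 0) by rewrite addr0.
have sN (t : R) : sin t = cos (t + - phi2).
  by rewrite cosB /phi2 cos_pihalf sin_pihalf mulr0 add0r mulr1.
have phi22 : - phi2 - phi2 = - pi by rewrite /phi2; field.
have c0 : cos (- phi2) = 0 by rewrite cosN /phi2 cos_pihalf.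
rewrite /fourier /cintegral; congr (Complex _ _).
  transitivity (\int[mu]_x (cft G 0 x * gaussn e x * cos (2 * pi * dotrV x xi + 0)
    + cft G (- phi2) x * gaussn e x * cos (2 * pi * dotrV x xi + - phi2))).
    apply: eq_Rintegral => x _ /=.
    by rewrite cosN sinN [in LHS]cN [in LHS]sN; ring.
  rewrite RintegralD// !E subrr addr0 opprK addNr phi22 cosN cospi cos0 /mollified -/A.
  by field.
transitivity (\int[mu]_x (cft G (- phi2) x * gaussn e x * cos (2 * pi * dotrV x xi + 0)
    - cft G 0 x * gaussn e x * cos (2 * pi * dotrV x xi + - phi2))).
  apply: eq_Rintegral => x _ /=.
  by rewrite cosN sinN [in LHS]cN [in LHS]sN; ring.
rewrite RintegralB// !E subr0 addr0 add0r opprK add0r c0.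
have -> : cos phi2 = 0 by exact: cos_pihalf.
by field.
Qed.

Lemma evolution_gauss_inverse G e z : bounded_support G -> 0 < e ->
  evolution phi (gauss_inverse G e) z =
  Complex (osc phi (mollified G e) 0 z) (osc phi (mollified G e) (- phi2) z).
Proof.
move=> cG e0.
have -> : evolution phi (gauss_inverse G e) z = cintegral mu
    (fun xi => expi (phase phi z xi) * Complex (mollified G e xi) 0).
  by congr cintegral; apply/funext => xi; rewrite fourier_gauss_inverse.
have sN (t : R) : sin t = cos (t + - phi2).
  by rewrite cosB /phi2 cos_pihalf sin_pihalf mulr0 add0r mulr1.
congr Complex; apply: eq_Rintegral => xi _ /=; first by rewrite addr0 mulr0 subr0 mulrC.
by rewrite mulr0 add0r mulrC -sN.
Qed.

(** The factor 2 comes from bounding the real and the imaginary part separately by [cft_sqr_le]; the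
    Gaussian only decreases them. *)
Lemma gauss_inverse_sqr_le G e : bounded_support G -> 0 < e ->
  (\int[mu]_x (Normc.normc (gauss_inverse G e x) `^ 2)%:E <= (2 * \int[mu]_x (G x ^+ 2))%:E)%E.
Proof.
move=> cG e0; have iG := csb_integrable cG; have [mG [k k0 [A A0 GA]]] := cG.
have iG2 : integrableR mu (fun x => G x ^+ 2).
  apply: (integrableMbound iG mG (M := A)) => x; have [+ _] := GA x.
  by move=> /le_trans; apply; rewrite ler_piMr// wt_le1.
have mc c := measurable_cft c iG.
have sq c : measurable_fun setT (fun x => (cft G c x ^+ 2)%:E).
  by apply/measurable_EFinP; exact: measurable_funX.
apply: (@le_trans _ _ (\int[mu]_x ((cft G 0 x ^+ 2)%:E + (cft G (- phi2) x ^+ 2)%:E))%E).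
  apply: ge0_le_integralT => x; first by rewrite lee_fin powR_ge0.
  rewrite normc_sqr/= -EFinD lee_fin !exprMn.
  have g1 : gaussn e x ^+ 2 <= 1 by rewrite expr_le1 ?gaussn_ge0 ?gaussn_le1.
  by apply: lerD; rewrite ler_piMr ?sqr_ge0.
rewrite ge0_integralD//; [|by move=> x _; rewrite lee_fin sqr_ge0..].
rewrite mulrDl mul1r EFinD -integral_EFinR//.
by apply: leeD; exact: cft_sqr_le.
Qed.

(* [Num.max C 0] because the constant of the hypothesis may be negative. *)
Definition strichartz_const : R := (Num.max C 0 * 2 `^ 2^-1) `^ s.

Lemma strichartz_const_ge0 : 0 <= strichartz_const.
Proof. exact: powR_ge0. Qed.

Let s0 : 0 < s. Proof. exact: lt_trans s_gt2. Qed.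

Lemma strichartz_mollified G e : bounded_support G -> 0 < e ->
  (\int[muxt]_z (Normc.normc (evolution phi (gauss_inverse G e) z) `^ s)%:E
    <= (strichartz_const * (\int[mu]_x (G x ^+ 2)) `^ (s / 2))%:E)%E.
Proof.
move=> cG e0; set I := \int[mu]_x (G x ^+ 2).
have I0 : 0 <= I by apply: Rintegral_ge0 => x _; exact: sqr_ge0.
have C0 : 0 <= Num.max C 0 by rewrite le_max lexx orbT.
have -> : strichartz_const * I `^ (s / 2) = (Num.max C 0 * (2 * I) `^ 2^-1) `^ s.
  rewrite /strichartz_const; move: (Num.max C 0) I I0 C0 => M I I0 M0.
  have -> : (2 * I) `^ 2^-1 = 2 `^ 2^-1 * I `^ 2^-1 by rewrite powRM.
  have M20 : 0 <= M * 2 `^ 2^-1 by rewrite mulr_ge0 ?powR_ge0.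
  rewrite mulrA [RHS](powRM s M20 (powR_ge0 _ _)).
  by rewrite -(powRrM I) [2^-1 * s]mulrC.
apply: poweRV_le => //.
- by apply: integral_ge0 => z _; rewrite lee_fin powR_ge0.
- by rewrite mulr_ge0// powR_ge0.
have := strichartz (schwartz_gauss_inverse cG e0).
rewrite !cLnormE => /le_trans; apply.
rewrite EFinM; apply: (@le_trans _ _ ((Num.max C 0)%:E * (\int[mu]_x (Normc.normc (gauss_inverse G e x) `^ 2)%:E) `^ 2^-1)%E).
  by apply: lee_wpmul2r; rewrite ?poweR_ge0// lee_fin le_max lexx.
apply: lee_wpmul2l; first by rewrite lee_fin.
rewrite -poweR_EFin; apply: gt0_ler_poweR => //; rewrite ?in_itv/= ?leey ?andbT ?lee_fin ?mulr_ge0//.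
- by apply: integral_ge0 => z _; rewrite lee_fin powR_ge0.
- exact: gauss_inverse_sqr_le.
Qed.

(** For fixed [z] the mollified integrals converge by [smoothing_swap] and [approximate_identity],
    and Fatou in [z] keeps the bound. The two values of [c] are the real and the imaginary part of
    the evolution of [gauss_inverse]. *)
Lemma osc_csb_le G c : bounded_support G -> c = 0 \/ c = - phi2 ->
  (\int[muxt]_z (`|osc phi G c z| `^ s)%:E
    <= (strichartz_const * (\int[mu]_x (G x ^+ 2)) `^ (s / 2))%:E)%E.
Proof.
move=> cG hc; have iG := csb_integrable cG; have [mG _] := cG.
pose ek (k : nat) : R := k.+1%:R^-1.
have ek0 k : 0 < ek k by rewrite invr_gt0 ltr0n.
have m1 : measurable_fun [set: R] (fun x : R => `|x| `^ s).
  exact: measurableT_comp (measurable_powR s) _.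
apply: (fatou_le (m := muxt) (f_ := fun k z => `|osc phi (mollified G (ek k)) c z| `^ s)
  (f := fun z => `|osc phi G c z| `^ s)).
- move=> k; apply: measurableT_comp m1 _; apply: measurable_osc => //.
  exact: integrable_smoothing.
- by move=> k z; exact: powR_ge0.
- move=> z; apply: cvg_powR_norm; first by rewrite (le_trans _ (ltW s_gt2))// ler1n.
  pose p (xi : 'rV[R]_n) := cos (phase phi z xi + c).
  have mp : measurable_fun setT p by exact: measurable_oscphase1.
  have p1 xi : `|p xi| <= 1 by exact: cos_max.
  have cp : continuous p.
    move=> x; apply: (@continuous_comp _ _ _ (fun xi => phase phi z xi + c) cos);
      last exact: continuous_cos.
    have cphix : phi xi @[xi --> nbhs (x : 'rV[R]_n)] --> phi x by exact: cphi.
    suff : phase phi z xi + c @[xi --> nbhs (x : 'rV[R]_n)] -->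
      phase phi z x + c by [].
    apply: cvgD; last exact: cvg_cst.
    apply: cvgD; first by apply: cvgM => //; exact: cvg_cst.
    apply: cvgM; first exact: cvg_cst.
    exact: cvg_dotrV.
  have -> : (fun k => osc phi (mollified G (ek k)) c z) =
      (fun k => \int[mu]_y (G y * \int[mu]_x (kern (ek k) (x - y) * p x))).
    by apply/funext => k; rewrite -smoothing_swap.
  have H := @cvg_Rintegral _ _ _ mu
    (fun k y => G y * \int[mu]_x (kern (ek k) (x - y) * p x)) (fun y => G y * p y) (fun y => `|G y|).
  apply: (H _ _ (integrable_norm iG) _).2.
  - by move=> k; exact: measurable_smoothing.
  - move=> y; apply: cvgM; first exact: cvg_cst.
    exact: approximate_identity.
  - move=> k y; rewrite normrM ler_piMr//.
    have [i1 I1] := kern_shift_integrable y (ek0 k).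
    rewrite -I1; apply: normr_Rintegral_le => //.
      by apply: measurable_funM => //; exact: measurable_intR i1.
    by move=> x; rewrite normrM ger0_norm ?kern_ge0// ler_piMr ?kern_ge0.
move=> k; apply: le_trans (strichartz_mollified cG (ek0 k)).
apply: ge0_le_integralT => z; first by rewrite lee_fin powR_ge0.
rewrite lee_fin; apply: ge0_ler_powR; rewrite ?nnegrE ?normc_ge0 ?(ltW s0)//.
rewrite evolution_gauss_inverse//.
by case: hc => ->; [apply: le_trans (normc_Re _)|apply: le_trans (normc_Im _)].
Qed.

(** Truncation to growing cubes makes the support bounded and does not increase the mass. What
    remains asks for no smoothness of [G], so [G] may be cut off to any measurable frequency set. *)
Lemma osc_wt_le G c A : measurable_fun setT G -> (forall x, `|G x| <= A * wt x) ->
  c = 0 \/ c = - phi2 ->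
  (\int[muxt]_z (`|osc phi G c z| `^ s)%:E
    <= (strichartz_const * (\int[mu]_x (G x ^+ 2)) `^ (s / 2))%:E)%E.
Proof.
move=> mG GA hc; have iG := integrable_wt_le mG GA.
have A0 : 0 <= A.
  exact: wt_le_ge0 GA.
have iG2 : integrableR mu (fun x => G x ^+ 2).
  apply: (integrableMbound iG mG (M := A)) => x.
  by apply: (le_trans (GA x)); rewrite ler_piMr// wt_le1.
pose box (k : nat) : set 'rV[R]_n := [set x | forall i, `|x ord0 i| <= k%:R].
have mbox k : measurable (box k).
  rewrite (_ : box k = [set x | forall i, `[- k%:R, k%:R]%classic (x ord0 i)]).
    exact: (measurable_rV_all (A := fun=> `[- k%:R, k%:R]%classic)).
  by apply/seteqP; split => x /= H i; have := H i; rewrite in_itv/= ler_norml.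
pose Gk (k : nat) x := G x * \1_(box k) x.
have Gkle k x : `|Gk k x| <= `|G x|.
  by rewrite normrM ler_piMr// ger0_norm ?indic_ge0// indicE lern1 leq_b1.
have mGk k : measurable_fun setT (Gk k).
  by apply: measurable_funM => //; exact: measurable_indic.
have csbGk k : bounded_support (Gk k).
  split => //; exists k%:R => //; exists A => // x; split.
    exact: le_trans (Gkle k x) (GA x).
  rewrite /Gk indicE; have [xk|_] := boolP (x \in box k); last by rewrite mulr0 eqxx.
  by move=> _; move: xk; rewrite inE.
apply: (fatou_le (m := muxt) (f_ := fun k z => `|osc phi (Gk k) c z| `^ s)
  (f := fun z => `|osc phi G c z| `^ s)).
- move=> k; apply: measurableT_comp (measurable_powR s) _.
  by apply: measurableT_comp => //; apply: measurable_osc => //; exact: csb_integrable.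
- by move=> k z; exact: powR_ge0.
- move=> z; apply: cvg_powR_norm; first by rewrite (le_trans _ (ltW s_gt2))// ler1n.
  have H := @cvg_Rintegral _ _ _ mu
    (fun k xi => Gk k xi * cos (phase phi z xi + c))
    (fun xi => G xi * cos (phase phi z xi + c)) (fun y => `|G y|).
  apply: (H _ _ (integrable_norm iG) _).2.
  - by move=> k; apply: measurable_funM => //; exact: measurable_oscphase1.
  - move=> x; apply: cvgM; last exact: cvg_cst.
    apply: (@cvg_trans _ (cst (G x) @ \oo)); last exact: cvg_cst.
    apply: near_eq_cvg; near=> k; rewrite /Gk indicE mem_set ?mulr1//= => i.
    apply: (@le_trans _ _ `|x|); first exact: norm_rV_coord.
    near: k; exact: nbhs_infty_ger.
  - move=> k x; rewrite normrM (le_trans _ (Gkle k x))// ler_piMr//; exact: cos_max.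
move=> k; apply: le_trans (osc_csb_le (csbGk k) hc) _.
rewrite lee_fin; apply: ler_wpM2l; first exact: strichartz_const_ge0.
have s20 : 0 <= s / 2 by rewrite divr_ge0// ltW.
have le2 x : Gk k x ^+ 2 <= G x ^+ 2.
  by rewrite -[leLHS]real_normK ?num_real// -[leRHS]real_normK ?num_real// ler_sqr ?nnegrE.
have i2 : integrableR mu (fun x => Gk k x ^+ 2).
  apply: (le_integrableR _ _ iG2); first exact: measurable_funX.
  by move=> x; rewrite ger0_norm ?sqr_ge0.
apply: ge0_ler_powR => //; rewrite ?nnegrE; [by apply: Rintegral_ge0 => x _; rewrite sqr_ge0..|].
by apply: le_Rintegral.
Unshelve. all: by end_near. Qed.

End strichartz_real.

(** * The Christ-Kiselev lemma *)

Section christ_kiselev.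
Context d1 d2 (T1 : measurableType d1) (T2 : measurableType d2) {R : realType}.
Variables (m2 : {measure set T2 -> \bar R}) (nu : set T1 -> R) (s : R).
Hypothesis s_gt2 : 2 < s.
Hypothesis nu_ge0 : forall A, 0 <= nu A.
Hypothesis nuD : forall A B, measurable A -> measurable B -> A `&` B = set0 ->
  nu (A `|` B) = nu A + nu B.

(* The operators whose maximal functions are bounded below: [M A z] stands for the absolute value of an operator applied to the restriction to [A] of a fixed function of squared L^2 norm [nu A]. *)
Record admissible (K : R) (M : set T1 -> T2 -> R) : Prop := Admissible {
  admissible_measurable : forall A, measurable A -> measurable_fun setT (M A) ;
  admissible_ge0 : forall A z, 0 <= M A z ;
  admissible_subadditive : forall A B, measurable A -> measurable B -> A `&` B = set0 ->
    forall z, M (A `|` B) z <= M A z + M B z ;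
  admissible_le : forall A, measurable A ->
    (\int[m2]_z (M A z `^ s)%:E <= (K * nu A `^ (s / 2))%:E)%E }.

Let s_gt0 : 0 < s. Proof. exact: lt_trans s_gt2. Qed.

Let powR2E (x : R) : 2 `^ x = expR (x * ln 2).
Proof. by rewrite /powR gt_eqF. Qed.

Let powR2_lt (x y : R) : x < y -> 2 `^ x < 2 `^ y.
Proof. by move=> xy; rewrite !powR2E ltr_expR ltr_pM2r// ln_gt0// ltr1n. Qed.

(* The convexity inequality with [l] so close to 1 that two halves of the mass contribute in total less than the whole: this is where [s > 2] is used. *)
Lemma powRD_le : exists p l : R, [/\ 0 <= p, 0 <= l, l * (2 * 2 `^ (- (s / 2))) < 1 &
  forall a b : R, 0 <= a -> 0 <= b -> (a + b) `^ s <= p * a `^ s + l * b `^ s].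
Proof.
set h : R := 2 `^ ((s - 2) / (4 * s)).
have e0 : 0 < h - 1.
  rewrite subr_gt0 /h -[ltLHS](powRr0 (2 : R)); apply: powR2_lt.
  by rewrite divr_gt0// ?mulr_gt0// subr_gt0.
have h0 : 0 < h by rewrite -subr_gt0; lra.
set e := h - 1.
exists ((1 + e^-1) `^ s), (h `^ s); split; rewrite ?powR_ge0//.
  rewrite /h -powRrM -[X in _ * (X * _)](@powRr1 _ 2)//.
  rewrite -!powRD ?pnatr_eq0 ?implybT// -[ltRHS](powRr0 (2 : R)); apply: powR2_lt.
  rewrite (_ : _ + _ = - (s - 2) / 4); last by field; rewrite gt_eqF.
  by rewrite mulNr oppr_lt0 divr_gt0// subr_gt0.
move=> a b a0 b0; have [ab|ba] := leP a (e * b).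
  rewrite -[leLHS]add0r lerD ?mulr_ge0 ?powR_ge0// -powRM ?(ltW h0)//.
  by apply: ge0_ler_powR; rewrite ?nnegrE ?addr_ge0 ?mulr_ge0 ?(ltW h0) ?(ltW s_gt0)//; rewrite /e in ab; lra.
rewrite -[leLHS]addr0 lerD ?mulr_ge0 ?powR_ge0// -powRM ?addr_ge0 ?invr_ge0 ?(ltW e0)//.
apply: ge0_ler_powR; rewrite ?nnegrE ?addr_ge0 ?mulr_ge0 ?addr_ge0 ?invr_ge0 ?(ltW e0) ?(ltW s_gt0)//.
rewrite mulrDl mul1r lerD2l -ler_pdivrMl ?invr_gt0// invrK.
exact: ltW.
Qed.

Lemma nu_le A B : measurable A -> measurable B -> A `<=` B -> nu A <= nu B.
Proof.
move=> mA mB AB; rewrite -(setDUK AB) nuD//; last 2 first.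
- exact: measurableD.
- exact: setDIK.
by rewrite lerDl.
Qed.

(** The s-th power of a maximum is at most the sum of the s-th powers, so the constants add. *)
Lemma admissible_max K1 K2 M1 M2 : admissible K1 M1 -> admissible K2 M2 ->
  admissible (K1 + K2) (fun A z => Num.max (M1 A z) (M2 A z)).
Proof.
move=> [m1 p1 s1 l1] [m2' p2 s2 l2]; split.
- by move=> A mA; apply: measurable_maxr; [exact: m1|exact: m2'].
- by move=> A z; rewrite le_max p1.
- move=> A B mA mB AB z; rewrite ge_max.
  rewrite (le_trans (s1 _ _ mA mB AB z)) ?lerD ?le_max ?lexx//=.
  by rewrite (le_trans (s2 _ _ mA mB AB z)) ?lerD ?le_max ?lexx ?orbT.
- move=> A mA; rewrite mulrDl EFinD.
  apply: (@le_trans _ _ (\int[m2]_z (M1 A z `^ s + M2 A z `^ s)%:E)%E).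
    apply: ge0_le_integralT => z; rewrite lee_fin ?powR_ge0//.
    by rewrite /Num.max; case: ifP => _; rewrite ?lerDl ?lerDr powR_ge0.
  rewrite ge0_integralRD//; [|by move=> z; exact: powR_ge0..|exact/measurable_fun_powR/m1|
    exact/measurable_fun_powR/m2'].
  by apply: leeD; [exact: l1|exact: l2].
Qed.

Section chain.
Variables (K : R) (M : set T1 -> T2 -> R) (S : nat -> set T1).
Hypothesis admM : admissible K M.
Hypothesis mS : forall i, measurable (S i).
Hypothesis ndS : forall i j, (i <= j)%N -> S i `<=` S j.

Definition chain_max a b (A : set T1) (z : T2) : R :=
  \big[Num.max/0]_(a <= i < b) M (A `&` S i) z.

Lemma chain_max_ge0 a b A z : 0 <= chain_max a b A z.
Proof. exact: bigmax_ge_id. Qed.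

Lemma measurable_chain_max a b A : measurable A -> measurable_fun setT (chain_max a b A).
Proof.
move=> mA; rewrite /chain_max; elim: (index_iota a b) => [|i r IHr].
  by under eq_fun do rewrite big_nil; exact: measurable_cst.
under eq_fun do rewrite big_cons; apply: measurable_maxr => //.
by apply: admissible_measurable admM _ _; exact: measurableI.
Qed.

Lemma chain_max_le a b A z (y : R) : 0 <= y ->
  (forall i, (a <= i < b)%N -> M (A `&` S i) z <= y) -> chain_max a b A z <= y.
Proof.
move=> y0 H; rewrite /chain_max big_seq; apply: bigmax_le => // i.
by rewrite mem_index_iota; exact: H.
Qed.

Lemma le_chain_max a b A z i : (a <= i < b)%N -> M (A `&` S i) z <= chain_max a b A z.
Proof.
by move=> iab; apply: (@bigmax_sup_seq _ _ _ _ _ i) => //; rewrite mem_index_iota.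
Qed.

(** [k] is the first index at which the mass exceeds [nuA], or the last index of the chain if there
    is none; for the last index nothing follows [k] and the final claim is vacuous. *)
Lemma chain_split (nuA : R) a m A : 0 <= nuA -> exists2 k, (a <= k < a + m.+1)%N &
  (forall i, (a <= i < k)%N -> nu (A `&` S i) <= nuA) /\
  ((k.+1 < a + m.+1)%N -> nuA < nu (A `&` S k)).
Proof.
move=> nuA0; elim: m a => [|m IHm] a.
  exists a; first by rewrite addn1 leqnn ltnSn.
  by split => [i|]; rewrite ?addn1 ?ltnn// => /andP[/leq_ltn_trans H /H]; rewrite ltnn.
have [Sa|Sa] := leP (nu (A `&` S a)) nuA; last first.
  exists a; first by rewrite leqnn -addSnnS leq_addr.
  by split => // i /andP[/leq_ltn_trans H /H]; rewrite ltnn.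
have [k /andP[ak kb] [H1 H2]] := IHm a.+1; rewrite addSnnS in kb H2.
exists k; first by rewrite (ltnW ak) kb.
split => // i /andP[]; rewrite leq_eqVlt => /predU1P[<-//|ai ik].
by apply: H1; rewrite ai.
Qed.

Lemma chain_max_subadditive a b A B z : measurable A -> measurable B -> A `&` B = set0 ->
  chain_max a b (A `|` B) z <= chain_max a b A z + chain_max a b B z.
Proof.
move=> mA mB AB; apply: chain_max_le => [|i iab]; first by rewrite addr_ge0 ?chain_max_ge0.
rewrite setIUl.
apply: le_trans (admissible_subadditive admM _ _ _ _) _; [exact: measurableI|exact: measurableI| |].
  by rewrite setIACA AB set0I.
by rewrite lerD ?le_chain_max.
Qed.

(* Induction on the length of the chain: cut it at the set [S k] that first takes more than half of the mass of [A]. Before [k] the chain lives in [A `&` S k.-1], after [k] in [A `\` S k] up to the single term [M (A `&` S k)]; both pieces carry at most half of the mass. *)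
Lemma chain_max_bound (p l D : R) : 0 <= p -> 0 <= l -> 0 <= D -> 0 <= K ->
  (forall a b : R, 0 <= a -> 0 <= b -> (a + b) `^ s <= p * a `^ s + l * b `^ s) ->
  p + l * (2 * 2 `^ (- (s / 2))) * D = D ->
  forall m a A, measurable A ->
    (\int[m2]_z (chain_max a (a + m) A z `^ s)%:E <= (D * K * nu A `^ (s / 2))%:E)%E.
Proof.
move=> p0 l0 D0 K0 pl pD.
have int0 a b A : (b <= a)%N -> (\int[m2]_z (chain_max a b A z `^ s)%:E)%E = 0%E.
  move=> ba; rewrite integral0_eq// => z _.
  by rewrite /chain_max big_geq// powR0 ?gt_eqF.
elim/ltn_ind => -[_ a A mA|m IHm a A mA].
  by rewrite addn0 int0// lee_fin !mulr_ge0// powR_ge0.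
have nu2 : 0 <= nu A / 2 by rewrite divr_ge0.
have [k /andP[ak kb] [H1 H2]] := chain_split a m A nu2.
set b := (a + m.+1)%N in kb H2 *.
have [L mL [LA nuL XL]] : exists2 L, measurable L & [/\ L `<=` A, nu L <= nu A / 2 &
    forall z, chain_max a k A z <= chain_max a k L z].
  have [ka|ak'] := leqP k a.
    exists set0 => //; split => //.
      have := nuD measurable0 measurable0 (setI0 _); rewrite setU0 => /eqP.
      by rewrite -subr_eq0 opprD addNKr oppr_eq0 => /eqP ->.
    by move=> z; rewrite /chain_max !big_geq.
  have k0 : (0 < k)%N by exact: leq_ltn_trans ak'.
  exists (A `&` S k.-1); first exact: measurableI.
  split; first exact: subIsetl.
    by apply: H1; rewrite -ltnS prednK// ak'/= leqnn.
  move=> z; apply: chain_max_le => [|i /andP[ai ik]]; first exact: chain_max_ge0.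
  have -> : A `&` S i = A `&` S k.-1 `&` S i.
    by rewrite -setIA; congr setI; apply/esym/setIidPr/ndS; rewrite -ltnS prednK.
  by apply: le_chain_max; rewrite ai.
have mk : measurable (A `&` S k) by exact: measurableI.
have mkD : measurable (A `\` S k) by exact: measurableD.
pose X := chain_max a k L; pose Y := chain_max k.+1 b (A `\` S k).
have kD i : (k <= i)%N -> A `&` S i = (A `&` S k) `|` ((A `\` S k) `&` S i).
  move=> ki; apply/seteqP; split => [x [Ax Sx]|x [[Ax Sx]|[[Ax _] Sx]]].
  - by have [xk|xk] := pselect (S k x); [left|right].
  - by split => //; exact: (ndS ki).
  - by [].
(* Every other index lies on one side of [k], so the sides enter through a maximum and not a sum:
   its s-th power is at most [X^s + Y^s], with coefficient 1. *)
have Nle z : chain_max a b A z <= M (A `&` S k) z + Num.max (X z) (Y z).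
  apply: chain_max_le => [|i /andP[ai ib]].
    by rewrite addr_ge0 ?(admissible_ge0 admM)// le_max chain_max_ge0.
  have [ik|ki] := ltnP i k.
    rewrite -[leLHS]add0r lerD ?(admissible_ge0 admM)// le_max; apply/orP; left.
    by apply: le_trans (XL z); apply: le_chain_max; rewrite ai.
  move: ki; rewrite leq_eqVlt => /predU1P[<-|ki].
    by rewrite lerDl le_max chain_max_ge0.
  rewrite (kD i (ltnW ki)).
  apply: le_trans (admissible_subadditive admM _ _ _ _) _ => //; first exact: measurableI.
    by apply/seteqP; split => // x [[_ Sx] [[_ /(_ Sx)]]].
  by rewrite lerD2l le_max; apply/orP; right; apply: le_chain_max; rewrite ki.
have nup (B : set T1) : nu B <= nu A / 2 ->
    D * K * nu B `^ (s / 2) <= D * K * (nu A `^ (s / 2) * 2 `^ (- (s / 2))).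
  have -> : nu A `^ (s / 2) * 2 `^ (- (s / 2)) = (nu A / 2) `^ (s / 2).
    move: (s / 2) => t.
    by rewrite powRM ?invr_ge0// -[in RHS](@powR_inv1 _ 2)// -powRrM mulN1r.
  move=> nuB; rewrite ler_wpM2l ?mulr_ge0//.
  by apply: ge0_ler_powR; rewrite ?nnegrE ?divr_ge0// ltW.
have IX : (\int[m2]_z (X z `^ s)%:E <= (D * K * (nu A `^ (s / 2) * 2 `^ (- (s / 2))))%:E)%E.
  apply: (@le_trans _ _ (D * K * nu L `^ (s / 2))%:E); last by rewrite lee_fin nup.
  rewrite /X -(subnKC ak); apply: IHm => //.
  by rewrite ltn_subLR// -/b.
have IY : (\int[m2]_z (Y z `^ s)%:E <= (D * K * (nu A `^ (s / 2) * 2 `^ (- (s / 2))))%:E)%E.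
  have [bk|kb'] := leqP b k.+1.
    by rewrite /Y int0// lee_fin !mulr_ge0 ?powR_ge0.
  apply: (@le_trans _ _ (D * K * nu (A `\` S k) `^ (s / 2))%:E); last first.
    rewrite lee_fin nup//; have := nuD mk mkD.
    have -> : (A `&` S k) `|` (A `\` S k) = A by rewrite setUIDK.
    have -> : A `&` S k `&` (A `\` S k) = set0 by apply/seteqP; split => // x [[_ Sx] [_ /(_ Sx)]].
    by move=> /(_ erefl) nuE; have := H2 kb'; lra.
  rewrite /Y -(subnKC (ltnW kb')); apply: IHm => //.
  by rewrite ltnS leq_subLR /b addnS addSn ltnS leq_add2r.
have mX : measurable_fun setT X by exact: measurable_chain_max.
have mY : measurable_fun setT Y by exact: measurable_chain_max.
have mMk : measurable_fun setT (M (A `&` S k)) by exact: (admissible_measurable admM).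
apply: (@le_trans _ _ (\int[m2]_z (p * M (A `&` S k) z `^ s + l * (X z `^ s + Y z `^ s))%:E)%E).
  apply: ge0_le_integralT => z; rewrite lee_fin ?powR_ge0//.
  apply: (@le_trans _ _ ((M (A `&` S k) z + Num.max (X z) (Y z)) `^ s)).
    apply: ge0_ler_powR; rewrite ?nnegrE ?addr_ge0 ?chain_max_ge0 ?(admissible_ge0 admM) ?(ltW s_gt0)//.
    by rewrite le_max chain_max_ge0.
  rewrite (le_trans (pl _ _ _ _)) ?(admissible_ge0 admM)//.
    by rewrite le_max chain_max_ge0.
  rewrite lerD2l ler_wpM2l//.
  by rewrite /Num.max; case: ifP => _; rewrite ?lerDl ?lerDr powR_ge0.
have pw (f : T2 -> R) z : 0 <= f z `^ s by exact: powR_ge0.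
have mpX := measurable_fun_powR s mX; have mpY := measurable_fun_powR s mY.
have mpM := measurable_fun_powR s mMk.
rewrite ge0_integralRD; [|by move=> z; rewrite mulr_ge0|by move=> z; rewrite mulr_ge0// addr_ge0|
  exact: measurable_funM|by apply: measurable_funM => //; exact: measurable_funD].
rewrite !ge0_integralRZl// => [|z|]; [|by rewrite addr_ge0|exact: measurable_funD].
rewrite ge0_integralRD//.
have IM : (\int[m2]_z (M (A `&` S k) z `^ s)%:E <= (K * nu A `^ (s / 2))%:E)%E.
  apply: le_trans (admissible_le admM mk) _; rewrite lee_fin ler_wpM2l//.
  apply: ge0_ler_powR; rewrite ?nnegrE ?divr_ge0 ?(ltW s_gt0)//.
  by apply: nu_le => //; exact: subIsetl.
set N := nu A `^ (s / 2); set h := 2 `^ (- (s / 2)).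
(* Here [D] is the fixed point of the recursion: [p] for the single term, and [l * 2^(-s/2) * D] for
   each of the two halves. *)
have -> : D * K * N = p * (K * N) + l * (D * K * (N * h) + D * K * (N * h)).
  rewrite -[in LHS]pD -/h; ring.
rewrite EFinD !EFinM [in leRHS]EFinD.
apply: leeD; apply: lee_wpmul2l; rewrite ?lee_fin//.
exact: (leeD IX IY).
Qed.

End chain.

End christ_kiselev.

(** [D] is fixed before the spaces, the operator and the length [N] of the chain, and the conclusion
    has the form of the hypothesis on [M]; so the bound can be iterated with one constant. *)
Definition christ_kiselev_bound {R : realType} (s D : R) :=
  forall d1 d2 (T1 : measurableType d1) (T2 : measurableType d2)
    (m2 : {measure set T2 -> \bar R}) (nu : set T1 -> R),
    (forall A, 0 <= nu A) ->
    (forall A B, measurable A -> measurable B -> A `&` B = set0 -> nu (A `|` B) = nu A + nu B) ->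
  forall K M S N, 0 <= K -> admissible m2 nu s K M ->
    (forall i, measurable (S i)) -> (forall i j, (i <= j)%N -> S i `<=` S j) ->
    admissible m2 nu s (D * K) (chain_max M S 0 N).

Lemma christ_kiselev {R : realType} (s : R) : 2 < s ->
  exists2 D : R, 0 <= D & christ_kiselev_bound s D.
Proof.
move=> s2; have [p [l [p0 l0 pl1 pl]]] := powRD_le s2.
set q := l * (2 * 2 `^ (- (s / 2))) in pl1.
have q1 : 0 < 1 - q by rewrite subr_gt0.
(* The solution of [D = p + q * D], nonnegative because [q < 1]. *)
exists (p / (1 - q)); first by rewrite divr_ge0// ltW.
move=> d1 d2 T1 T2 m2 nu nu0 nuD K M S N K0 admM mS ndS; split.
- by move=> A mA; exact: (measurable_chain_max admM).
- by move=> A z; exact: chain_max_ge0.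
- by move=> A B mA mB AB z; exact: (chain_max_subadditive admM).
- move=> A mA; rewrite -[N]add0n; apply: (chain_max_bound s2 nu0 nuD admM) pl _ _ _ A mA => //.
    by rewrite divr_ge0// ltW.
  by rewrite -/q; field; rewrite gt_eqF.
Qed.

(** * Maximal functions over level sets *)

Section grid.
Context {R : realType}.

(* Points of step [1 / (k + 1)] in [- (k + 1), k + 1]. *)
Definition grid (k i : nat) : R := i%:R / k.+1%:R - k.+1%:R.

(** An interval of length [2 (k + 1)] contains [2 (k + 1)^2] steps, hence one more point. *)
Definition grid_size (k : nat) : nat := (2 * k.+1 ^ 2).+1.

Lemma near_natS_gt (x : R) : \forall k \near \oo, x < k.+1%:R.
Proof.
near=> k; apply: (@le_lt_trans _ _ k%:R); last by rewrite ltr_nat.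
by near: k; exact: nbhs_infty_ger.
Unshelve. all: by end_near. Qed.

Lemma grid_le k i j : (i <= j)%N -> grid k i <= grid k j.
Proof. by move=> ij; rewrite lerB// ler_wpM2r ?invr_ge0// ler_nat. Qed.

(* The condition [x * y < u] is the limit of grid conditions on [x] or [- x], according to the sign of [y]; for [y = 0] the grid points tend to an infinity. *)
Lemma grid_approx (y u : R) : exists (sg : bool) (i : nat -> nat),
  (forall k, (i k < grid_size k)%N) /\
  forall x, \forall k \near \oo, ((-1) ^+ sg * x < grid k (i k)) = (x * y < u).
Proof.
have [->|y0] := eqVneq y 0.
  have [u0|u0] := ltP 0 u.
    exists false, (fun k => (2 * k.+1 ^ 2)%N); split => // x.
    near=> k; rewrite mulr0 u0 expr0 mul1r /grid.
    rewrite natrM natrX expr2 mulrA mulfK ?pnatr_eq0//.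
    rewrite (_ : 2 * k.+1%:R - k.+1%:R = k.+1%:R); last by ring.
    by near: k; exact: near_natS_gt.
  exists false, (fun=> 0%N); split => // x.
  near=> k; rewrite mulr0 [RHS]ltNge u0 expr0 mul1r /grid mul0r sub0r.
  apply/negbTE; rewrite -leNgt lerNl ltW//.
  by near: k; exact: near_natS_gt.
have ay : 0 < `|y| by rewrite normr_gt0.
set v := u / `|y|.
(* The position of [v] on the grid in units of one step; its integer part is the index of the grid
   point just below [v]. The minimum with the last index keeps it in range while [k] is too small
   for the grid to reach [v]. *)
pose t (k : nat) : R := (v + k.+1%:R) * k.+1%:R.
pose sg : bool := y < 0.
exists sg, (fun k => minn (Num.trunc (t k)) (2 * k.+1 ^ 2)); split.
  by move=> k; rewrite ltnS geq_minr.
move=> x; have -> : (x * y < u) = ((-1) ^+ sg * x < v).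
  rewrite /v ltr_pdivlMr// {1}(realEsign (num_real y)) -/sg.
  by rewrite mulrA [x * _]mulrC.
set x' := (-1) ^+ _ * x.
have H : x' < v -> \forall k \near \oo, k.+1%:R^-1 <= v - x'.
  rewrite -subr_gt0 => xv; near=> k; rewrite -[leRHS]invrK lef_pV2 ?posrE ?invr_gt0//.
  by apply: ltW; near: k; exact: near_natS_gt.
(* A grid point at most [v] never accepts an [x' >= v]; one within [1 / (k + 1)] of [v] accepts a
   given [x' < v] from some [k] on. *)
suff H2 : \forall k \near \oo, grid k (minn (Num.trunc (t k)) (2 * k.+1 ^ 2)) <= v /\
    v < grid k (minn (Num.trunc (t k)) (2 * k.+1 ^ 2)) + k.+1%:R^-1.
  have [xv|xv] := ltP x' v; last first.
    by apply: filterS H2 => k [gv _]; apply/negbTE; rewrite -leNgt (le_trans gv).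
  apply: filterS2 (H xv) H2 => k; move: (grid k _) => g h [_ h2].
  by apply: (@le_lt_trans _ _ (v - k.+1%:R^-1)); rewrite ?ltrBlDr// lerBrDr addrC -lerBrDr.
near=> k.
have vk : `|v| <= k.+1%:R.
  by apply: ltW; near: k; exact: near_natS_gt.
have [vk1 vk2] : - k.+1%:R <= v /\ v <= k.+1%:R by move: vk; rewrite ler_norml => /andP.
have t0 : 0 <= t k by rewrite /t mulr_ge0//; clear -vk1; lra.
have /andP[t1 t2] := trunc_itv t0.
have -> : minn (Num.trunc (t k)) (2 * k.+1 ^ 2) = Num.trunc (t k).
  apply/minn_idPl; rewrite -(ler_nat R) (le_trans t1)// natrM natrX expr2 mulrA /t.
  by rewrite ler_wpM2r//; clear -vk2; lra.
split; rewrite /grid; first by rewrite lerBlDr ler_pdivrMr.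
rewrite addrAC -[X in _ + X - _]mul1r -mulrDl ltrBrDr ltr_pdivlMr//.
by rewrite natr1.
Unshelve. all: by end_near. Qed.

End grid.

Section level_sets.
Context d1 d2 (T1 : measurableType d1) (T2 : measurableType d2) {R : realType} (m : nat).
Variable r : 'I_m -> T1 -> R.
Hypothesis mr : forall j, measurable_fun setT (r j).
Variable M : set T1 -> T2 -> R.

Definition level_set k (j : 'I_m) (sg : bool) (i : nat) : set T1 :=
  [set x | (-1) ^+ sg * r j x < grid k i].

(** One nested chain maximum per coordinate. Both signs are included because the sign of the
    coordinate of [z], which decides between sublevel and superlevel sets, varies with [z]. *)
Fixpoint level_max k (l : seq 'I_m) : set T1 -> T2 -> R :=
  if l is j :: l' then fun A z =>
    Num.max (chain_max (level_max k l') (level_set k j false) 0 (grid_size k) A z)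
            (chain_max (level_max k l') (level_set k j true) 0 (grid_size k) A z)
  else M.

Lemma measurable_level_set k j sg i : measurable (level_set k j sg i).
Proof.
rewrite (_ : level_set k j sg i = (fun x => (-1) ^+ sg * r j x) @^-1` `]-oo, grid k i[%classic); last first.
  by apply/seteqP; split => x; rewrite /level_set/= in_itv.
rewrite -[X in measurable X]setTI; apply: measurable_funM => //.
Qed.

Lemma le_level_max k l A z (sg : 'I_m -> bool) (i : 'I_m -> nat) :
  (forall j, (i j < grid_size k)%N) ->
  M (A `&` [set x | forall j, j \in l -> level_set k j (sg j) (i j) x]) z <= level_max k l A z.
Proof.
move=> ik; elim: l A => [|j l IHl] A /=.
  by rewrite (_ : A `&` _ = A)//; apply/seteqP; split => x // [].
have -> : A `&` [set x | forall j0, j0 \in j :: l -> level_set k j0 (sg j0) (i j0) x] =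
    (A `&` level_set k j (sg j) (i j)) `&` [set x | forall j0, j0 \in l -> level_set k j0 (sg j0) (i j0) x].
  apply/seteqP; split => x /=.
    move=> [Ax H]; split; first by split => //; apply: H; rewrite mem_head.
    by move=> j0 j0l; apply: H; rewrite inE j0l orbT.
  move=> [[Ax Sx] H]; split => // j0; rewrite inE => /predU1P[->//|]; exact: H.
apply: (le_trans (IHl _)); rewrite le_max; apply/orP.
by case: (sg j); [right|left]; apply: le_chain_max => /=.
Qed.

Variables (m2 : {measure set T2 -> \bar R}) (nu : set T1 -> R) (s : R) (D K : R).
Hypothesis K0 : 0 <= K.
Hypothesis D0 : 0 <= D.
Hypothesis admM : admissible m2 nu s K M.
Hypothesis nu_ge0 : forall A, 0 <= nu A.
Hypothesis nuD : forall A B, measurable A -> measurable B -> A `&` B = set0 ->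
  nu (A `|` B) = nu A + nu B.
Hypothesis CK : christ_kiselev_bound s D.

(** Each coordinate costs [D] for each of its two chains. The length of the chains, and with it [k],
    does not enter the constant. *)
Lemma admissible_level_max k l : admissible m2 nu s ((2 * D) ^+ size l * K) (level_max k l).
Proof.
elim: l => [|j l IHl]; first by rewrite expr0 mul1r.
have L0 : 0 <= (2 * D) ^+ size l * K by rewrite mulr_ge0// exprn_ge0// mulr_ge0.
have -> : (2 * D) ^+ size (j :: l) * K = D * ((2 * D) ^+ size l * K) + D * ((2 * D) ^+ size l * K).
  by rewrite /= exprS; ring.
have nd sg a b : (a <= b)%N -> level_set k j sg a `<=` level_set k j sg b.
  by move=> ab x /= /lt_le_trans; apply; exact: grid_le.
have adm sg := CK nu_ge0 nuD (grid_size k) L0 IHl (measurable_level_set k j sg) (nd sg).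
exact: admissible_max (adm false) (adm true).
Qed.

End level_sets.

Lemma indicU_disjoint {R : realType} (T : Type) (A B : set T) (x : T) :
  A `&` B = set0 -> \1_(A `|` B) x = \1_A x + \1_B x :> R.
Proof.
move=> AB; rewrite !indicE in_setU.
have [xA|xA] := boolP (x \in A); last by rewrite add0r.
have [xB|xB] := boolP (x \in B); last by rewrite addr0.
by have : set0 x by rewrite -AB; split; exact: set_mem.
Qed.

(** * Oscillatory integrals cut off to orthants *)

Section level_osc.
Context {R : realType} {n : nat}.
Local Notation mu := (rVleb R n).
Local Notation muxt := (muxt R n).
Variable phi : 'rV[R]_n -> R.
Hypothesis cphi : continuous phi.
Variable G : 'rV[R]_n -> R.
Variable A : R.
Hypothesis mG : measurable_fun setT G.
Hypothesis GA : forall x, `|G x| <= A * wt x.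
Variable c : R.

Definition osc_on (E : set 'rV[R]_n) z := `|osc phi (fun x => G x * \1_E x) c z|.

Definition mass_on (E : set 'rV[R]_n) : R := \int[mu]_x ((G x * \1_E x) ^+ 2).

Let A0 : 0 <= A.
Proof. exact: wt_le_ge0 GA. Qed.

Let iG : integrableR mu G.
Proof. exact: integrable_wt_le mG GA. Qed.

Let mGE E : measurable E -> measurable_fun setT (fun x => G x * \1_E x).
Proof. by move=> mE; apply: measurable_funM => //; exact: measurable_indic. Qed.

Let GE_le (E : set 'rV[R]_n) x : `|G x * \1_E x| <= `|G x|.
Proof. by rewrite normrM ler_piMr// ger0_norm ?indic_ge0// indicE lern1 leq_b1. Qed.

Let GE_wt (E : set 'rV[R]_n) x : `|G x * \1_E x| <= A * wt x.
Proof. exact: le_trans (GE_le E x) (GA x). Qed.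

Let iGE E : measurable E -> integrableR mu (fun x => G x * \1_E x).
Proof. by move=> mE; apply: integrable_wt_le (mGE mE) _ => x; exact: GE_wt. Qed.

Lemma mass_on_ge0 E : 0 <= mass_on E.
Proof. by apply: Rintegral_ge0 => x _; exact: sqr_ge0. Qed.

Lemma mass_onD E F : measurable E -> measurable F -> E `&` F = set0 ->
  mass_on (E `|` F) = mass_on E + mass_on F.
Proof.
move=> mE mF EF.
have i2 B : measurable B -> integrableR mu (fun x => (G x * \1_B x) ^+ 2).
  move=> mB; apply: (integrableMbound (iGE mB) (mGE mB) (M := A)) => x.
  by apply: (le_trans (GE_wt B x)); rewrite ler_piMr// wt_le1.
rewrite /mass_on -RintegralD//; [|exact: i2..].
apply: eq_Rintegral => x _; rewrite (indicU_disjoint x EF).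
have : \1_E x * \1_F x = 0 :> R.
  by rewrite -[LHS]/((\1_E \* \1_F) x) -indicI EF indic0.
by move: (\1_E x) (\1_F x) => a b ab; rewrite !exprMn; nra.
Qed.

(** Subadditivity is linearity in [G] and the triangle inequality; the L^s bound is [osc_wt_le] for
    the cut off [G], which obeys the same pointwise bound. *)
Lemma admissible_osc_on s C : 2 < s -> strichartz_estimate phi s C ->
  c = 0 \/ c = - (pi / 2) ->
  admissible muxt mass_on s (strichartz_const s C) osc_on.
Proof.
move=> s2 St hc; split.
- move=> E mE; apply: measurableT_comp => //; apply: measurable_osc => //; exact: iGE.
- by move=> E z; exact: normr_ge0.
- move=> E F mE mF EF z; rewrite /osc_on (le_trans _ (ler_normD _ _))//.
  rewrite le_eqVlt; apply/orP; left; apply/eqP; congr Num.norm.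
  rewrite /osc -RintegralD//; [|exact: integrable_osc (iGE mE)|exact: integrable_osc (iGE mF)].
  by apply: eq_Rintegral => x _; rewrite (indicU_disjoint x EF); ring.
- by move=> E mE; exact: (osc_wt_le cphi s2 St (mGE mE) (GE_wt E) hc).
Qed.

Lemma osc_on_le E z : measurable E -> osc_on E z <= \int[mu]_x `|G x|.
Proof.
move=> mE; apply: normr_Rintegral_le (integrable_norm iG) _.
  by apply: measurable_funM; [exact: mGE|exact: measurable_oscphase1].
by move=> x; rewrite normrM (le_trans _ (GE_le E x))// ler_piMr// cos_max.
Qed.

Section levels.
Variable r : 'I_n.+1 -> 'rV[R]_n -> R.
Hypothesis mr : forall j, measurable_fun setT (r j).

Definition orthant z (u : 'rV[R]_n.+1) : set 'rV[R]_n :=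
  [set x | forall j, r j x * rV_snoc z ord0 j < u ord0 j].

Lemma measurable_orthant z u : measurable (orthant z u).
Proof.
rewrite (_ : orthant z u = \bigcap_(j in [set: 'I_n.+1])
   ((fun x => r j x * rV_snoc z ord0 j) @^-1` `]-oo, u ord0 j[%classic)); last first.
  apply/seteqP; split => [x Ex j _|x Ex j]; first by rewrite /= in_itv/=; exact: Ex.
  by have := Ex j I; rewrite /= in_itv.
apply: fin_bigcap_measurable => // j _; rewrite -[X in measurable X]setTI.
exact: measurable_funM.
Qed.

Definition osc_level k z := level_max r osc_on k (enum 'I_n.+1) setT z.

(** For fixed [z] and [u], [grid_approx] supplies a sign and an index per coordinate, so that the
    indicator of the orthant is a pointwise limit of indicators of grid intersections; dominated
    convergence carries this over to the integrals. *)
Lemma osc_on_orthant_le z u (e : R) : 0 < e ->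
  \forall k \near \oo, osc_on (orthant z u) z <= osc_level k z + e.
Proof.
move=> e0.
have /(_ _)/cid-/all_sig[sg /(_ _)/cid-/all_sig[i Hi]] : forall j : 'I_n.+1, exists (sg : bool) (i : nat -> nat),
    (forall k, (i k < grid_size k)%N) /\
    forall x, \forall k \near \oo, ((-1) ^+ sg * x < grid k (i k)) = (x * rV_snoc z ord0 j < u ord0 j).
  by move=> j; exact: grid_approx.
pose E k := [set x | forall j, j \in enum 'I_n.+1 -> level_set r k j (sg j) (i j k) x].
have mE k : measurable (E k).
  rewrite (_ : E k = \bigcap_(j in [set: 'I_n.+1]) level_set r k j (sg j) (i j k)).
    by apply: fin_bigcap_measurable => // j _; exact: measurable_level_set.
  by apply/seteqP; split => x Ex j; [move=> _; apply: Ex; rewrite mem_enum|move=> _; exact: Ex].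
have H := @cvg_Rintegral _ _ _ mu
    (fun k xi => G xi * \1_(E k) xi * cos (phase phi z xi + c))
    (fun xi => G xi * \1_(orthant z u) xi * cos (phase phi z xi + c)) (fun y => `|G y|).
have {H} : osc phi (fun x => G x * \1_(E k) x) c z @[k --> \oo] --> osc phi (fun x => G x * \1_(orthant z u) x) c z.
  apply: (H _ _ (integrable_norm iG) _).2.
  - by move=> k; apply: measurable_funM; [exact: mGE|exact: measurable_oscphase1].
  - move=> x; apply: cvgM; last exact: cvg_cst.
    apply: cvgM; first exact: cvg_cst.
    apply: (@cvg_trans _ (cst (\1_(orthant z u) x : R) @ \oo)); last exact: cvg_cst.
    apply: near_eq_cvg.
    have : \forall k \near \oo, forall j : 'I_n.+1, ((-1) ^+ sg j * r j x < grid k (i j k)) =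
        (r j x * rV_snoc z ord0 j < u ord0 j).
      by apply: filter_forall => j; exact: (Hi j).2.
    apply: filterS => k Hk; rewrite !indicE; congr (_%:R); congr nat_of_bool.
    apply/idP/idP; rewrite !inE => Ex j.
      by move=> _; rewrite /level_set/= Hk; exact: Ex.
    by rewrite -Hk; apply: Ex; rewrite mem_enum.
  - move=> k x; rewrite normrM (le_trans _ (GE_le (E k) x))// ler_piMr//; exact: cos_max.
move=> /cvgrPdist_le /(_ _ e0); apply: filterS => k.
rewrite /osc_on; set a := osc _ _ _ _; set b := osc _ _ _ _ => ab.
have : `|b| <= osc_level k z.
  have := @le_level_max _ _ _ _ _ _ r osc_on k (enum 'I_n.+1) setT z sg (i ^~ k) (fun j => (Hi j).1 k).
  by rewrite setTI.
have := ler_distD b a 0; rewrite !subr0 => h1 h2.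
by rewrite (le_trans h1)// addrC lerD.
Qed.

(** The uniformity in [u] does not come from uniform convergence: [osc_on_orthant_le] is applied to
    a single [u] whose value is within [e / 2] of the supremum over all orthants. *)
Lemma osc_orthant_sup z (e : R) : 0 < e ->
  \forall k \near \oo, forall u, osc_on (orthant z u) z <= osc_level k z + e.
Proof.
move=> e0; have e20 : 0 < e / 2 by rewrite divr_gt0.
pose V := [set osc_on (orthant z u) z | u in [set: 'rV[R]_n.+1]].
have supV : has_sup V.
  split; first by exists (osc_on (orthant z 0) z); exists 0.
  exists (\int[mu]_x `|G x|) => _ [u _ <-]; apply: osc_on_le; exact: measurable_orthant.
have [_ [u _ <-] uV] := sup_adherent e20 supV.
apply: filterS (osc_on_orthant_le z u e20) => k uk v.
have : osc_on (orthant z v) z <= sup V by apply: ub_le_sup; [case: supV|exists v].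
move: uV; rewrite ltrBlDr => /ltW uV vV.
by rewrite (le_trans vV)// (le_trans uV)// [e in leRHS]splitr addrA lerD2r.
Qed.

End levels.

End level_osc.

(** The sequence [f_] itself may fail to converge, but the minimum of [h] and [f_ k] tends to [h]
    and stays below [f_ k]. *)
Lemma fatou_powR_near {R : realType} d (T : measurableType d) (m : {measure set T -> \bar R})
    (s : R) (f_ : nat -> T -> R) (h : T -> R) (B : \bar R) : 1 <= s ->
  (forall k, measurable_fun setT (f_ k)) -> measurable_fun setT h ->
  (forall k x, 0 <= f_ k x) -> (forall x, 0 <= h x) ->
  (forall x (e : R), 0 < e -> \forall k \near \oo, h x <= f_ k x + e) ->
  (forall k, \int[m]_x (f_ k x `^ s)%:E <= B)%E ->
  (\int[m]_x (h x `^ s)%:E <= B)%E.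
Proof.
move=> s1 mf mh f0 h0 hf fB; have s0 : 0 <= s by exact: le_trans s1.
have mg k : measurable_fun setT (fun x => Num.min (h x) (f_ k x)) by exact: measurable_minr.
have g0 k x : 0 <= Num.min (h x) (f_ k x) by rewrite le_min h0 f0.
apply: (fatou_le (m := m) (f_ := fun k x => Num.min (h x) (f_ k x) `^ s) (f := fun x => h x `^ s)).
- by move=> k; exact: measurableT_comp (measurable_powR s) (mg k).
- by move=> k x; exact: powR_ge0.
- move=> x; have -> : h x = `|h x| by rewrite ger0_norm.
  have -> : (fun k => Num.min `|h x| (f_ k x) `^ s) = (fun k => `|Num.min (h x) (f_ k x)| `^ s).
    by apply/funext => k; rewrite !ger0_norm.
  apply: cvg_powR_norm => //; apply/cvgrPdist_le => e e0.
  apply: filterS (hf x _ e0) => k hk.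
  rewrite /Num.min; case: ltP => [_|fh]; first by rewrite subrr normr0 ltW.
  by rewrite ger0_norm ?subr_ge0// lerBlDl.
move=> k; apply: le_trans (fB k).
apply: ge0_le_integralT => x; first by rewrite lee_fin powR_ge0.
by rewrite lee_fin; apply: ge0_ler_powR; rewrite ?nnegrE// ge_min lexx orbT.
Qed.

(** * Averages of indicators of orthants *)

Section orthant_representation.
Context {R : realType}.
Local Notation leb := (@lebesgue_measure R).

Definition lt_ind n (v u : 'rV[R]_n) : R := \prod_(j < n) (v ord0 j < u ord0 j)%R%:R.

Lemma lt_ind_snoc n (x w : 'rV[R]_n) (t s : R) :
  lt_ind (rV_snoc (x, t)) (rV_snoc (w, s)) = lt_ind x w * (t < s)%R%:R.
Proof.
rewrite /lt_ind big_ord_lift_max/= !rV_snoc_max; congr (_ * _).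
by apply: eq_bigr => i _; rewrite !rV_snoc_lift.
Qed.

Lemma lt_ind_ge0 n (v u : 'rV[R]_n) : 0 <= lt_ind v u.
Proof. by apply: prodr_ge0 => j _; rewrite ler0n. Qed.

Lemma lt_ind_le1 n (v u : 'rV[R]_n) : lt_ind v u <= 1.
Proof. by apply: prodr_ile1 => j _; rewrite ler0n lern1 leq_b1. Qed.

Lemma measurable_lt_ind d (T : measurableType d) n (f g : T -> 'rV[R]_n) :
  (forall j, measurable_fun setT (fun t => f t ord0 j)) ->
  (forall j, measurable_fun setT (fun t => g t ord0 j)) ->
  measurable_fun setT (fun t => lt_ind (f t) (g t)).
Proof.
move=> mf mg; apply: measurable_prod => j _.
have mb : measurable_fun setT (fun t => f t ord0 j < g t ord0 j) by exact: measurable_fun_ltr.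
have mn : measurable_fun [set: bool] (fun b : bool => b%:R : R) by [].
exact: measurableT_comp mn mb.
Qed.

Definition slice n (F : 'rV[R]_n.+1 -> R) (s : R) : 'rV[R]_n -> R := fun x => F (rV_snoc (x, s)).

Lemma rV_snocD n (x : 'rV[R]_n) s (h : R) i :
  rV_snoc (x + h *: delta_mx ord0 i, s) = rV_snoc (x, s) + h *: delta_mx ord0 (lift ord_max i).
Proof.
apply/rowP => j; rewrite !mxE /=; case: unliftP => [k ->|->]/=.
  by rewrite !mxE eqxx/= (inj_eq lift_inj).
by rewrite (negbTE (neq_lift _ _)) mulr0 addr0.
Qed.

Lemma rV_snocDt n (x : 'rV[R]_n) (s h : R) :
  rV_snoc (x, s + h) = rV_snoc (x, s) + h *: delta_mx ord0 ord_max.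
Proof.
apply/rowP => j; rewrite !mxE /=; case: unliftP => [k ->|->]/=.
  by rewrite eq_sym (negbTE (neq_lift _ _)) mulr0 addr0.
by rewrite eqxx mulr1.
Qed.

Let slice_quotient n (F : 'rV[R]_n.+1 -> R) (s : R) i (x : 'rV[R]_n) :
  (fun h : R => h^-1 *: ((slice F s \o shift x) (h *: delta_mx ord0 i) - slice F s x)) =
  (fun h : R => h^-1 *: ((F \o shift (rV_snoc (x, s))) (h *: delta_mx ord0 (lift ord_max i))
    - F (rV_snoc (x, s)))).
Proof.
apply/funext => h; rewrite /slice /= [h *: _ + x]addrC rV_snocD.
by rewrite [_ + h *: _]addrC.
Qed.

Lemma partials_slice n (F : 'rV[R]_n.+1 -> R) (s : R) l :
  partials l (slice F s) = slice (partials (map (lift ord_max) l) F) s.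
Proof.
elim: l => [//|i l IHl]; rewrite /= IHl; apply/funext => x.
by rewrite /partial /derive slice_quotient.
Qed.

Lemma continuous_slice n (F : 'rV[R]_n.+1 -> R) s : continuous F -> continuous (slice F s).
Proof.
move=> cF x; suff : F (rV_snoc (y, s)) @[y --> nbhs (x : 'rV[R]_n)] --> F (rV_snoc (x, s)) by [].
apply: (@cvg_comp _ _ _ (fun y => rV_snoc (y, s)) F _ (nbhs (rV_snoc (x, s) : 'rV[R]_n.+1))); last exact: cF.
apply: cvg_rV => j; rewrite mxE /=; under eq_fun do rewrite mxE/=.
case: unliftP => [k _|_] /=; last exact: cvg_cst.
exact: coord_continuous.
Qed.

Lemma smooth_slice n (F : 'rV[R]_n.+1 -> R) s : smooth F -> smooth (slice F s).
Proof.
move=> sF l; rewrite partials_slice; have [cF dF] := sF (map (lift ord_max) l); split.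
  exact: continuous_slice.
move=> i x; have := dF (lift ord_max i) (rV_snoc (x, s)).
by rewrite /derivable slice_quotient.
Qed.

(* Every direction once; the order matches the induction on the dimension in [orthant_representation]. *)
Fixpoint all_directions n : seq 'I_n :=
  if n is n'.+1 then rcons (map (lift ord_max) (all_directions n')) ord_max else [::].

Definition mixed_partial n (F : 'rV[R]_n -> R) := partials (all_directions n) F.

Lemma mixed_partial_slice n (F : 'rV[R]_n.+1 -> R) s x :
  mixed_partial (slice (partial ord_max F) s) x = mixed_partial F (rV_snoc (x, s)).
Proof. by rewrite /mixed_partial partials_slice /= /partials foldr_rcons. Qed.

Definition rapid n (F : 'rV[R]_n -> R) := smooth F /\
  forall l, exists A : R, forall x, `|partials l F x| <= A * wt x.

(** Induction on the dimension: the last variable by the fundamental theorem, the others by the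
    induction hypothesis for slices of the last partial derivative. Each variable contributes the
    sign of the lower boundary term. *)
Lemma orthant_representation n (F : 'rV[R]_n -> R) v : rapid F ->
  F v = (-1) ^+ n * \int[rVleb R n]_u (mixed_partial F u * lt_ind v u).
Proof.
elim: n F v => [F v|n IHn F v] rF.
  rewrite Rintegral_rV0.
    by rewrite /lt_ind big_ord0 mulr1 expr0 mul1r /mixed_partial/= (_ : v = 0)//; apply/rowP => -[].
  apply: measurable_funM; first by apply: rV_continuous_measurable; have [] := rF.1 [::].
  by apply: measurable_lt_ind => -[].
have [sF bF] := rF.
pose x : 'rV[R]_n := \row_i v ord0 (lift ord_max i); pose t := v ord0 ord_max.
have -> : v = rV_snoc (x, t).
  apply/rowP => j; case: (unliftP ord_max j) => [k|] ->.
    by rewrite rV_snoc_lift mxE.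
  by rewrite rV_snoc_max.
have sl s : rapid (slice (partial ord_max F) s).
  split; first exact/smooth_slice/smooth_partial.
  move=> l; have [A FA] := bF (rcons (map (lift ord_max) l) ord_max).
  exists (A * (1 + s ^+ 2)^-1) => y; rewrite partials_slice /slice.
  have := FA (rV_snoc (y, s)); rewrite wt_snoc /partials foldr_rcons.
  by rewrite [wt y * _]mulrC mulrA.
have [A FA] := bF (all_directions n.+1).
have [B FB] := bF [:: ord_max].
have [B0 FB0] := bF [::].
have cF : continuous (mixed_partial F) by have [] := sF (all_directions n.+1).
have mF : measurable_fun setT (mixed_partial F) by exact: rV_continuous_measurable.
pose h (w : 'rV[R]_n * R) := mixed_partial F (rV_snoc w) * lt_ind (rV_snoc (x, t)) (rV_snoc w).
have hle (w : 'rV[R]_n) (s : R) : `|h (w, s)| <= A * wt w * (1 + s ^+ 2)^-1.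
  rewrite normrM [X in _ * X]ger0_norm ?lt_ind_ge0// (le_trans (ler_piMr _ (lt_ind_le1 _ _)))//.
  by have := FA (rV_snoc (w, s)); rewrite wt_snoc mulrA.
have iA m (a : R) : integrableR (rVleb R m) (fun x : 'rV[R]_m => a * wt x).
  exact: (integrableRZl a (@integrable_wt R m)).
have mh0 : measurable_fun setT (fun u => mixed_partial F u * lt_ind (rV_snoc (x, t)) u).
  apply: measurable_funM => //; apply: measurable_lt_ind => j; first exact: measurable_cst.
  exact: measurable_rV_coord.
have mh : measurable_fun [set: 'rV[R]_n * measurableTypeR R] h.
  exact: measurableT_comp mh0 (@measurable_rV_snoc _ (measurableTypeR R) n).
rewrite (Rintegral_snoc mh0 (iA n A) (@integrable_oneDsqrV R) hle).
(* The last variable becomes the outer one, so that the induction hypothesis evaluates the inner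
   integral at each fixed [s]. *)
rewrite (@Rintegral_swap _ _ _ _ _ (rVleb R n) leb _ _ _ mh (iA n A) (@integrable_oneDsqrV R) hle).
have E s : \int[rVleb R n]_w h (w, s) = (-1) ^+ n * (partial ord_max F (rV_snoc (x, s)) * (t < s)%R%:R).
  have := IHn _ x (sl s); rewrite {1}/slice => ->.
  rewrite mulrA signrMK -RintegralZr//; last first.
    apply: (@le_integrableR _ _ _ _ _ (fun w => A * (1 + s ^+ 2)^-1 * wt w)) (iA _ _).
      apply: measurable_funM.
        by apply: rV_continuous_measurable; have [c1 _] := (sl s).1 (all_directions n); exact: c1.
      apply: (@measurable_lt_ind _ _ n (cst x) id) => j; first exact: measurable_cst.
      exact: measurable_rV_coord.
    move=> w; rewrite normrM [X in _ * X]ger0_norm ?lt_ind_ge0//.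
    rewrite (le_trans (ler_piMr _ (lt_ind_le1 _ _)))// mixed_partial_slice.
    by have := FA (rV_snoc (w, s)); rewrite wt_snoc mulrA mulrAC.
  by apply: eq_Rintegral => w _; rewrite /h lt_ind_snoc mixed_partial_slice mulrA.
under eq_Rintegral do rewrite E.
have fE s : rV_snoc (x, s) = rV_snoc (x, 0) + s *: delta_mx ord0 ord_max.
  by rewrite -rV_snocDt add0r.
have dF s : is_derive s (1 : R) (fun s : R => F (rV_snoc (x, s))) (partial ord_max F (rV_snoc (x, s))).
  have -> : (fun s : R => F (rV_snoc (x, s))) = (fun s => F (rV_snoc (x, 0) + s *: delta_mx ord0 ord_max)).
    by apply/funext => s'; rewrite fE.
  by rewrite (fE s); apply: is_derive_line; exact: smooth_derivable.
have cdF : continuous (fun s => partial ord_max F (rV_snoc (x, s))).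
  have [c1 _] := smooth_partial ord_max sF [::].
  move=> s; apply: (@cvg_comp _ _ _ (fun s => rV_snoc (x, s)) (partial ord_max F) _ (nbhs (rV_snoc (x, s) : 'rV[R]_n.+1))); last exact: c1.
  apply: cvg_rV => j; rewrite mxE /=; under eq_fun do rewrite mxE/=.
  by case: unliftP => [k _|_] /=; [exact: cvg_cst|exact: cvg_id].
have idF : integrableR leb (fun s => partial ord_max F (rV_snoc (x, s))).
  have H := @le_integrableR _ _ _ leb (fun s => partial ord_max F (rV_snoc (x, s))) (fun s => B * wt x * (1 + s ^+ 2)^-1).
  apply: H.
  - exact: continuous_measurable_fun.
  - by move=> s; have := FB (rV_snoc (x, s)); rewrite wt_snoc mulrA.
  - exact: (integrableRZl (B * wt x) (@integrable_oneDsqrV R)).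
(* The boundary term at infinity vanishes by the weight bound on [F] itself. *)
have F0 : F (rV_snoc (x, t + k.+1%:R)) @[k --> \oo] --> 0.
  apply/cvgr0Pnorm_le => e e0; set M := B0 * wt x.
  near=> k; set y := t + k.+1%:R.
  have y1 : M / e <= y.
    rewrite -lerBlDl; apply: (@le_trans _ _ k%:R); last by rewrite ler_nat.
    by near: k; exact: nbhs_infty_ger.
  have y0 : 0 < 1 + y ^+ 2 by rewrite ltr_pwDl ?sqr_ge0.
  have := FB0 (rV_snoc (x, y)); rewrite /= wt_snoc mulrA -/M => /le_trans; apply.
  rewrite ler_pdivrMr//; move: y1; rewrite ler_pdivrMr// mulrC => /le_trans; apply.
  by rewrite ler_wpM2l ?(ltW e0)//; have := sqr_ge0 (y - 1); nra.
rewrite RintegralZl//; last first.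
  apply: (integrableMbound idF (M := 1)) => [|s].
    have mb : measurable_fun [set: R] (fun s : R => t < s) by exact: measurable_fun_ltr.
    have mn : measurable_fun [set: bool] (fun b : bool => b%:R : R) by [].
    exact: measurableT_comp mn mb.
  by rewrite ger0_norm ?ler0n// lern1 leq_b1.
by rewrite (Rintegral_derive_gt dF cdF idF F0) exprS -mulrA signrMK mulN1r opprK.
Unshelve. all: by end_near. Qed.

End orthant_representation.

(** * Oscillatory integrals with a real amplitude *)

Section damped_oscillation.
Context {R : realType} {n : nat}.
Local Notation mu := (rVleb R n).
Local Notation muxt := (muxt R n).

(** The real building block of the operator: real amplitude, real frequency function, and [c]
    choosing between cosine and sine. *)
Definition damped (phi : 'rV[R]_n -> R) (psi : 'rV[R]_n.+1 -> R) (r : 'I_n.+1 -> 'rV[R]_n -> R)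
    (G : 'rV[R]_n -> R) (c : R) (z : 'rV[R]_n * R) : R :=
  \int[mu]_xi (psi (\row_j (r j xi * rV_snoc z ord0 j)) * G xi *
    cos (phase phi z xi + c)).

Variable phi : 'rV[R]_n -> R.
Hypothesis cphi : continuous phi.
Variable psi : 'rV[R]_n.+1 -> R.
Hypothesis rpsi : rapid psi.
Variable r : 'I_n.+1 -> 'rV[R]_n -> R.
Hypothesis mr : forall j, measurable_fun setT (r j).
Variables (G : 'rV[R]_n -> R) (A : R).
Hypothesis mG : measurable_fun setT G.
Hypothesis GA : forall x, `|G x| <= A * wt x.

Let iG : integrableR mu G.
Proof. exact: integrable_wt_le mG GA. Qed.

Let mpsi : measurable_fun setT psi.
Proof. by apply: rV_continuous_measurable; have [] := rpsi.1 [::]. Qed.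

Lemma measurable_damped c : measurable_fun [set: 'rV[R]_n * measurableTypeR R] (damped phi psi r G c).
Proof.
pose h (v : 'rV[R]_n * ('rV[R]_n * measurableTypeR R)) : R :=
  psi (\row_j (r j v.1 * rV_snoc v.2 ord0 j)) * G v.1 * cos (phase phi v.2 v.1 + c).
have mh : measurable_fun setT h.
  apply: measurable_funM; last exact: measurable_oscphase.
  apply: measurable_funM; last exact: measurableT_comp mG measurable_fst.
  have mrow : measurable_fun setT (fun v : 'rV[R]_n * ('rV[R]_n * measurableTypeR R) =>
      (\row_j (r j v.1 * rV_snoc v.2 ord0 j) : 'rV[R]_n.+1)).
    apply/measurable_fun_rVP => j; under eq_fun do rewrite mxE.
    apply: measurable_funM; first exact: measurableT_comp (mr j) measurable_fst.
    have m1 : measurable_fun setT (fun v : 'rV[R]_n * ('rV[R]_n * measurableTypeR R) => rV_snoc v.2).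
      exact: measurableT_comp (@measurable_rV_snoc _ (measurableTypeR R) n) measurable_snd.
    exact: measurableT_comp (@measurable_rV_coord _ _ _ j) m1.
  exact: measurableT_comp mpsi mrow.
have [B psiB] := rpsi.2 [::].
have B0 : 0 <= B by exact: wt_le_ge0 psiB.
have hG x z : `|h (x, z)| <= B * `|G x|.
  rewrite normrM (le_trans (ler_piMr _ (cos_max _)))// normrM ler_wpM2r//.
  by rewrite (le_trans (psiB _))// ler_piMr// wt_le1.
have iBG : integrableR mu (fun x => B * `|G x|).
  exact: (integrableRZl B (integrable_norm iG)).
exact: measurable_Rintegral_xt mh iBG hG.
Qed.

(** After inserting [orthant_representation] and exchanging the integrals, the integral over
    frequencies is that of [G] cut off to an orthant, bounded by [v]; the rest is the integral of
    the bound on the mixed derivative. *)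
Lemma damped_le c z (B v : R) : (forall u, `|mixed_partial psi u| <= B * wt u) ->
  (forall u, osc_on phi G c (orthant r z u) z <= v) ->
  `|damped phi psi r G c z| <= B * (\int[rVleb R n.+1]_u wt u) * v.
Proof.
move=> psiB ov.
have B0 : 0 <= B by exact: wt_le_ge0 psiB.
pose p xi := cos (phase phi z xi + c).
have mp : measurable_fun setT p by exact: measurable_oscphase1.
pose y xi : 'rV[R]_n.+1 := \row_j (r j xi * rV_snoc z ord0 j).
have my j : measurable_fun setT (fun xi => y xi ord0 j).
  by under eq_fun do rewrite mxE; exact: measurable_funM.
have mpart : measurable_fun setT (mixed_partial psi).
  by apply: rV_continuous_measurable; have [] := rpsi.1 (all_directions n.+1).
pose h (w : 'rV[R]_n * 'rV[R]_n.+1) := mixed_partial psi w.2 * lt_ind (y w.1) w.2 * (G w.1 * p w.1).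
have mh : measurable_fun setT h.
  apply: measurable_funM.
    apply: measurable_funM; first exact: measurableT_comp mpart measurable_snd.
    apply: measurable_lt_ind => j.
      exact: measurableT_comp (my j) measurable_fst.
    exact: measurableT_comp (@measurable_rV_coord _ _ _ j) measurable_snd.
  apply: measurable_funM; first exact: measurableT_comp mG measurable_fst.
  exact: measurableT_comp mp measurable_fst.
have hle x u : `|h (x, u)| <= `|G x| * (B * wt u).
  rewrite normrM mulrC ler_pM//.
    by rewrite normrM ler_piMr// cos_max.
  by rewrite normrM [X in _ * X]ger0_norm ?lt_ind_ge0// (le_trans (ler_piMr _ (lt_ind_le1 _ _))).
have iBw : integrableR (rVleb R n.+1) (fun u : 'rV[R]_n.+1 => B * wt u).
  exact: (integrableRZl B (@integrable_wt R n.+1)).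
have ihx x : integrableR (rVleb R n.+1) (fun u => mixed_partial psi u * lt_ind (y x) u).
  apply: (le_integrableR _ _ iBw).
    apply: measurable_funM => //.
    by apply: measurable_lt_ind => j; [exact: measurable_cst|exact: measurable_rV_coord].
  by move=> u; rewrite normrM [X in _ * X]ger0_norm ?lt_ind_ge0// (le_trans (ler_piMr _ (lt_ind_le1 _ _))).
have iGp : integrableR mu (fun x => (-1) ^+ n.+1 * (G x * p x)).
  exact: (integrableRZl ((-1) ^+ n.+1) (integrable_osc cphi c z iG)).
have -> : damped phi psi r G c z = (-1) ^+ n.+1 * \int[mu]_x (\int[rVleb R n.+1]_u h (x, u)).
  rewrite -RintegralZl//; last first.
    apply: (@le_integrableR _ _ _ _ _ (fun x => `|G x| * \int[rVleb R n.+1]_u (B * wt u))).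
    - exact: measurable_Rintegral_prod1 mh (integrable_norm iG) iBw hle.
    - move=> x; rewrite -RintegralZl//; apply: normr_Rintegral_le => //.
        exact: measurableT_comp mh (measurable_pair1 x).
      exact: (integrableRZl `|G x| iBw).
    - exact: (integrableRZr (\int[rVleb R n.+1]_u (B * wt u)) (integrable_norm iG)).
  apply: eq_Rintegral => x _; rewrite (orthant_representation (y x) rpsi) -/(p x).
  have A4 (a b g q : R) : a * b * g * q = a * (b * (g * q)) by ring.
  by rewrite A4 -RintegralZr.
rewrite normrM normr_sign mul1r.
rewrite (Rintegral_swap mh (integrable_norm iG) iBw hle).
rewrite -[leRHS]mulrA [X in _ <= B * X]mulrC mulrA.
have E u : \int[mu]_x h (x, u) = mixed_partial psi u * osc phi (fun x => G x * \1_(orthant r z u) x) c z.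
  rewrite /osc -RintegralZl//; last first.
    apply: integrable_osc => //; apply: (integrableMbound iG (M := 1)).
      exact: measurable_indic (measurable_orthant mr z u).
    by move=> x; rewrite ger0_norm ?indic_ge0// indicE lern1 leq_b1.
  apply: eq_Rintegral => x _; rewrite /h/= /p -!mulrA; congr (_ * _).
  rewrite mulrCA; congr (_ * _); congr (_ * _).
  rewrite indicE /lt_ind; have [xo|xo] := boolP (x \in orthant r z u).
    by apply: big1 => j _; rewrite mxE; have := set_mem xo j => ->.
  move: xo; rewrite notin_setE => /existsNP[j /negP/negbTE Hj].
  by rewrite (bigD1 j)//= mxE Hj mul0r.
have iv : integrableR (rVleb R n.+1) (fun u : 'rV[R]_n.+1 => B * v * wt u).
  exact: (integrableRZl (B * v) (@integrable_wt R n.+1)).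
rewrite -RintegralZl//; last exact: integrable_wt.
apply: normr_Rintegral_le => //.
  by have := measurable_Rintegral_prod2 mh (integrable_norm iG) iBw hle.
by move=> u; rewrite E normrM mulrAC ler_pM// ?ov.
Qed.

Variable s : R.
Hypothesis s_gt2 : 2 < s.
Variable C : R.
Hypothesis strichartz : strichartz_estimate phi s C.
Variable D : R.
Hypothesis D0 : 0 <= D.
Hypothesis CK : christ_kiselev_bound s D.

Lemma damped_powR_le c (B : R) : (forall u, `|mixed_partial psi u| <= B * wt u) ->
  c = 0 \/ c = - (pi / 2) ->
  (\int[muxt]_z (`|damped phi psi r G c z| `^ s)%:E <=
    ((B * (\int[rVleb R n.+1]_u wt u)) `^ s * ((2 * D) ^+ n.+1 * strichartz_const s C)
      * (\int[mu]_x (G x ^+ 2)) `^ (s / 2))%:E)%E.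
Proof.
move=> psiB hc; set I := \int[_]_u _.
have B0 : 0 <= B by exact: wt_le_ge0 psiB.
have I0 : 0 <= I by apply: Rintegral_ge0 => u _; exact: wt_ge0.
set b := B * I; have b0 : 0 <= b by rewrite mulr_ge0.
have adm k := admissible_level_max mr (strichartz_const_ge0 s C) D0
  (admissible_osc_on cphi mG GA s_gt2 strichartz hc)
  (mass_on_ge0 G) (mass_onD mG GA) CK k (enum 'I_n.+1).
apply: (fatou_powR_near (m := muxt) (f_ := fun k z => b * osc_level phi G c r k z) (h := fun z => `|damped phi psi r G c z|)).
- by rewrite (le_trans _ (ltW s_gt2))// ler1n.
- by move=> k; apply: measurable_funM => //; exact: (admissible_measurable (adm k)).
- by apply: measurableT_comp => //; exact: measurable_damped.
- by move=> k z; rewrite mulr_ge0//; exact: (admissible_ge0 (adm k)).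
- by move=> z; exact: normr_ge0.
(* The error is multiplied by [b], which may be 0, so the tolerance is divided by [b + 1]. *)
- move=> z e e0; have e'0 : 0 < e / (b + 1) by rewrite divr_gt0// ltr_wpDl.
  apply: filterS (osc_orthant_sup cphi mG GA c mr z e'0) => k Hk.
  rewrite (le_trans (damped_le psiB Hk))// -/I -/b mulrDr lerD2l mulrCA ler_piMr ?(ltW e0)//.
  by rewrite ler_pdivrMr ?ltr_wpDl// mul1r lerDl.
move=> k.
have := admissible_le (adm k) measurableT; rewrite size_enum_ord => H.
have mT : mass_on G setT = \int[mu]_x (G x ^+ 2).
  by apply: eq_Rintegral => x _; rewrite indicT mulr1.
rewrite mT in H; rewrite -mulrA EFinM.
apply: le_trans (lee_wpmul2l _ H); last by rewrite lee_fin powR_ge0.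
rewrite -ge0_integralRZl ?powR_ge0//; [|by move=> z; exact: powR_ge0|
  by apply: measurable_fun_powR; exact: (admissible_measurable (adm k))].
rewrite le_eqVlt; apply/orP; left; apply/eqP; apply: eq_integral => z _.
by rewrite powRM//; exact: (admissible_ge0 (adm k)).
Qed.

End damped_oscillation.

(** * Reduction to Borel functions *)

Section completed_measurability.
Context {R : realType}.
Import HBNNSimple.

(* No measurability is assumed of [f] and [g]: the integral is a supremum over simple functions. *)
Lemma ge0_integral_eq_off d (T : measurableType d) (mu : {measure set T -> \bar R}) (Z : set T)
    (f g : T -> \bar R) : measurable Z -> mu Z = 0%E ->
  (forall x, 0 <= f x)%E -> (forall x, 0 <= g x)%E -> (forall x, ~ Z x -> f x = g x) ->
  (\int[mu]_x f x = \int[mu]_x g x)%E.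
Proof.
move=> mZ Z0.
suff le f' g' : (forall x, 0 <= f' x)%E -> (forall x, 0 <= g' x)%E -> (forall x, ~ Z x -> f' x = g' x) ->
    (\int[mu]_x f' x <= \int[mu]_x g' x)%E.
  move=> f0 g0 fg; apply/eqP; rewrite eq_le le//= le// => x /fg ->//.
move=> f0 g0 fg; rewrite ge0_integralTE//; apply: ge_ereal_sup => _ [h /= hf <-].
pose h' := proj_nnsfun h (measurableC mZ).
have -> : sintegral mu h = sintegral mu h'.
  rewrite -!integralT_nnsfun; apply: ge0_ae_eq_integral => //.
  - by apply/measurable_EFinP.
  - by apply/measurable_EFinP.
  - by move=> x _; rewrite lee_fin.
  - by move=> x _; rewrite lee_fin.
  exists Z; split => // x /=; apply: contra_notP => Zx _.
  by rewrite /h' /= mindicE mem_set// mulr1.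
rewrite ge0_integralTE//; apply: ereal_sup_ubound; exists h' => //= x.
have [Zx|Zx] := pselect (Z x).
  by rewrite mindicE memNset ?mulr0// => /(_ Zx).
by rewrite mindicE mem_set// mulr1 -fg.
Qed.

Lemma Rintegral_eq_off d (T : measurableType d) (mu : {measure set T -> \bar R}) (Z : set T)
    (f g : T -> R) : measurable Z -> mu Z = 0%E -> (forall x, ~ Z x -> f x = g x) ->
  \int[mu]_x f x = \int[mu]_x g x.
Proof.
move=> mZ Z0 fg; rewrite /Rintegral; congr fine.
rewrite integralE [RHS]integralE.
congr (_ - _)%E; apply: (ge0_integral_eq_off mZ Z0) => // x Zx.
- by rewrite !funeposE fg.
- by rewrite !funenegE fg.
Qed.

Lemma negligible_bigcup_countable d (T : measurableType d) (mu : {measure set T -> \bar R})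
    (I : countType) (Z : I -> set T) : (forall i, mu.-negligible (Z i)) ->
  mu.-negligible (\bigcup_i Z i).
Proof.
move=> Z0.
have -> : \bigcup_i Z i = \bigcup_(k : nat) (if unpickle k is Some i then Z i else set0).
  apply/seteqP; split => [x [i _ Zx]|x [k _]].
    by exists (pickle i); [exact: Logic.I|rewrite pickleK; exact: Zx].
  by case: (unpickle k) => // i Zx; exists i.
by apply: negligible_bigcup => k; case: (unpickle k) => [i|]; [exact: Z0|exact: negligible_set0].
Qed.

(** A function is determined by its sublevel sets at rational levels. Each of these is Borel up to a
    null set, and countably many null sets are collected into one, on which the function is set to
    0. *)
Lemma lebesgue_measurable_fun_borel n (r : 'rV[R]_n -> R) : lebesgue_measurable_fun r ->
  exists r' : 'rV[R]_n -> R, measurable_fun setT r' /\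
  exists Z, [/\ measurable Z, rVleb R n Z = 0%E & forall x, ~ Z x -> r x = r' x].
Proof.
move=> lr.
have /(_ _)/cid-/all_sig[A /(_ _)/cid-/all_sig[Z AZ]] : forall q : rat,
    exists A Z : set 'rV[R]_n, [/\ measurable A, measurable Z, rVleb R n Z = 0%E &
      forall x, ~ Z x -> (r x < ratr q <-> A x)].
  move=> q; have [A mA [N [Z [mZ Z0 NZ]] AN]] := lr _ (measurable_itv `]-oo, (ratr q : R)[).
  exists A, Z; split => // x Zx.
  have : (r @^-1` `]-oo, (ratr q : R)[%classic) x = (A `|` N) x by rewrite AN.
  rewrite /= in_itv/= => ->; split; last by left.
  by case => // /NZ.
pose U := \bigcup_q Z q.
have mU : measurable U by apply: bigcupT_measurable_rat => q; have [] := AZ q.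
have U0 : rVleb R n U = 0%E.
  apply/(negligibleP (rVleb R n) mU); apply: negligible_bigcup_countable => q.
  by have [_ mZ Z0 _] := AZ q; apply/(negligibleP (rVleb R n) mZ).
exists (fun x => if x \in U then 0 else r x); split; last first.
  by exists U; split => // x Ux; rewrite memNset.
apply: (measurability _ (RGenInftyO.measurableE R)) => _ [_ [a ->] <-].
(* Strict sublevel sets at the rationals [q <= a] exhaust the one at [a]. The modified function is 0
   on [U], so [U] belongs to the set at level [q] exactly when [0 < q]. *)
rewrite setTI (_ : _ @^-1` _ = \bigcup_(q : rat) ((if ratr q <= a then setT else set0) `&`
   ((A q `\` U) `|` (if 0 < ratr q :> R then U else set0)))).
  apply: bigcupT_measurable_rat => q; have [mA _ _ _] := AZ q.
  apply: measurableI; first by case: ifP.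
  apply: measurableU; first exact: measurableD.
  by case: ifP.
apply/seteqP; split => x.
  rewrite /= in_itv/= => xa.
  have [q] := rat_in_itvoo xa; rewrite in_itv/= => /andP[xq qa].
  exists q => //; rewrite ltW//; split => //; move: xq.
  have [Ux|Ux] := boolP (x \in U).
    by move=> ->; right; exact: set_mem.
  have {}Ux : ~ U x by move=> /mem_set; apply/negP.
  move=> xq; left; split => //; have [_ _ _ H] := AZ q.
  by apply/H => // Zx; apply: Ux; exists q.
move=> [q _ []]; case: ifP => // qa _ H; rewrite /= in_itv/=.
apply: lt_le_trans qa; case: H => [[Ax Ux]|].
  rewrite memNset//; have [_ _ _ H] := AZ q.
  by apply/H => // Zx; apply: Ux; exists q.
by case: ifP => // q0 Ux; rewrite mem_set.
Qed.

Lemma lebesgue_measurable_family_borel n (I : countType) (r : I -> 'rV[R]_n -> R) :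
  (forall i, lebesgue_measurable_fun (r i)) ->
  exists r' : I -> 'rV[R]_n -> R, (forall i, measurable_fun setT (r' i)) /\
  exists Z, [/\ measurable Z, rVleb R n Z = 0%E & forall x, ~ Z x -> forall i, r i x = r' i x].
Proof.
move=> lr.
have /(_ _)/cid-/all_sig[r' mr'] := fun i => lebesgue_measurable_fun_borel (lr i).
have /(_ _)/cid-/all_sig[Z rZ] := fun i => (mr' i).2.
exists r'; split; first by move=> i; exact: (mr' i).1.
have [U [mU U0 ZU]] : (rVleb R n).-negligible (\bigcup_i Z i).
  apply: negligible_bigcup_countable => i; have [mZ Z0 _] := rZ i.
  exact/(negligibleP (rVleb R n) mZ).
exists U; split => // x Ux i; have [_ _] := rZ i; apply => Zx.
by apply: Ux; apply: ZU; exists i.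
Qed.

End completed_measurability.

Section power_integral_bound.
Context d (T : measurableType d) {R : realType} (mu : {measure set T -> \bar R}) (s : R).
Hypothesis s_gt0 : 0 < s.

(** Measurability and sign are bundled with the bound so that sums can be estimated repeatedly. *)
Definition powR_integral_le (h : T -> R) (W : R) := [/\ measurable_fun setT h,
  forall z, 0 <= h z & (\int[mu]_z (h z `^ s)%:E <= W%:E)%E].

(** From [a + b <= 2 max(a, b)]; a cruder constant than convexity gives, but it only has to be
    finite. *)
Lemma powR_integral_leD h1 h2 W1 W2 : powR_integral_le h1 W1 -> powR_integral_le h2 W2 ->
  powR_integral_le (fun z => h1 z + h2 z) (2 `^ s * (W1 + W2)).
Proof.
move=> [m1 p1 l1] [m2 p2 l2]; split; first exact: measurable_funD.
  by move=> z; rewrite addr_ge0.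
apply: (@le_trans _ _ (\int[mu]_z (2 `^ s * (h1 z `^ s + h2 z `^ s))%:E)%E).
  apply: ge0_le_integralT => z; rewrite lee_fin ?powR_ge0//.
  have [le|le] := leP (h1 z) (h2 z).
    apply: (@le_trans _ _ ((2 * h2 z) `^ s)).
      apply: ge0_ler_powR; rewrite ?nnegrE ?addr_ge0 ?mulr_ge0 ?(ltW s_gt0)//.
      by rewrite mulrDl mul1r lerD2r.
    by rewrite powRM// ler_wpM2l ?powR_ge0// lerDr powR_ge0.
  apply: (@le_trans _ _ ((2 * h1 z) `^ s)).
    apply: ge0_ler_powR; rewrite ?nnegrE ?addr_ge0 ?mulr_ge0 ?(ltW s_gt0)//.
    by rewrite mulrDl mul1r lerD2l ltW.
  by rewrite powRM// ler_wpM2l ?powR_ge0// lerDl powR_ge0.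
rewrite ge0_integralRZl ?powR_ge0//; [|by move=> z; rewrite addr_ge0 ?powR_ge0|
  by apply: measurable_funD; exact: measurable_fun_powR].
rewrite ge0_integralRD//; [|by move=> z; exact: powR_ge0..|exact: measurable_fun_powR|exact: measurable_fun_powR].
by rewrite EFinM EFinD; apply: lee_wpmul2l; [rewrite lee_fin powR_ge0|exact: leeD].
Qed.

End power_integral_bound.

(** * Complex-valued functions *)

Section schwartz_fourier.
Context {R : realType} {n : nat}.
Local Notation mu := (rVleb R n).

Lemma schwartz_rapid (F : 'rV[R]_n -> R) : schwartz_real F -> rapid F.
Proof.
by move=> sF; split; [case: sF|move=> l; have [A _ FA] := schwartz_wt l sF; exists A].
Qed.

Lemma schwartz_measurable (F : 'rV[R]_n -> R) : schwartz_real F -> measurable_fun setT F.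
Proof. by move=> [sF _]; apply: rV_continuous_measurable; have [] := sF [::]. Qed.

Lemma schwartz_integrable (F : 'rV[R]_n -> R) : schwartz_real F -> integrableR mu F.
Proof.
move=> sF; have [A _ FA] := schwartz_wt [::] sF.
exact: integrable_wt_le (schwartz_measurable sF) FA.
Qed.

Variable f : 'rV[R]_n -> R[i].
Hypothesis sf : schwartz f.
Let f1 x := complex.Re (f x).
Let f2 x := complex.Im (f x).
Let sf1 : schwartz_real f1. Proof. exact: sf.1. Qed.
Let sf2 : schwartz_real f2. Proof. exact: sf.2. Qed.

Definition fourier_Re xi := cft f1 0 xi + cft f2 (- (pi / 2)) xi.
Definition fourier_Im xi := cft f2 0 xi - cft f1 (- (pi / 2)) xi.

Lemma cosB_pihalf (t : R) : cos (t + - (pi / 2)) = sin t.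
Proof. by rewrite cosB cos_pihalf sin_pihalf mulr0 add0r mulr1. Qed.

Lemma fourierE xi : fourier f xi = Complex (fourier_Re xi) (fourier_Im xi).
Proof.
have i1 c := integrable_cosphase c xi (schwartz_integrable sf1).
have i2 c := integrable_cosphase c xi (schwartz_integrable sf2).
rewrite /fourier /cintegral /fourier_Re /fourier_Im /cft.
rewrite -RintegralD// -RintegralB//; congr Complex; apply: eq_Rintegral => x _;
  rewrite cosB_pihalf addr0 /f1 /f2; case: (f x) => a b /=; rewrite cosN sinN; ring.
Qed.

Let mass := \int[mu]_x (f1 x ^+ 2) + \int[mu]_x (f2 x ^+ 2).

Let isqr g : schwartz_real g -> integrableR mu (fun x => g x ^+ 2).
Proof.
move=> sg; have [A A0 gA] := schwartz_wt [::] sg.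
apply: (integrableMbound (schwartz_integrable sg) (schwartz_measurable sg) (M := A)) => x.
by rewrite (le_trans (gA x))// ler_piMr// wt_le1.
Qed.

Lemma integral_normc_sqr : (\int[mu]_x (Normc.normc (f x) `^ 2)%:E = mass%:E)%E.
Proof.
rewrite /mass EFinD -!integral_EFinR; [|exact: isqr..].
rewrite -ge0_integralRD; [|by move=> x; exact: sqr_ge0|by move=> x; exact: sqr_ge0|
  by apply: measurable_funX; exact: schwartz_measurable..].
by apply: eq_integral => x _; rewrite normc_sqr.
Qed.

Lemma fourier_wt_le : exists2 A, 0 <= A & forall xi,
  `|fourier_Re xi| <= A * wt xi /\ `|fourier_Im xi| <= A * wt xi.
Proof.
have [A1 A10 H1] := schwartz_cft sf1; have [A2 A20 H2] := schwartz_cft sf2.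
exists (A1 + A2); first exact: addr_ge0.
move=> xi; split; first by rewrite (le_trans (ler_normD _ _))// [leRHS]mulrDl lerD.
by rewrite (le_trans (ler_normB _ _))// [leRHS]mulrDl addrC lerD.
Qed.

Lemma measurable_fourier_Re : measurable_fun setT fourier_Re.
Proof. by apply: measurable_funD; apply: measurable_cft; exact: schwartz_integrable. Qed.

Lemma measurable_fourier_Im : measurable_fun setT fourier_Im.
Proof. by apply: measurable_funB; apply: measurable_cft; exact: schwartz_integrable. Qed.

(** The factor 2 is that of [(p + q)^2 <= 2 (p^2 + q^2)]; [cft_sqr_le] then bounds each square. *)
Let sqr_combination (a b g : 'rV[R]_n -> R) : schwartz_real a -> schwartz_real b ->
  (forall x, `|g x| <= `|cft a 0 x| + `|cft b (- (pi / 2)) x|) -> measurable_fun setT g ->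
  integrableR mu (fun x => g x ^+ 2) ->
  \int[mu]_x (g x ^+ 2) <= 2 * (\int[mu]_x (a x ^+ 2) + \int[mu]_x (b x ^+ 2)).
Proof.
move=> sa sb gab mg ig; rewrite -lee_fin -integral_EFinR//.
have mcft (u : 'rV[R]_n -> R) c : schwartz_real u -> measurable_fun setT (fun x => cft u c x ^+ 2).
  by move=> su; apply: measurable_funX; apply: measurable_cft; exact: schwartz_integrable.
apply: (@le_trans _ _ (\int[mu]_x (2 * (cft a 0 x ^+ 2 + cft b (- (pi / 2)) x ^+ 2))%:E)%E).
  apply: ge0_le_integralT => x; rewrite lee_fin ?sqr_ge0//.
  rewrite -[leLHS]real_normK ?num_real// -(real_normK (num_real (cft a 0 x))).
  rewrite -(real_normK (num_real (cft b _ x))).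
  apply: (@le_trans _ _ ((`|cft a 0 x| + `|cft b (- (pi / 2)) x|) ^+ 2)).
    by rewrite ler_sqr ?nnegrE ?addr_ge0.
  by have := sqr_ge0 (`|cft a 0 x| - `|cft b (- (pi / 2)) x|); nra.
rewrite ge0_integralRZl//; [|by move=> x; rewrite addr_ge0 ?sqr_ge0|by apply: measurable_funD; exact: mcft].
rewrite ge0_integralRD//; [|by move=> x; exact: sqr_ge0..|exact: mcft|exact: mcft].
rewrite -[leRHS]/(2%:E * ((\int[mu]_x (a x ^+ 2))%:E + (\int[mu]_x (b x ^+ 2))%:E))%E.
apply: lee_wpmul2l; first by rewrite lee_fin.
by rewrite -(integral_EFinR (isqr sa)) -(integral_EFinR (isqr sb)); apply: leeD;
  apply: cft_sqr_le; exact: schwartz_integrable.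
Qed.

Let ifsqr (g : 'rV[R]_n -> R) A : measurable_fun setT g -> 0 <= A -> (forall x, `|g x| <= A * wt x) ->
  integrableR mu (fun x => g x ^+ 2).
Proof.
move=> mg A0 gA; apply: (integrableMbound (integrable_wt_le mg gA) mg (M := A)) => x.
by rewrite (le_trans (gA x))// ler_piMr// wt_le1.
Qed.

Lemma fourier_sqr_le : \int[mu]_x (fourier_Re x ^+ 2) <= 2 * mass /\
  \int[mu]_x (fourier_Im x ^+ 2) <= 2 * mass.
Proof.
have [A A0 H] := fourier_wt_le; split.
  apply: sqr_combination => //; first by move=> x; exact: ler_normD.
    exact: measurable_fourier_Re.
  by apply: (ifsqr measurable_fourier_Re A0) => x; exact: (H x).1.
rewrite /mass addrC; apply: sqr_combination => //; first by move=> x; exact: ler_normB.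
  exact: measurable_fourier_Im.
by apply: (ifsqr measurable_fourier_Im A0) => x; exact: (H x).2.
Qed.

End schwartz_fourier.

(** * The operator as a combination of real integrals *)

Section pseudo_differential.
Context {R : realType} {n : nat}.
Local Notation mu := (rVleb R n).
Local Notation muxt := (muxt R n).
Variable phi : 'rV[R]_n -> R.
Hypothesis cphi : continuous phi.
Variables (psi : 'rV[R]_n.+1 -> R[i]) (f : 'rV[R]_n -> R[i]).
Hypothesis spsi : schwartz psi.
Hypothesis sf : schwartz f.
Let psi1 x := complex.Re (psi x).
Let psi2 x := complex.Im (psi x).

Lemma pseudo_diff_eq_off r r' (Z : set 'rV[R]_n) z : measurable Z -> mu Z = 0%E ->
  (forall x, ~ Z x -> forall i, r i x = r' i x) ->
  pseudo_diff phi psi r f z = pseudo_diff phi psi r' f z.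
Proof.
move=> mZ Z0 rr'; rewrite /pseudo_diff /cintegral.
have E x : ~ Z x -> \row_i (r i x * rV_snoc z ord0 i) = \row_i (r' i x * rV_snoc z ord0 i) :> 'rV[R]_n.+1.
  by move=> Zx; apply/rowP => i; rewrite !mxE rr'.
by congr Complex; apply: (Rintegral_eq_off mZ Z0) => x Zx; rewrite E.
Qed.

Variable r : 'I_n.+1 -> 'rV[R]_n -> R.
Hypothesis mr : forall j, measurable_fun setT (r j).

Lemma integrable_damped (F : 'rV[R]_n.+1 -> R) (G : 'rV[R]_n -> R) (A c : R) (z : 'rV[R]_n * R) : schwartz_real F -> measurable_fun setT G ->
  (forall x, `|G x| <= A * wt x) ->
  integrableR mu (fun xi : 'rV[R]_n => F (\row_j (r j xi * rV_snoc z ord0 j)) * G xi *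
    cos (phase phi z xi + c)).
Proof.
move=> sF mG GA; have [B B0 FB] := schwartz_wt [::] sF.
have mrow : measurable_fun setT (fun xi : 'rV[R]_n => (\row_j (r j xi * rV_snoc z ord0 j) : 'rV[R]_n.+1)).
  by apply/measurable_fun_rVP => j; under eq_fun do rewrite mxE; exact: measurable_funM.
have iFG : integrableR mu (fun xi => G xi * F (\row_j (r j xi * rV_snoc z ord0 j))).
  apply: (integrableMbound (integrable_wt_le mG GA) (M := B)).
    exact: measurableT_comp (schwartz_measurable sF) mrow.
  by move=> x; rewrite (le_trans (FB _))// ler_piMr// wt_le1.
have := integrableMbound iFG (measurable_oscphase1 cphi c z) (fun x => cos_max _).
by apply: eq_integrable => // x _ /=; rewrite [G x * _]mulrC.
Qed.

Let g1 := fourier_Re f.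
Let g2 := fourier_Im f.
Let c0 : R := 0.
Let c1 : R := - (pi / 2).
Let T F g c z := damped phi F r g c z.

Lemma pseudo_diffE z : pseudo_diff phi psi r f z = Complex
  (T psi1 g1 c0 z - T psi2 g2 c0 z - (T psi1 g2 c1 z + T psi2 g1 c1 z))
  (T psi1 g1 c1 z - T psi2 g2 c1 z + (T psi1 g2 c0 z + T psi2 g1 c0 z)).
Proof.
have [A A0 gA] := fourier_wt_le sf.
have m1 := measurable_fourier_Re sf; have m2 := measurable_fourier_Im sf.
have i1 F c (sF : schwartz_real F) := integrable_damped c z sF m1 (fun x => (gA x).1).
have i2 F c (sF : schwartz_real F) := integrable_damped c z sF m2 (fun x => (gA x).2).
have [s1 s2] := spsi.
have a11 c := i1 _ c s1; have a12 c := i2 _ c s1.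
have a21 c := i1 _ c s2; have a22 c := i2 _ c s2.
have b c := integrableRB (a11 c) (a22 c); have d c := integrableRD (a12 c) (a21 c).
rewrite /pseudo_diff /cintegral /T /damped.
rewrite -(RintegralB measurableT (a11 c0) (a22 c0)) -(RintegralD measurableT (a12 c1) (a21 c1)).
rewrite -(RintegralB measurableT (b c0) (d c1)).
rewrite -(RintegralB measurableT (a11 c1) (a22 c1)) -(RintegralD measurableT (a12 c0) (a21 c0)).
rewrite -(RintegralD measurableT (b c1) (d c0)).
congr Complex; apply: eq_Rintegral => x _; 
  rewrite (fourierE sf) /c0 /c1 cosB_pihalf addr0;
  by case: (psi _) => p q /=; ring.
Qed.

Variable s : R.
Hypothesis s_gt0 : 0 < s.
Variable W : R.
Hypothesis TW : forall F g c, F = psi1 \/ F = psi2 -> g = g1 \/ g = g2 -> c = 0 \/ c = - (pi / 2) ->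
  (\int[muxt]_z (`|T F g c z| `^ s)%:E <= W%:E)%E.

(** The modulus is at most the sum of the eight absolute values in [pseudo_diffE]; three rounds of
    [powR_integral_leD] give [(2^s)^3 = 8^s] and eight copies of [W]. *)
Lemma pseudo_diff_powR_le :
  (\int[muxt]_z (Normc.normc (pseudo_diff phi psi r f z) `^ s)%:E <= (8 `^ s * (8 * W))%:E)%E.
Proof.
have [A A0 gA] := fourier_wt_le sf; have [s1 s2] := spsi.
have m1 := measurable_fourier_Re sf; have m2 := measurable_fourier_Im sf.
have P F g c : F = psi1 \/ F = psi2 -> g = g1 \/ g = g2 -> c = 0 \/ c = - (pi / 2) ->
    powR_integral_le muxt s (fun z => `|T F g c z|) W.
  move=> hF hg hc; split; [|by move=> z; exact: normr_ge0|exact: TW].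
  have rF : rapid F by case: hF => ->; exact: schwartz_rapid.
  apply: measurableT_comp => //.
  by case: hg => ->; [apply: (measurable_damped cphi rF mr m1 (A := A)) => x; exact: (gA x).1
                     |apply: (measurable_damped cphi rF mr m2 (A := A)) => x; exact: (gA x).2].
have PD := @powR_integral_leD _ _ _ muxt s s_gt0.
pose S2 F c z := `|T F g1 c z| + `|T F g2 c z|.
pose S4 c z := S2 psi1 c z + S2 psi2 c z.
pose S8 z := S4 c0 z + S4 c1 z.
have P2 F c : F = psi1 \/ F = psi2 -> c = 0 \/ c = - (pi / 2) ->
    powR_integral_le muxt s (S2 F c) (2 `^ s * (W + W)).
  by move=> hF hc; apply: PD; apply: P => //; [left|right].
have P4 c : c = 0 \/ c = - (pi / 2) -> powR_integral_le muxt s (S4 c) _ :=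
  fun hc => PD _ _ _ _ (P2 _ _ (or_introl erefl) hc) (P2 _ _ (or_intror erefl) hc).
have [_ _] : powR_integral_le muxt s S8 _ := PD _ _ _ _ (P4 _ (or_introl erefl)) (P4 _ (or_intror erefl)).
have -> : 2 `^ s * (2 `^ s * (2 `^ s * (W + W) + 2 `^ s * (W + W)) +
    2 `^ s * (2 `^ s * (W + W) + 2 `^ s * (W + W))) = 8 `^ s * (8 * W).
  have -> : 8 = 2 * 2 * 2 :> R by ring.
  by rewrite !powRM//; ring.
apply: le_trans; apply: ge0_le_integralT => z; first by rewrite lee_fin powR_ge0.
rewrite lee_fin; apply: ge0_ler_powR; rewrite ?nnegrE ?normc_ge0 ?(ltW s_gt0)//.
  by rewrite !addr_ge0.
have normc_le (a b : R) : Normc.normc (Complex a b) <= `|a| + `|b|.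
  rewrite /= -[leRHS]ger0_norm ?addr_ge0// -sqrtr_sqr ler_wsqrtr//.
  rewrite -(real_normK (num_real a)) -(real_normK (num_real b)).
  by have := mulr_ge0 (normr_ge0 a) (normr_ge0 b); nra.
rewrite pseudo_diffE (le_trans (normc_le _ _))//.
have n4 (a b c d : R) : `|a - b - (c + d)| <= `|a| + `|b| + (`|c| + `|d|).
  by rewrite (le_trans (ler_normB _ _))// lerD// ?ler_normB// ler_normD.
have n4' (a b c d : R) : `|a - b + (c + d)| <= `|a| + `|b| + (`|c| + `|d|).
  by rewrite (le_trans (ler_normD _ _))// lerD// ?ler_normB// ler_normD.
rewrite (le_trans (lerD (n4 _ _ _ _) (n4' _ _ _ _)))// /S8 /S4 /S2.
rewrite le_eqVlt; apply/orP; left; apply/eqP; ring.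
Qed.

End pseudo_differential.

Theorem corollary5 (R : realType) (n : nat) (n_ge1 : (1 <= n)%N)
    (phi : 'rV[R]_n -> R) (phi_smooth : smooth phi)
    (s : R) (s_gt2 : 2 < s)
    (strichartz : exists C : R, forall f : 'rV[R]_n -> R[i], schwartz f ->
      (cLnorm (lebesgue_xt R n) s%:E (evolution phi f)
        <= C%:E * cLnorm (lebesgue_rV R n) 2%:E f)%E)
    (psi : 'rV[R]_n.+1 -> R[i]) (psi_schwartz : schwartz psi) :
  exists C : R,
    forall r : 'I_n.+1 -> 'rV[R]_n -> R,
      (forall i, lebesgue_measurable_fun (r i)) ->
    forall f : 'rV[R]_n -> R[i], schwartz f ->
      (cLnorm (lebesgue_xt R n) s%:E (pseudo_diff phi psi r f)
        <= C%:E * cLnorm (lebesgue_rV R n) 2%:E f)%E.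
Proof.
have [C St] := strichartz.
have cphi : continuous phi by have [] := phi_smooth [::].
have s0 : 0 < s by exact: lt_trans s_gt2.
have [D D0 CK] := christ_kiselev s_gt2.
have [s1 s2] := psi_schwartz.
have [B1 B10 psiB1] := schwartz_wt (all_directions n.+1) s1.
have [B2 B20 psiB2] := schwartz_wt (all_directions n.+1) s2.
pose K := ((B1 + B2) * (\int[rVleb R n.+1]_u wt u)) `^ s * ((2 * D) ^+ n.+1 * strichartz_const s C).
have K0 : 0 <= K.
  by rewrite !mulr_ge0 ?powR_ge0 ?strichartz_const_ge0// exprn_ge0// mulr_ge0.
(* [8^s * 8] counts the eight real integrals and [2^(s/2)] comes from the factor 2 in
   [fourier_sqr_le]; everything in [W] is chosen before [r] and [f]. *)
pose W := 8 `^ s * (8 * (K * 2 `^ (s / 2))).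
have W0 : 0 <= W by do 3 (apply: mulr_ge0 => //; rewrite ?powR_ge0//).
exists (W `^ s^-1) => r lr f sf.
(* The Lebesgue measurable [r] are replaced by Borel functions that agree with them off one null set
   of frequencies and so define the same operator. *)
have [r' [mr' [Z [mZ Z0 rr']]]] := lebesgue_measurable_family_borel lr.
have -> : pseudo_diff phi psi r f = pseudo_diff phi psi r' f.
  by apply/funext => z; exact: pseudo_diff_eq_off rr'.
rewrite !cLnormE (integral_normc_sqr sf); set mass := _ + _.
have mass0 : 0 <= mass by rewrite addr_ge0//; apply: Rintegral_ge0 => x _; exact: sqr_ge0.
have [g1le g2le] := fourier_sqr_le sf; rewrite -/mass in g1le g2le.
have [A A0 gA] := fourier_wt_le sf.
rewrite poweR_EFin -EFinM.
(* [B1 + B2] bounds the mixed derivative of either component of [psi], so one constant covers every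
   choice of [F], [g] and [c]. *)
have TW F g c : F = (fun x => complex.Re (psi x)) \/ F = (fun x => complex.Im (psi x)) ->
    g = fourier_Re f \/ g = fourier_Im f -> c = 0 \/ c = - (pi / 2) ->
  (\int[muxt R n]_z (`|damped phi F r' g c z| `^ s)%:E <= (K * (2 * mass) `^ (s / 2))%:E)%E.
  move=> hF hg hc.
  have rF : rapid F by case: hF => ->; exact: schwartz_rapid.
  have FB u : `|mixed_partial F u| <= (B1 + B2) * wt u.
    case: hF => ->.
      by rewrite (le_trans (psiB1 u))// ler_wpM2r ?wt_ge0// lerDl.
    by rewrite (le_trans (psiB2 u))// ler_wpM2r ?wt_ge0// lerDr.
  have mg : measurable_fun setT g.
    by case: hg => ->; [exact: measurable_fourier_Re|exact: measurable_fourier_Im].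
  have gA' x : `|g x| <= A * wt x by case: hg => ->; have [] := gA x.
  apply: le_trans (damped_powR_le cphi rF mr' mg gA' s_gt2 St D0 CK FB hc) _.
  rewrite lee_fin ler_wpM2l//; apply: ge0_ler_powR; rewrite ?nnegrE ?mulr_ge0 ?divr_ge0 ?(ltW s0)//.
    by apply: Rintegral_ge0 => x _; exact: sqr_ge0.
  by case: hg => ->.
have := pseudo_diff_powR_le cphi psi_schwartz sf mr' s0 TW.
have -> : 8 `^ s * (8 * (K * (2 * mass) `^ (s / 2))) = W * mass `^ (s / 2).
  by rewrite powRM// /W; ring.
move=> H.
(* [mass] is the square of the L^2 norm of [f], and [(mass^(s/2))^(1/s) = mass^(1/2)]. *)
have -> : W `^ s^-1 * mass `^ 2^-1 = (W * mass `^ (s / 2)) `^ s^-1.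
  rewrite powRM ?powR_ge0// -powRrM; congr (_ * _ `^ _).
  by rewrite mulrAC mulfV ?mul1r// gt_eqF.
rewrite -poweR_EFin; apply: gt0_ler_poweR => //.
- by rewrite invr_ge0 ltW.
- rewrite in_itv/= leey andbT; apply: integral_ge0 => z _; by rewrite lee_fin powR_ge0.
- by rewrite in_itv/= leey andbT lee_fin mulr_ge0 ?powR_ge0.
Qed.
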